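(* Consider a sequence, indexed by $p\to\infty$, of rank-one tensor PCA models $\mathcal A=\mathcal T+\mathcal Z\in\mathbb R^{p_1\times p_2\times p_3}$, $\mathcal T=\lambda\,u\otimes v\otimes w$ with unit vectors $u,v,w$, $\lambda>0$, $\mathcal Z$ with i.i.d. $N(0,\sigma^2)$ entries, $p_j\asymp p$. Let $\hat\lambda,\hat u,\hat v,\hat w,\hat{\mathcal T}$ be the output of Algorithm 4 with $t_{\max}\ge C_1\log p$ for a suitable constant $C_1>0$. Fix $\alpha\in(0,1)$, let $z_{\alpha/2}=\Phi^{-1}(1-\alpha/2)$, $s(t)=\max\{t,\log(p)\sigma^2\hat\lambda^{-2}\}$ for $t\ge0$, and $$\widetilde{CI}_\alpha(\hat{\mathcal T}_{ijk})=\Big[\hat{\mathcal T}_{ijk}-z_{\alpha/2}\sigma S_{ijk},\ \hat{\mathcal T}_{ijk}+z_{\alpha/2}\sigma S_{ijk}\Big],\quad S_{ijk}=\sqrt{s(\hat u_i^2)s(\hat v_j^2)+s(\hat v_j^2)s(\hat w_k^2)+s(\hat w_k^2)s(\hat u_i^2)}.$$ If $\lambda/\sigma\gg p^{3/4}$ and $|u_i|,|v_j|,|w_k|\ll\min\{\lambda/(\sigma p),1/\sqrt{\log p}\}$ for indices $i\in[p_1],j\in[p_2],k\in[p_3]$, then $$\liminf_{p\to\infty}\mathbb P\big(\mathcal T_{ijk}\in\widetilde{CI}_\alpha(\hat{\mathcal T}_{ijk})\big)\ge1-\alpha.$$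
   Context: $u\otimes v\otimes w$ has entries $u_iv_jw_k$; $u_i$ denotes the $i$th entry of $u$. $\mathcal M_j$ is mode-$j$ matricization, and $\mathcal A\times_jx^\top$ contracts mode $j$ with vector $x$. $p=\max_jp_j$, $p_j\asymp p$ means comparable up to constant factors; $a\ll b$ means $a/b\to0$ and $a\gg b$ means $a/b\to\infty$ as $p\to\infty$. $\Phi$ is the standard normal CDF. Algorithm 4: $\hat u^{(0)},\hat v^{(0)},\hat w^{(0)}$ are the leading left singular vectors of $\mathcal M_1(\mathcal A),\mathcal M_2(\mathcal A),\mathcal M_3(\mathcal A)$; for $t=0,\dots,t_{\max}-1$, $\hat u^{(t+1)}$ is the normalization of $\mathcal A\times_2\hat v^{(t)\top}\times_3\hat w^{(t)\top}$, $\hat v^{(t+1)}$ of $\mathcal A\times_1\hat u^{(t)\top}\times_3\hat w^{(t)\top}$, $\hat w^{(t+1)}$ of $\mathcal A\times_1\hat u^{(t)\top}\times_2\hat v^{(t)\top}$; $\hat u=\hat u^{(t_{\max})}$, etc., $\hat\lambda=\mathcal A\times_1\hat u^\top\times_2\hat v^\top\times_3\hat w^\top$, $\hat{\mathcal T}=\hat\lambda\,\hat u\otimes\hat v\otimes\hat w$. Signs of $\hat u,\hat v,\hat w$ are chosen so that $\langle\hat u,u\rangle,\langle\hat v,v\rangle,\langle\hat w,w\rangle\ge0$ (this leaves $\hat{\mathcal T}$ unchanged). *)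

(* Defs.v *)
From HB Require Import structures.
From mathcomp Require Import all_boot all_order all_algebra.
From mathcomp Require Import all_classical all_reals all_analysis.
From mathcomp Require Import normal_distribution.

Set Implicit Arguments.
Unset Strict Implicit.
Unset Printing Implicit Defensive.

Import Order.TTheory GRing.Theory Num.Def Num.Theory.

Local Open Scope classical_set_scope.
Local Open Scope ring_scope.

Section TensorDefs.
Variable R : realType.

Definition vec (a : nat) := 'I_a -> R.
Definition tensor3 (a b c : nat) := 'I_a -> 'I_b -> 'I_c -> R.

Definition vnorm (a : nat) (x : vec a) : R := Num.sqrt (\sum_(i < a) x i ^+ 2).

(* normalization x / ||x|| (with the convention 0^-1 = 0) *)
Definition normalize (a : nat) (x : vec a) : vec a := fun i => x i / vnorm x.

Definition rank1 (a b c : nat) (lam : R) (u : vec a) (v : vec b) (w : vec c)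
  : tensor3 a b c := fun i j k => lam * u i * v j * w k.

Definition contr23 (a b c : nat) (A : tensor3 a b c) (v : vec b) (w : vec c) : vec a :=
  fun i => \sum_(j < b) \sum_(k < c) A i j k * v j * w k.
Definition contr13 (a b c : nat) (A : tensor3 a b c) (u : vec a) (w : vec c) : vec b :=
  fun j => \sum_(i < a) \sum_(k < c) A i j k * u i * w k.
Definition contr12 (a b c : nat) (A : tensor3 a b c) (u : vec a) (v : vec b) : vec c :=
  fun k => \sum_(i < a) \sum_(j < b) A i j k * u i * v j.

Definition contr123 (a b c : nat) (A : tensor3 a b c) (u : vec a) (v : vec b) (w : vec c) : R :=
  \sum_(i < a) \sum_(j < b) \sum_(k < c) A i j k * u i * v j * w k.

(* mode-j matricizations: rows indexed by mode j, columns by the pair of the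
   other two modes (column order is irrelevant for left singular vectors). *)
Definition mat1 (a b c : nat) (A : tensor3 a b c) : 'I_a -> 'I_b * 'I_c -> R :=
  fun i jk => A i jk.1 jk.2.
Definition mat2 (a b c : nat) (A : tensor3 a b c) : 'I_b -> 'I_a * 'I_c -> R :=
  fun j ik => A ik.1 j ik.2.
Definition mat3 (a b c : nat) (A : tensor3 a b c) : 'I_c -> 'I_a * 'I_b -> R :=
  fun k ij => A ij.1 ij.2 k.

Definition leading_lsv (m : nat) (C : finType) (M : 'I_m -> C -> R) (x : vec m) : Prop :=
  vnorm x = 1 /\
  forall y : vec m, vnorm y = 1 ->
    \sum_(c : C) (\sum_(i < m) y i * M i c) ^+ 2 <=
    \sum_(c : C) (\sum_(i < m) x i * M i c) ^+ 2.

Fixpoint power_iter (a b c : nat) (A : tensor3 a b c) (u0 : vec a) (v0 : vec b)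
    (w0 : vec c) (t : nat) : vec a * vec b * vec c :=
  match t with
  | 0 => (u0, v0, w0)
  | t'.+1 =>
    let: (u, v, w) := power_iter A u0 v0 w0 t' in
    (normalize (contr23 A v w), normalize (contr13 A u w), normalize (contr12 A u v))
  end.

Definition alg4 (a b c : nat) (A : tensor3 a b c) (u0 : vec a) (v0 : vec b)
    (w0 : vec c) (tmax : nat) : R * vec a * vec b * vec c :=
  let: (u, v, w) := power_iter A u0 v0 w0 tmax in
  (contr123 A u v w, u, v, w).

End TensorDefs.

Definition mutually_independent d (T : measurableType d) (R : realType)
    (P : probability T R) (I : finType) (X : I -> T -> R) : Prop :=
  forall (J : {set I}) (B : I -> set R), (forall i, measurable (B i)) ->
    P (\bigcap_(i in [set x | x \in J]) (X i @^-1` B i)) =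
    (\prod_(i in J) P (X i @^-1` B i))%E.

Definition std_normal_cdf (R : realType) (x : R) : \bar R :=
  normal_prob 0 1 `]-oo, x].

(* Main.v *)
Require Import Defs.
From HB Require Import structures.
From mathcomp Require Import all_boot all_order all_algebra.
From mathcomp Require Import all_classical all_reals all_analysis.
From mathcomp Require Import normal_distribution measurable_realfun.
From mathcomp Require Import ring lra.

Set Implicit Arguments.
Unset Strict Implicit.
Unset Printing Implicit Defensive.

Import Order.TTheory GRing.Theory Num.Def Num.Theory.

Local Open Scope classical_set_scope.
Local Open Scope ring_scope.

(* Divide by [lambda] and write [mu = lambda / sigma], so that the tensor is [u (x) v (x) w + E] with
   [E = W / mu] and [W] standard Gaussian.  With high probability [E] has injective norm
   [e = O(sqrt p / mu)], and its three Gram matrices are multiples of the identity up to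
   [O(p^(3/2) / mu^2)]; both follow from Gaussian tail bounds and a union bound over a finite grid.
   The second estimate gives the spectral initialization a constant correlation with the truth,
   because [mu >> p^(3/4)].  Every iterate is, up to scaling, [u + x] with [x] orthogonal to [u]; one
   step replaces [x] by [P E(., v + y, w + z) / (1 + theta)], [P] being the projection orthogonal to
   [u], which makes [x = O(e)] after one step and [x = P E(., v, w) + O(e^2)] after two.  Three steps
   thus suffice, which is less than [log p] once [p] is large.

   The third step shows that the entry [i] of [hat u] is proportional to
   [u_i + E(e_i, v, w) + remainder].  The only second-order terms of the remainder that are not
   products of scalar Gaussians are quadratic forms such as [<E(e_i, ., w), E(u, ., w)>], of size
   [(|u_i| p + sqrt p) / mu^2]; this is [o(1 / mu)] by incoherence, and the cubic terms [e^3] are [o(1 / mu)] because [mu >> p^(3/4)].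
   Hence [hat T_ijk - T_ijk] is [sigma] times an exact centred Gaussian linear form in [W] plus an
   error.  The truncation at level [log p / mu^2] makes [S_ijk] dominate both this error and,
   up to a factor [1 + o(1)], the standard deviation of the linear form. *)

(** * Gaussian laws, independence and convolution *)

(** The obstacle is that [hat v] and [hat w] depend on the noise they are contracted with. A bound
    uniform over all vectors gives only [e^2 = O(p / mu^2)] for the second-order part of an entry,
    which is not [o(1 / mu)] when [mu] lies between [p^(3/4)] and [p]. The second-order terms are
    therefore made explicit, as quadratic forms along fixed directions, and uniform bounds serve
    only from third order on, where [mu e^3 = O(p^(3/2) / mu^2)].

    Hence just two kinds of event are uniform over vectors, and these fail with probability
    exponentially small in [p]. What remains is a fixed number of scalars, each bounded by a
    constant [M] at a cost of order [eta] in probability. The constants are fixed in the order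
    [eta], [M], [tau], [kk], and [n] comes last.

    The noise of an entry is at most about [M / mu], whereas a truncated magnitude is at least about
    [sqrt (log p) / mu]; eventually [M^2 <= tau sqrt (log p)], and this is what makes [S_ijk]
    dominate. The linear form is exactly Gaussian for every [p], so no limit theorem enters. Signs
    of the estimates are never fixed: only magnitudes, and products in which the signs cancel,
    occur. *)

Section Gauss.
Variable R : realType.
Notation mu := (@lebesgue_measure R).
Implicit Types (m s : R) (B : set R).

Definition aff m s : measurableTypeR R -> measurableTypeR R := fun x => m + s * x.

Lemma measurable_aff m s : measurable_fun setT (aff m s).
Proof. by apply: measurable_funD => //; apply: measurable_funM. Qed.

Lemma aff_preimage_oc m s a b : 0 < s ->
  aff m s @^-1` `]a, b] = `](a - m) / s, (b - m) / s]%classic.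
Proof.
move=> s0; apply/seteqP; split => x; rewrite /aff /= !in_itv /= => /andP[h1 h2].
  by rewrite ltr_pdivrMr// ler_pdivlMr// mulrC ltrBlDl lerBrDl h1 h2.
move: h1 h2; rewrite ltr_pdivrMr// ler_pdivlMr// mulrC ltrBlDl lerBrDl => -> ->.
by [].
Qed.

(** The rescaled pushforward gives half-open intervals their length, and this determines Lebesgue
    measure. *)
Lemma lebesgue_measure_aff m s (s0 : 0 < s) B : measurable B ->
  (mu B = s%:E * mu (aff m s @^-1` B))%E.
Proof.
move=> mB.
have mf := measurable_aff m s.
pose nu := mscale (NngNum (ltW s0)) (measure_function_pushforward__canonical__measure_function_Measure mu mf).
have nuE A : nu A = (s%:E * mu (aff m s @^-1` A))%E by [].
rewrite -nuE; apply: lebesgue_measure_unique => //.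
move=> _ [[a b]] _ <-.
rewrite [RHS]nuE.
rewrite aff_preimage_oc//.
rewrite !lebesgue_measure_itv/= !lte_fin.
rewrite ltr_pM2r ?invr_gt0// ltrD2r; case: ifPn => _; last by rewrite mule0.
by rewrite -!EFinD -EFinM; congr (_%:E); field; rewrite gt_eqF.
Qed.

Lemma ge0_integral_aff m s (s0 : 0 < s) B (f : R -> \bar R) : measurable B ->
  measurable_fun B f -> (forall x, 0 <= f x)%E ->
  (\int[mu]_(x in B) f x = s%:E * \int[mu]_(x in aff m s @^-1` B) f (aff m s x))%E.
Proof.
move=> mB mf f0.
have ma := measurable_aff m s.
pose pm := measure_function_pushforward__canonical__measure_function_Measure mu ma.
have H1 : (\int[pm]_(x in B) f x = \int[mu]_(x in aff m s @^-1` B) f (aff m s x))%E.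
  by apply: (ge0_integral_pushforward ma) => //.
rewrite -H1.
have <- := (@ge0_integral_mscale _ _ R pm B mB (NngNum (ltW s0)) f mf (fun x _ => f0 x)).
apply: eq_measure_integral => A mA _; exact: lebesgue_measure_aff.
Qed.

Definition gauss1 : probability (measurableTypeR R) R := normal_prob 0 1.

Lemma gauss1E B : gauss1 B = (\int[mu]_(x in B) (normal_pdf 0 1 x)%:E)%E.
Proof. by []. Qed.

Lemma normal_pdf_aff m s (x : R) : 0 < s ->
  s * normal_pdf m s (aff m s x) = normal_pdf 0 1 x.
Proof.
move=> s0; have sn0 : s != 0 by rewrite gt_eqF.
rewrite (normal_pdfE _ sn0). rewrite (normal_pdfE _ (oner_neq0 R)) /aff /normal_peak.
rewrite mulrA /normal_fun subr0 addrAC subrr add0r !expr1n; congr (_ * _).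
  rewrite mul1r -mulrnAr sqrtrM ?sqr_ge0// sqrtr_sqr gtr0_norm//.
  by rewrite invfM mulrA divff// mul1r.
congr expR; rewrite exprMn -(mulr_natr (s ^+ 2)).
have : s * s != 0 by rewrite mulf_neq0.
by move=> ss0; field; rewrite ?sn0 ?ss0.
Qed.

Lemma normal_prob_aff m s B : 0 < s -> measurable B ->
  normal_prob m s B = gauss1 (aff m s @^-1` B).
Proof.
move=> s0 mB; rewrite gauss1E /normal_prob.
rewrite (@ge0_integral_aff m s)//; last 2 first.
- by apply/measurable_EFinP; apply: measurable_funTS; exact: measurable_normal_pdf.
- by move=> x; rewrite lee_fin normal_pdf_ge0.
have mA : measurable (aff m s @^-1` B).
  by rewrite -[X in measurable X]setTI; exact: measurable_aff.
rewrite -ge0_integralZl//; last 3 first.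
- apply/measurable_EFinP; apply: measurable_funTS.
  by apply: (measurableT_comp (measurable_normal_pdf _ _)); exact: measurable_aff.
- by move=> x _; rewrite lee_fin normal_pdf_ge0.
- by rewrite lee_fin ltW.
by apply: eq_integral => x _; rewrite -EFinM normal_pdf_aff.
Qed.

End Gauss.

(** * Independent families and their sums over blocks *)

Section Independence.
Variable R : realType.

Definition law := probability (measurableTypeR R) R.

Definition push d (T : measurableType d) (P : probability T R)
  (f : T -> measurableTypeR R) (mf : measurable_fun setT f) : law :=
  distribution P (mfun_Sub (mem_set mf)).

Lemma pushE d (T : measurableType d) (P : probability T R) f
  (mf : measurable_fun setT f) B : push P mf B = P (f @^-1` B).
Proof. by []. Qed.

Definition padd (z : measurableTypeR R * measurableTypeR R) : measurableTypeR R :=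
  z.1 + z.2.

Lemma measurable_padd : measurable_fun setT padd.
Proof. by apply: measurable_funD; [exact: measurable_fst|exact: measurable_snd]. Qed.

Definition conv (n1 n2 : law) : law := push (n1 \x n2)%E measurable_padd.

(** Conditionally on [E], the law of [(U, V)] agrees with the product law on rectangles, hence
    everywhere. Carrying [E] along allows two variables to be merged without losing their
    independence of the others, which [E] records. *)
Lemma pair_unique d (T : measurableType d) (P : probability T R) (E : set T)
    (U V : T -> R) (n1 n2 : law) :
  measurable E -> measurable_fun setT U -> measurable_fun setT V ->
  (forall B1 B2, measurable B1 -> measurable B2 ->
     P (E `&` U @^-1` B1 `&` V @^-1` B2) = (P E * (n1 B1 * n2 B2))%E) ->
  forall W : set (measurableTypeR R * measurableTypeR R), measurable W ->
    P (E `&` [set t | W (U t, V t)]) = (P E * (n1 \x n2) W)%E.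
Proof.
move=> mE mU mV H W mW.
have PEf : P E \is a fin_num by rewrite fin_num_measure.
have mUV : measurable_fun setT (fun t => (U t, V t) : measurableTypeR R * measurableTypeR R).
  exact: measurable_fun_pair.
have mWUV W' : measurable W' -> measurable [set t | W' (U t, V t)].
  by move=> mW'; rewrite -[X in measurable X]setTI; exact: mUV.
have [PE0|PE0] := eqVneq (P E) 0%E.
  rewrite PE0 mul0e; apply/eqP; rewrite eq_le measure_ge0 andbT.
  by rewrite -PE0 le_measure ?inE//; apply: measurableI => //; exact: mWUV.
have [e e0 PEe] : exists2 e : R, 0 < e & P E = e%:E.
  by exists (fine (P E)); rewrite ?fineK// fine_gt0// lt0e PE0 measure_ge0/= -ge0_fin_numE.
have kge0 : 0 <= e^-1 by rewrite invr_ge0 ltW.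
pose m1 := measure_function_pushforward__canonical__measure_function_Measure
  (mrestr P mE) mUV.
pose m2 : {measure set (measurableTypeR R * measurableTypeR R) -> \bar R} := mscale (NngNum kge0) m1.
have m2E W' : m2 W' = (e^-1%:E * P ([set t | W' (U t, V t)] `&` E))%E by [].
have m2U : forall A B, measurable A -> measurable B -> m2 (A `*` B) = (n1 A * n2 B)%E.
  move=> A B mA mB; rewrite m2E; set S := (X in (_ * P X)%E).
  have -> : S = E `&` U @^-1` A `&` V @^-1` B.
    rewrite /S; apply/seteqP; split => t.
      by move=> [[h1 h2] h3]; split.
    by move=> [[h1 h2] h3]; split.
  by rewrite H// PEe muleA -EFinM mulVf ?gt_eqF// mul1e.
rewrite (product_measure_unique m2U mW) m2E PEe muleA -EFinM.
by rewrite divff ?gt_eqF// mul1e setIC.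
Qed.

Lemma pair_conv d (T : measurableType d) (P : probability T R) (E : set T)
    (U V : T -> R) (n1 n2 : law) :
  measurable E -> measurable_fun setT U -> measurable_fun setT V ->
  (forall B1 B2, measurable B1 -> measurable B2 ->
     P (E `&` U @^-1` B1 `&` V @^-1` B2) = (P E * (n1 B1 * n2 B2))%E) ->
  forall B, measurable B ->
    P (E `&` (fun t => U t + V t) @^-1` B) = (P E * conv n1 n2 B)%E.
Proof.
move=> mE mU mV H B mB.
have mB' : measurable (padd @^-1` B).
  by rewrite -[X in measurable X]setTI; exact: measurable_padd.
by have := pair_unique mE mU mV H mB'.
Qed.

Section fam.
Variables (d : measure_display) (T : measurableType d) (P : probability T R).

(** Independence and marginal laws in one formula over the full index set: subfamilies and marginals
    are recovered by putting [setT] in the other slots. *)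
Definition ifam (I : finType) (X : I -> T -> R) (nu : I -> law) :=
  (forall i, measurable_fun setT (X i)) /\
  forall B : I -> set R, (forall i, measurable (B i)) ->
    P [set t | forall i, B i (X i t)] = (\prod_i nu i (B i))%E.

Lemma measurable_forall (I : finType) (Q : I -> Prop) (F : I -> set T) :
  (forall i, Q i -> measurable (F i)) -> measurable [set t | forall i, Q i -> F i t].
Proof. by move=> mF; apply: (@fin_bigcap_measurable _ _ I Q F). Qed.

Lemma ifam_ext (I : finType) (X Y : I -> T -> R) (nu : I -> law) :
  (forall i t, X i t = Y i t) -> ifam X nu -> ifam Y nu.
Proof. by move=> e; suff -> : X = Y by []; apply/funext => i; apply/funext => t. Qed.

Lemma ifam_map (I : finType) (X : I -> T -> R) (nu : I -> law)
    (f : I -> measurableTypeR R -> measurableTypeR R)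
    (mf : forall i, measurable_fun setT (f i)) :
  ifam X nu -> ifam (fun i t => f i (X i t)) (fun i => push (nu i) (mf i)).
Proof.
move=> [mX HX]; split => [i|B mB]; first exact: (measurableT_comp (mf i) (mX i)).
have mB' i : measurable (f i @^-1` B i).
  by rewrite -[X in measurable X]setTI; exact: (mf i measurableT _ (mB i)).
exact: (HX (fun i => f i @^-1` B i) mB').
Qed.

(* Absorbing the summands one at a time: after a list [L] has been processed, the partial block
   sums over [L] together with the [X i] for [i] outside [L] are independent.  [Q] is any
   property of laws that is additive under convolution. *)
Lemma ifam_block_sum (I C : finType) (X : I -> T -> R) (nu : I -> law)
    (g : I -> C) (Q : R -> law -> Prop) (a : I -> R) (n0 : law) :
  ifam X nu ->
  (forall B, measurable B -> n0 B = \d_(0 : R) B) -> Q 0 n0 ->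
  (forall r1 r2 n1 n2, Q r1 n1 -> Q r2 n2 -> Q (r1 + r2) (conv n1 n2)) ->
  (forall i, Q (a i) (nu i)) ->
  exists2 rho : C -> law, ifam (fun c t => \sum_(i | g i == c) X i t) rho
    & forall c, Q (\sum_(i | g i == c) a i) (rho c).
Proof.
move=> [mX HX] Hn0 Q0 Qadd Qa.
pose S (L : seq I) c t := \sum_(i <- L | g i == c) X i t.
have mS L c : measurable_fun setT (S L c).
  rewrite /S; elim: L => [|l L IH]; first by under eq_fun do rewrite big_nil; exact: measurable_cst.
  under eq_fun do rewrite big_cons.
  case: (g l == c) => //. exact: (measurable_funD (mX l) IH).
have key : forall L : seq I, uniq L -> exists2 rho : C -> law,
   (forall B D, (forall i, measurable (B i)) -> (forall c, measurable (D c)) ->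
      P [set t | (forall i, i \notin L -> B i (X i t)) /\ (forall c, D c (S L c t))] =
      (\prod_(i | i \notin L) nu i (B i) * \prod_c rho c (D c))%E)
   & forall c, Q (\sum_(i <- L | g i == c) a i) (rho c).
  elim => [_|l L IH /= /andP[lL uL]].
    exists (fun=> n0) => [B D mB mD|c]; last by rewrite big_nil.
    have [allD|nallD] := pselect (forall c, D c 0).
      rewrite [X in (_ * X)%E]big1 ?mule1; last first.
        move=> c _; by rewrite (Hn0 _ (mD c)) diracE (mem_set (allD c)).
     transitivity (P [set t | forall i, B i (X i t)]); last first.
        by rewrite (HX B mB); apply: eq_bigl => i; rewrite in_nil.
      congr (P _); apply/seteqP; split => [t /= [h _] i|t /= h]; first exact: h.
      by split=> [i _|c]; [exact: h|rewrite /S big_nil; exact: allD].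
    have [c nDc] : exists c, ~ D c 0 by apply/existsNP.
    transitivity (P set0); last first.
      rewrite measure0 (bigD1 c)//= (Hn0 _ (mD c)) diracE (memNset nDc) mul0e mule0 //.
    by congr (P _); apply/seteqP; split => [t /= [_ /(_ c)]|//]; rewrite /S big_nil.
  have {IH}[rho Hrho Qrho] := IH uL.
  exists (fun c => if g l == c then conv (nu l) (rho c) else rho c); last first.
    move=> c; rewrite big_cons; case: ifP => // _; exact: Qadd.
  move=> B D mB mD; set c0 := g l.
  pose E := [set t | (forall i, i \notin l :: L -> B i (X i t)) /\
                     (forall c, c != c0 -> D c (S L c t))].
  have mE : measurable E.
    apply: measurableI; apply: measurable_forall => i _.
      by rewrite -[X in measurable X]setTI; exact: mX.
    by rewrite -[X in measurable X]setTI; exact: mS.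
  (* [E] constrains everything except [X l] and the partial sum of its own block. The induction
     hypothesis is applied with [B1] and [B2] in these two slots; taking both to be [setT] reads off
     [P E], and the factorization becomes the hypothesis of [pair_conv]. *)
  have HE B1 B2 : measurable B1 -> measurable B2 ->
      P (E `&` X l @^-1` B1 `&` S L c0 @^-1` B2) =
      (nu l B1 * rho c0 B2 * (\prod_(i | i \notin l :: L) nu i (B i)
        * \prod_(c | c != c0) rho c (D c)))%E.
    move=> mB1 mB2.
    pose B' i := if i == l then B1 else B i.
    pose D' c := if c == c0 then B2 else D c.
    have mB' i : measurable (B' i) by rewrite /B'; case: ifP.
    have mD' i : measurable (D' i) by rewrite /D'; case: ifP.
    transitivity (P [set t | (forall i, i \notin L -> B' i (X i t)) /\
        (forall c, D' c (S L c t))]); last first.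
      have e1 : (\prod_(c | c != c0) rho c (D' c) = \prod_(c | c != c0) rho c (D c))%E.
        by apply: eq_bigr => c /negbTE; rewrite /D' => ->.
      have e2 : (\prod_(i | (i \notin L) && (i != l)) nu i (B' i) =
                 \prod_(i | i \notin l :: L) nu i (B i))%E.
        apply: eq_big => [i|i /andP[_ /negbTE]]; first by rewrite in_cons negb_or andbC.
        by rewrite /B' => ->.
      rewrite (Hrho _ _ mB' mD') (bigD1 l)// (bigD1 c0)// e1 e2 /B' /D' !eqxx.
      by rewrite !muleA; congr (_ * _)%E; rewrite -!muleA; congr (_ * _)%E; rewrite muleC.
    congr (P _); apply/seteqP; split => t /=.
      move=> [[[h1 h2] h3] h4]; split=> [i iL|c]; rewrite /B' /D'.
        by case: eqVneq => [->//|il]; apply: h1; rewrite in_cons negb_or il.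
      by case: eqVneq => [->//|]; exact: h2.
    move=> [h1 h2]; split; last by have := h2 c0; rewrite /D' eqxx.
    split; last by have := h1 l lL; rewrite /B' eqxx.
    split=> [i|c cc0]; last by have := h2 c; rewrite /D' (negbTE cc0).
    by rewrite in_cons negb_or => /andP[/negbTE il iL]; have := h1 i iL; rewrite /B' il.
  have HPE : P E = (\prod_(i | i \notin l :: L) nu i (B i)
        * \prod_(c | c != c0) rho c (D c))%E.
    have := HE _ _ measurableT measurableT.
    by rewrite !preimage_setT !setIT !probability_setT !mul1e.
  have := @pair_conv _ _ P E (X l) (S L c0) (nu l) (rho c0) mE (mX l) (mS L c0).
  have H2 B1 B2 : measurable B1 -> measurable B2 -> 
      P (E `&` X l @^-1` B1 `&` S L c0 @^-1` B2) = (P E * (nu l B1 * rho c0 B2))%E.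
    by move=> mB1 mB2; rewrite HE// HPE muleC.
  move=> /(_ H2 _ (mD c0)) H3; transitivity (P (E `&` (fun t => X l t + S L c0 t) @^-1` D c0)); last first.
    rewrite H3; rewrite HPE (bigD1 c0 (P := predT))//= eqxx.
    have -> : (\prod_(i | i != c0) (if c0 == i then conv (nu l) (rho i) else rho i) (D i)
               = \prod_(i | i != c0) rho i (D i))%E.
      by apply: eq_bigr => c /negbTE cc0; rewrite eq_sym cc0.
    by rewrite -muleA; congr (_ * _)%E; rewrite muleC.
  congr (P _); apply/seteqP; split => t /=; last first.
    move=> [[h1 h2] h3]; split => // c; rewrite /S big_cons -/c0.
    by case: eqVneq => [<-//|cc0]; apply: h2; rewrite eq_sym.
  move=> [h1 h2]; split; first split => //.
    move=> c cc0; have := h2 c; rewrite /S big_cons -/c0 eq_sym (negbTE cc0) //.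
  by have := h2 c0; rewrite /S big_cons -/c0 eqxx.
have [rho Hrho Qrho] := key (enum I) (enum_uniq I).
exists rho; last by move=> c; have := Qrho c; rewrite big_enum_cond.
split=> [c|D mD].
  by have := mS (enum I) c; congr (measurable_fun _ _); apply/funext => t;
    rewrite /S big_enum_cond.
have := Hrho (fun=> setT) D (fun=> measurableT) mD.
rewrite [X in (X * _)%E]big1 ?mul1e; last by move=> i; rewrite mem_enum.
move=> <-; congr (P _); apply/seteqP; split => t /=.
  by move=> h; split=> // c; have := h c; rewrite /S big_enum_cond.
by move=> [_ h] c; have := h c; rewrite /S big_enum_cond.
Qed.

End fam.
End Independence.

(** * Stability of centred Gaussian laws under convolution *)

Section GaussConv.
Variable R : realType.
Notation mu := (@lebesgue_measure R).
Local Notation gauss1 := (@gauss1 R).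

(** The law is given by integrals of its density over sets. Integrals of functions go through the
    Radon-Nikodym derivative, which equals the density almost everywhere because both have the same
    integral over every measurable set. *)
Lemma integral_gauss1 (f : R -> \bar R) :
  measurable_fun setT f -> (forall x, 0 <= f x)%E ->
  (\int[gauss1]_x f x = \int[mu]_x (f x * (normal_pdf 0 1 x)%:E))%E.
Proof.
move=> mf f0; have dom : gauss1 `<< mu by exact: normal_prob_dominates.
rewrite -(Radon_Nikodym_SigmaFinite.change_of_variables dom f0 measurableT mf).
have mpdf : measurable_fun setT (fun x : R => (normal_pdf 0 1 x)%:E).
  by apply/measurable_EFinP; exact: measurable_normal_pdf.
have mRN := measurable_int _ (Radon_Nikodym_SigmaFinite.f_integrable dom).
apply: ae_eq_integral => //.
- exact: emeasurable_funM.
- exact: emeasurable_funM.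
apply: ae_eqe_mul2l; apply: integral_ae_eq => //.
  exact: Radon_Nikodym_SigmaFinite.f_integrable.
by move=> E ET mE; rewrite -Radon_Nikodym_SigmaFinite.f_integral.
Qed.

(** Two factorizations of the joint density of [(X, s X + t Y)] for independent standard normals:
    the sum given [X], or [X] given the sum, with conditional mean [s z / r^2] and deviation
    [t / r]. The identity is completion of the square in [x]. *)
Lemma normal_pdf_conv (s t x z : R) : 0 < s -> 0 < t ->
  let r := Num.sqrt (s ^+ 2 + t ^+ 2) in
  normal_pdf 0 1 x * normal_pdf (s * x) t z =
  normal_pdf 0 r z * normal_pdf (s * z / r ^+ 2) (t / r) x.
Proof.
move=> s0 t0 r.
have r2 : r ^+ 2 = s ^+ 2 + t ^+ 2.
  by rewrite sqr_sqrtr// addr_ge0// sqr_ge0.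
have r0 : 0 < r by rewrite sqrtr_gt0 addr_gt0// exprn_gt0.
have tr0 : 0 < t / r by rewrite divr_gt0.
have t0' : t != 0 by rewrite gt_eqF.
have r0' : r != 0 by rewrite gt_eqF.
have tr0' : t / r != 0 by rewrite gt_eqF.
rewrite (normal_pdfE _ (oner_neq0 R)) (normal_pdfE _ t0') (normal_pdfE _ r0').
rewrite (normal_pdfE _ tr0') mulrACA [in RHS]mulrACA; congr (_ * _).
  rewrite /normal_peak -!invfM; congr (_^-1).
  have sq (y : R) : 0 < y -> Num.sqrt (y ^+ 2 * pi *+ 2) = y * Num.sqrt (pi *+ 2).
    by move=> y0; rewrite -mulrnAr sqrtrM ?sqr_ge0// sqrtr_sqr gtr0_norm.
  by rewrite !sq//; field.
rewrite /normal_fun -!expRD; congr expR.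
have st0 : s ^+ 2 + t ^+ 2 != 0 by rewrite -r2 expf_neq0.
rewrite expr1n subr0 !mulr2n expr_div_n r2.
field.
have s20 : 0 < s ^+ 2 by rewrite exprn_gt0.
have t20 : 0 < t ^+ 2 by rewrite exprn_gt0.
by rewrite !gt_eqF ?addr_gt0.
Qed.

(** A pushforward of [gauss1] by a scaling rather than a density, so that [a = 0] means the point
    mass at [0]: the law of an empty block sum, from which the absorption of summands starts. *)
Definition isgauss (a : R) (nu : law R) :=
  0 <= a /\ forall B, measurable B -> nu B = gauss1 (aff 0 (Num.sqrt a) @^-1` B).

Lemma measurable_aff_preimage (m s : R) (B : set (measurableTypeR R)) :
  measurable B -> measurable (aff m s @^-1` B).
Proof. by move=> mB; rewrite -[X in measurable X]setTI; exact: measurable_aff. Qed.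

Lemma integral_isgauss a nu (f : R -> \bar R) : isgauss a nu ->
  measurable_fun setT f -> (forall x, 0 <= f x)%E ->
  (\int[nu]_x f x = \int[gauss1]_x f (Num.sqrt a * x)%R)%E.
Proof.
move=> [a0 nuE] mf f0.
have ma := measurable_aff 0 (Num.sqrt a).
pose pm := measure_function_pushforward__canonical__measure_function_Measure gauss1 ma.
have -> : (\int[nu]_x f x = \int[pm]_x f x)%E.
  by apply: eq_measure_integral => A mA _; exact: nuE.
have -> : (\int[pm]_x f x = \int[gauss1]_x f (aff 0 (Num.sqrt a) x))%E.
  by apply: (ge0_integral_pushforward ma) => //.
by apply: eq_integral => x _; rewrite /aff add0r.
Qed.

(** After Tonelli, [normal_pdf_conv] leaves the conditional density of [x] given the sum as the
    inner integrand, and that integrates to one. *)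
Lemma gauss1_conv (s t : R) B : 0 < s -> 0 < t -> measurable B ->
  (\int[gauss1]_x gauss1 (aff (s * x)%R t @^-1` B) =
   gauss1 (aff 0 (Num.sqrt (s ^+ 2 + t ^+ 2)%R) @^-1` B))%E.
Proof.
move=> s0 t0 mB.
have r0 : 0 < Num.sqrt (s ^+ 2 + t ^+ 2).
  by rewrite sqrtr_gt0 addr_gt0// exprn_gt0.
rewrite -(normal_prob_aff 0 r0 mB).
under eq_integral do rewrite -(normal_prob_aff _ t0 mB).
rewrite integral_gauss1; last 2 first.
- pose W := [set w : measurableTypeR R * measurableTypeR R | B (s * w.1 + t * w.2)].
  have mW : measurable W.
    rewrite -[W]setTI; apply: (_ : measurable_fun setT
      (fun w : measurableTypeR R * measurableTypeR R => s * w.1 + t * w.2)) => //.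
    by apply: measurable_funD; apply: measurable_funM.
  have := measurable_fun_xsection gauss1 mW.
  congr (measurable_fun _ _); apply/funext => x /=.
  rewrite (normal_prob_aff _ t0 mB); congr (gauss1 _).
  by rewrite /xsection /aff; apply/seteqP; split => y /=; rewrite inE.
- by move=> x; exact: measure_ge0.
pose h (w : measurableTypeR R * measurableTypeR R) : \bar R :=
  (\1_B w.2 * (normal_pdf 0 1 w.1 * normal_pdf (s * w.1) t w.2))%:E.
have h0 w : (0 <= h w)%E by rewrite lee_fin !mulr_ge0// normal_pdf_ge0.
have mh : measurable_fun setT h.
  apply/measurable_EFinP; apply: measurable_funM.
    by apply: (measurableT_comp (measurable_indic _)) => //; exact: measurable_snd.
  apply: measurable_funM.
    by apply: (measurableT_comp (measurable_normal_pdf 0 1)); exact: measurable_fst.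
  rewrite (_ : (fun x => _) = (fun w : measurableTypeR R * measurableTypeR R => normal_pdf 0 t (w.2 - s * w.1))).
    apply: (measurableT_comp (measurable_normal_pdf 0 t)).
    by apply: measurable_funB; [exact: measurable_snd|apply: measurable_funM].
  apply/funext => w; rewrite !normal_pdfE ?gt_eqF//.
  by rewrite /normal_fun subr0.
transitivity (\int[mu]_x \int[mu]_z h (x, z))%E.
  apply: eq_integral => x _; rewrite /normal_prob integral_mkcond muleC.
  rewrite -ge0_integralZl//; last 3 first.
  - apply/(measurable_restrictT _ mB)/measurable_EFinP; apply: measurable_funTS.
    exact: measurable_normal_pdf.
  - by move=> z _; rewrite patchE; case: ifP => // _; rewrite lee_fin normal_pdf_ge0.
  - by rewrite lee_fin normal_pdf_ge0.
  apply: eq_integral => z _; rewrite /h /= patchE indicE.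
  by case: ifP => _; rewrite ?mule0 ?mul0r// mul1r -EFinM.
rewrite (fubini_tonelli h mh h0) /normal_prob [RHS]integral_mkcond.
apply: eq_integral => z _; rewrite /h/= patchE.
under eq_integral do rewrite normal_pdf_conv// indicE.
case: ifP => zB; last first.
  by under eq_integral do rewrite mul0r; rewrite integral0.
under eq_integral do rewrite mul1r EFinM.
rewrite ge0_integralZl//; last 3 first.
- by apply/measurable_EFinP; exact: measurable_normal_pdf.
- by move=> x _; rewrite lee_fin normal_pdf_ge0.
- by rewrite lee_fin normal_pdf_ge0.
by rewrite integral_normal_pdf mule1.
Qed.

Lemma conv_integral (n1 n2 : law R) B : measurable B ->
  (conv n1 n2 B = \int[n1]_x n2 [set y | B (x + y)%R])%E.
Proof.
move=> mB; have mW : measurable (@padd R @^-1` B).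
  by rewrite -[X in measurable X]setTI; exact: measurable_padd.
rewrite /conv pushE /product_measure1; apply: eq_integral => x _ /=.
by congr (n2 _); rewrite /xsection; apply/seteqP; split => y /=; rewrite inE.
Qed.

Lemma measurable_section_add (n2 : law R) B : measurable B ->
  measurable_fun setT (fun x : R => n2 [set y | B (x + y)]).
Proof.
move=> mB; have mW : measurable (@padd R @^-1` B).
  by rewrite -[X in measurable X]setTI; exact: measurable_padd.
have := measurable_fun_xsection n2 mW.
congr (measurable_fun _ _); apply/funext => x /=; congr (n2 _).
by rewrite /xsection; apply/seteqP; split => y /=; rewrite inE.
Qed.

Lemma isgauss_conv a b n1 n2 : isgauss a n1 -> isgauss b n2 ->
  isgauss (a + b) (conv n1 n2).
Proof.
move=> g1 g2; have [a0 n1E] := g1; have [b0 n2E] := g2.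
split; first exact: addr_ge0.
move=> B mB; rewrite conv_integral// (integral_isgauss g1); last 2 first.
- exact: measurable_section_add.
- by move=> x; exact: measure_ge0.
have mBs x : measurable [set y : R | B (x + y)].
  suff -> : [set y : R | B (x + y)] = aff x 1 @^-1` B.
    exact: measurable_aff_preimage.
  by apply/seteqP; split => y; rewrite /aff /= mul1r.
have E1 x : n2 [set y | B (Num.sqrt a * x + y)] =
    gauss1 (aff (Num.sqrt a * x) (Num.sqrt b) @^-1` B).
  rewrite (n2E _ (mBs _)); congr (gauss1 _); apply/seteqP.
  by split => y; rewrite /aff /= add0r.
under eq_integral do rewrite E1.
(* [gauss1_conv] works with densities and needs both deviations positive, so a vanishing variance,
   where that summand is the constant [0], is settled apart. *)
have [bE|bN0] := eqVneq b 0.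
  have E2 x : gauss1 (aff (Num.sqrt a * x) (Num.sqrt b) @^-1` B) =
      (\1_(aff 0 (Num.sqrt a) @^-1` B) x)%:E.
    rewrite bE sqrtr0 indicE; have [Bx|nBx] := pselect (B (Num.sqrt a * x)).
      rewrite mem_set; last by rewrite /= /aff add0r.
      rewrite -(@probability_setT _ _ _ gauss1); congr (gauss1 _).
      by apply/seteqP; split => y //= _; rewrite /aff mul0r addr0.
    rewrite memNset; last by rewrite /= /aff add0r.
    rewrite -[RHS](measure0 gauss1); congr (gauss1 _).
    by apply/seteqP; split => y //=; rewrite /aff mul0r addr0.
  under eq_integral do rewrite E2.
  rewrite integral_indic//; last exact: measurable_aff_preimage.
  by rewrite setIT bE addr0.
have [aE|aN0] := eqVneq a 0.
  rewrite aE sqrtr0 add0r.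
  under eq_integral do rewrite mul0r.
  transitivity (gauss1 (aff 0 (Num.sqrt b) @^-1` B) * gauss1 setT)%E.
    exact: (@integral_cst _ _ _ gauss1 _ measurableT).
  by rewrite (probability_setT gauss1) mule1.
rewrite gauss1_conv ?sqrtr_gt0 ?lt0r ?aN0 ?bN0//.
by rewrite !sqr_sqrtr.
Qed.

Lemma isgauss0 : isgauss 0 (\d_(0 : measurableTypeR R)).
Proof.
split=> // B mB; rewrite sqrtr0; transitivity (((0 : R) \in B)%:R%:E : \bar R).
  exact: diracE.
have [B0|nB0] := pselect (B 0).
  rewrite mem_set// -(@probability_setT _ _ _ gauss1); congr (gauss1 _).
  by apply/seteqP; split => y //= _; rewrite /aff mul0r addr0.
rewrite memNset// -[LHS](measure0 gauss1); congr (gauss1 _).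
by apply/seteqP; split => y //=; rewrite /aff mul0r addr0.
Qed.

End GaussConv.

(** * Moment generating functions and tail bounds *)

Section Tails.
Variable R : realType.
Notation mu := (@lebesgue_measure R).
Local Notation gauss1 := (@gauss1 R).

Lemma gauss1N (B : set (measurableTypeR R)) : measurable B ->
  gauss1 ((-%R : R -> R) @^-1` B) = gauss1 B.
Proof.
move=> mB; rewrite !gauss1E.
have mN : measurable_fun setT (-%R : measurableTypeR R -> measurableTypeR R).
  by apply: measurable_funN; exact: measurable_id.
pose pm := measure_function_pushforward__canonical__measure_function_Measure mu mN.
have mf : measurable_fun B (fun x : R => (normal_pdf 0 1 x)%:E).
  by apply: measurable_funTS; apply/measurable_EFinP; exact: measurable_normal_pdf.
have -> : (\int[mu]_(x in B) (normal_pdf 0 1 x)%:E = \int[pm]_(x in B) (normal_pdf 0 1 x)%:E)%E.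
  by apply: eq_measure_integral => A mA _; apply/esym; exact: lebesgue_measureN.
have H1 : (\int[pm]_(x in B) (normal_pdf 0 1 x)%:E =
   \int[mu]_(x in (-%R : R -> R) @^-1` B) (normal_pdf 0 1 (- x))%:E)%E.
  by apply: (ge0_integral_pushforward mN) => // y _; rewrite lee_fin normal_pdf_ge0.
rewrite H1; apply: eq_integral => x _; congr (_%:E).
by rewrite !(normal_pdfE _ (oner_neq0 R)) /normal_fun !subr0 sqrrN.
Qed.

(** [isgauss] scales by the nonnegative root of [b ^+ 2] only; a negative [b] is covered by the
    symmetry of the standard normal law. *)
Lemma isgauss_push_scale (b : R) (nu : law R)
    (mb : measurable_fun setT (fun x : measurableTypeR R => b * x : measurableTypeR R)) :
  (forall B, measurable B -> nu B = gauss1 B) -> isgauss (b ^+ 2) (push nu mb).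
Proof.
move=> nuE; split; first exact: sqr_ge0.
move=> B mB; have mB' : measurable ((fun x : R => b * x) @^-1` B).
  by rewrite -[X in measurable X]setTI; exact: mb.
rewrite pushE nuE// sqrtr_sqr; have [b0|b0] := leP 0 b.
  by rewrite ger0_norm//; congr (gauss1 _); apply/seteqP; split => x /=; rewrite /aff add0r.
rewrite ltr0_norm// -(gauss1N mB'); congr (gauss1 _).
by apply/seteqP; split => x /=; rewrite /aff add0r mulrN mulNr.
Qed.

(** Exponential tilting: up to a constant, [expR (b * x)] times the standard density is the density
    with mean [b]. *)
Lemma gauss1_mgf (b : R) : (\int[gauss1]_x (expR (b * x))%:E = (expR (b ^+ 2 / 2))%:E)%E.
Proof.
rewrite integral_gauss1; last 2 first.
- by apply/measurable_EFinP; apply: measurableT_comp => //; apply: measurable_funM.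
- by move=> x; rewrite lee_fin expR_ge0.
transitivity (\int[mu]_x ((expR (b ^+ 2 / 2))%:E * (normal_pdf b 1 x)%:E))%E.
  apply: eq_integral => x _; rewrite -!EFinM; congr (_%:E).
  rewrite !(normal_pdfE _ (oner_neq0 R)) mulrCA [in RHS]mulrCA; congr (_ * _).
  by rewrite /normal_fun -!expRD; congr expR; field.
rewrite ge0_integralZl//; last 2 first.
- by apply/measurable_EFinP; exact: measurable_normal_pdf.
- by move=> x _; rewrite lee_fin normal_pdf_ge0.
by rewrite integral_normal_pdf mule1.
Qed.

(** The weighted standard density is [q^-1] times the centred density of deviation [q^-1], where
    [q ^+ 2 = 1 - 2 * th]. *)
Lemma gauss1_sq_mgf (th : R) : th < 2^-1 ->
  (\int[gauss1]_x (expR (th * x ^+ 2))%:E = ((Num.sqrt (1 - 2 * th))^-1)%:E)%E.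
Proof.
move=> th2; have d0 : 0 < 1 - 2 * th by lra.
rewrite integral_gauss1; last 2 first.
- by apply/measurable_EFinP; apply: measurableT_comp => //; apply: measurable_funM => //; exact: exprn_measurable.
- by move=> x; rewrite lee_fin expR_ge0.
set q := Num.sqrt _.
have q0 : 0 < q by rewrite sqrtr_gt0.
have qV0 : q^-1 != 0 by rewrite invr_eq0 gt_eqF.
have q2 : q ^+ 2 = 1 - 2 * th by rewrite sqr_sqrtr// ltW.
transitivity (\int[mu]_x ((q^-1)%:E * (normal_pdf 0 q^-1 x)%:E))%E.
  apply: eq_integral => x _; rewrite -!EFinM; congr (_%:E).
  rewrite (normal_pdfE _ (oner_neq0 R)) (normal_pdfE _ qV0).
  rewrite mulrCA [in RHS]mulrA; congr (_ * _).
    rewrite /normal_peak.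
    have sq (y : R) : 0 < y -> Num.sqrt (y ^+ 2 * pi *+ 2) = y * Num.sqrt (pi *+ 2).
      by move=> y0; rewrite -mulrnAr sqrtrM ?sqr_ge0// sqrtr_sqr gtr0_norm.
    by rewrite !sq ?invr_gt0// mul1r invfM invrK mulrA mulVf ?mul1r ?gt_eqF.
  rewrite /normal_fun -!expRD; congr expR; rewrite subr0 exprVn q2.
  by field; rewrite ?gt_eqF//.
rewrite ge0_integralZl//; last 3 first.
- by apply/measurable_EFinP; exact: measurable_normal_pdf.
- by move=> x _; rewrite lee_fin normal_pdf_ge0.
- by rewrite lee_fin invr_ge0 ltW.
by rewrite integral_normal_pdf mule1.
Qed.

End Tails.

Section ExponentialMoments.
Variable R : realType.
Notation mu := (@lebesgue_measure R).
Local Notation gauss1 := (@gauss1 R).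

Lemma markov_gt1 (nu : law R) (f : R -> R) :
  measurable_fun setT f -> (forall x, 0 <= f x) ->
  (nu [set x | 1 < f x]%R <= \int[nu]_x (f x)%:E)%E.
Proof.
move=> mf f0.
have mE : measurable_fun [set: measurableTypeR R] (fun x : measurableTypeR R => (f x)%:E).
  exact/measurable_EFinP.
have := @le_integral_abse _ _ _ nu setT measurableT _ 1 mE ltr01.
rewrite mul1e setTI.
under [X in (_ <= X)%E]eq_integral do rewrite abse_EFin ger0_norm//.
apply: le_trans; apply: le_measure; rewrite ?inE.
- rewrite -[X in measurable X]setTI.
  by have := mf measurableT `]1, +oo[%classic (measurable_itv _);
    rewrite /preimage; under eq_set do rewrite /= in_itv /= andbT.
- rewrite -[X in measurable X]setTI; apply: emeasurable_fun_c_infty => //.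
  exact: measurableT_comp.
- by move=> x /= /ltW h; rewrite lee_fin ger0_norm.
Qed.

(** A logarithmic moment bound at one fixed [th]. In this form it is additive in [r] under
    convolution, as [ifam_block_sum] asks of the property it transports. *)
Definition mgf_le (th r : R) (nu : law R) :=
  (\int[nu]_x (expR (th * x))%:E <= (expR r)%:E)%E.

Lemma measurable_expRM (th : R) :
  measurable_fun [set: measurableTypeR R] (fun x : measurableTypeR R => (expR (th * x))%:E).
Proof. by apply/measurable_EFinP; apply: measurableT_comp => //; apply: measurable_funM. Qed.

Lemma mgf_le_conv th r1 r2 n1 n2 : mgf_le th r1 n1 -> mgf_le th r2 n2 ->
  mgf_le th (r1 + r2) (conv n1 n2).
Proof.
move=> H1 H2.
have mf := measurable_expRM th.
have f0 (x : R) : (0 <= (expR (th * x))%:E)%E by rewrite lee_fin expR_ge0.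
have E : (\int[conv n1 n2]_x (expR (th * x))%:E =
   \int[(n1 \x n2)]_z (expR (th * (z.1 + z.2)))%:E)%E.
  exact: (ge0_integral_pushforward (@measurable_padd R)).
rewrite /mgf_le E fubini_tonelli1; last 2 first.
- by apply: (measurableT_comp mf); exact: measurable_padd.
- by move=> z; rewrite lee_fin expR_ge0.
rewrite /fubini_F /=.
have E2 x : (\int[n2]_y (expR (th * (x + y)))%:E = (expR (th * x))%:E * \int[n2]_y (expR (th * y))%:E)%E.
  rewrite -(ge0_integralZl n2 measurableT mf (fun y _ => f0 y) (f0 x)).
  by apply: eq_integral => y _; rewrite mulrDr expRD EFinM.
under eq_integral do rewrite E2.
rewrite (ge0_integralZr n1 measurableT mf (fun y _ => f0 y)); last exact: integral_ge0.
by rewrite expRD EFinM; apply: lee_pmul => //; apply: integral_ge0.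
Qed.

Lemma mgf_le0 th : mgf_le th 0 (\d_(0 : measurableTypeR R)).
Proof.
rewrite /mgf_le; have := @integral_dirac _ _ (0 : measurableTypeR R) R setT measurableT _ (measurable_expRM th).
by move=> ->; rewrite diracT mul1e mulr0.
Qed.

(** Squared and inverted, the claim is [1 <= (1 - 2 th) exp(2 th + 8 th^2)]. By [1 + x <= exp x] the
    right side is at least [1 + 4 th^2 (1 - 4 th)], which is where [th <= 1/4] comes from. *)
Lemma exp_chi_bound (th : R) : `|th| <= 4^-1 ->
  expR (- th) / Num.sqrt (1 - 2 * th) <= expR (4 * th ^+ 2).
Proof.
rewrite ler_norml => /andP[h1 h2].
have d0 : 0 < 1 - 2 * th by lra.
rewrite ler_pdivrMr ?sqrtr_gt0// -ler_pdivrMl ?expR_gt0// -expRN -expRD.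
rewrite -(@ler_pXn2r _ 2) ?nnegrE ?expR_ge0 ?sqrtr_ge0// (sqr_sqrtr (ltW d0)).
rewrite -expRM_natl.
have h : 1 + (2 * th + 8 * th ^+ 2) <= expR (2 * th + 8 * th ^+ 2).
  exact: expR_ge1Dx.
rewrite (_ : 2%:R * (- (4 * th ^+ 2) - th) = - (2 * th + 8 * th ^+ 2)); last by ring.
rewrite expRN -[(expR _)^-1]mul1r ler_pdivrMr ?expR_gt0//.
apply: le_trans (_ : (1 - 2 * th) * (1 + (2 * th + 8 * th ^+ 2)) <= _); last first.
  by rewrite ler_pM2l.
suff : 0 <= th ^+ 2 * (1 - 4 * th) by nra.
by apply: mulr_ge0; [exact: sqr_ge0|lra].
Qed.

(** Chernoff's bound at parameter [t], once for each sign; for [t = 0] the bound on each side is the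
    trivial one. *)
Lemma gauss1_tail (t : R) : 0 <= t ->
  (gauss1 [set x : R | t < `|x|]%R <= (2 * expR (- (t ^+ 2 / 2)))%:E)%E.
Proof.
move=> t0.
have m1 (s : R) : measurable [set x : measurableTypeR R | t < s * x].
  rewrite -[X in measurable X]setTI.
  have ms : measurable_fun setT (fun x : measurableTypeR R => s * x : measurableTypeR R) by apply: measurable_funM.
  have := ms measurableT `]t, +oo[%classic (measurable_itv _).
  by rewrite /preimage; under eq_set do rewrite /= in_itv /= andbT.
have tail (s : R) : s ^+ 2 = 1 -> (gauss1 [set x | t < s * x]%R <= (expR (- (t ^+ 2 / 2)))%:E)%E.
  move=> s1; have [t00|tn0] := eqVneq t 0.
    have -> : - (t ^+ 2 / 2) = 0 by rewrite t00 expr0n mul0r oppr0.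
    by rewrite expR0; apply: probability_le1; exact: m1.
  have tgt : 0 < t by rewrite lt0r tn0.
  pose f x := expR (- t ^+ 2) * expR (t * s * x).
  have mf : measurable_fun [set: measurableTypeR R] (f : measurableTypeR R -> measurableTypeR R).
    apply: measurable_funM => //.
    by apply/measurable_EFinP; exact: measurable_expRM.
  have f0 x : 0 <= f x by rewrite /f mulr_ge0// expR_ge0.
  have -> : [set x | t < s * x] = [set x | 1 < f x].
    apply/seteqP; split => x /=; rewrite /f -expRD -expR0 ltr_expR.
      by move=> h; rewrite addrC subr_gt0 expr2 -mulrA ltr_pM2l.
    by rewrite addrC subr_gt0 expr2 -mulrA ltr_pM2l.
  apply: (le_trans (markov_gt1 _ mf f0)).
  rewrite /f; under eq_integral do rewrite EFinM.
  have ge0e x : (0 <= (expR (t * s * x))%:E)%E by rewrite lee_fin expR_ge0.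
  have ge0k : (0 <= (expR (- t ^+ 2))%:E)%E by rewrite lee_fin expR_ge0.
  rewrite (ge0_integralZl gauss1 measurableT (measurable_expRM (t * s)) (fun x _ => ge0e x) ge0k).
  rewrite gauss1_mgf -EFinM lee_fin -expRD ler_expR exprMn s1; lra.
have e : [set x : R | t < `|x|] `<=` [set x | t < 1 * x] `|` [set x | t < (-1) * x].
  move=> x /=; rewrite mul1r mulN1r; have [x0|x0] := leP 0 x.
    by rewrite ger0_norm//; left.
  by rewrite ltr0_norm//; right.
have m2 : measurable [set x : measurableTypeR R | t < `|x|].
  rewrite -[X in measurable X]setTI.
  have ms : measurable_fun setT (fun x : measurableTypeR R => `|x| : measurableTypeR R) by apply: measurableT_comp.
  have := ms measurableT `]t, +oo[%classic (measurable_itv _).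
  by rewrite /preimage; under eq_set do rewrite /= in_itv /= andbT.
apply: (le_trans (le_measure gauss1 _ _ e)); rewrite ?inE//.
  exact: measurableU.
apply: (le_trans (measureU2 _ _ _)) => //.
rewrite mulrDl mul1r EFinD; apply: leeD; apply: tail; by rewrite ?expr1n ?sqrrN ?expr1n.
Qed.

End ExponentialMoments.

Lemma measurable_gt_norm (R : realType) d (T : measurableType d) (Y : T -> R) (s : R) :
  measurable_fun setT Y -> measurable [set t | s < `|Y t|].
Proof.
move=> mY; rewrite -[X in measurable X]setTI.
have ms : measurable_fun setT (fun t => `|Y t|) by apply: measurableT_comp.
have := ms measurableT `]s, +oo[%classic (measurable_itv _).
by rewrite /preimage; under eq_set do rewrite /= in_itv /= andbT.
Qed.

Section StdFam.
Variables (R : realType) (d : measure_display) (T : measurableType d).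
Variable P : probability T R.
Local Notation gauss1 := (@gauss1 R).

Definition stdfam (I : finType) (X : I -> T -> R) := ifam P X (fun=> gauss1).

Lemma ifam_single (X : T -> R) (rho : unit -> law R) :
  ifam P (fun _ : unit => X) rho -> forall B, measurable B ->
  P [set t | B (X t)] = rho tt B.
Proof.
move=> [_ H] B mB; have := H (fun=> B) (fun=> mB).
rewrite (big_pred1 tt); last by case.
move=> <-; congr (P _); apply/seteqP; split => t /=; first by move=> h [].
by move=> /(_ tt).
Qed.

Lemma stdfam_block (I C : finType) (X : I -> T -> R) (g : I -> C) (b : I -> R) :
  stdfam X ->
  exists2 rho : C -> law R, ifam P (fun c t => \sum_(i | g i == c) b i * X i t) rho
    & forall c, isgauss (\sum_(i | g i == c) b i ^+ 2) (rho c).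
Proof.
move=> HX.
have mb i : measurable_fun setT (fun x : measurableTypeR R => b i * x : measurableTypeR R).
  exact: measurable_funM.
have H1 := ifam_map mb HX.
apply: (ifam_block_sum g (Q := @isgauss R) (a := fun i => b i ^+ 2)
  (n0 := \d_(0 : measurableTypeR R)) H1) => //.
- exact: isgauss0.
- by move=> *; exact: isgauss_conv.
- by move=> i; exact: isgauss_push_scale.
Qed.

Lemma linear_law (I : finType) (X : I -> T -> R) (b : I -> R) B :
  stdfam X -> measurable B ->
  P [set t | B (\sum_i b i * X i t)] =
  gauss1 (aff 0 (Num.sqrt (\sum_i b i ^+ 2)) @^-1` B).
Proof.
move=> HX mB.
have [rho Hrho gr] := stdfam_block (fun=> tt) b HX.
have Hs : ifam P (fun (_ : unit) t => \sum_i b i * X i t) rho.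
  by apply: ifam_ext Hrho => -[] t; apply: eq_bigl.
by rewrite (ifam_single Hs mB); have [_ ->] := gr tt.
Qed.

Lemma measurable_linear (I : finType) (X : I -> T -> R) (b : I -> R) :
  stdfam X -> measurable_fun setT (fun t => \sum_i b i * X i t).
Proof.
by move=> [mX _]; apply: measurable_sum => i; exact: measurable_funM.
Qed.

(** [A] is only an upper bound on the variance, so the coefficients may vanish while the exponent
    keeps its meaning. *)
Lemma linear_tail (I : finType) (X : I -> T -> R) (b : I -> R) (A s : R) :
  stdfam X -> \sum_i b i ^+ 2 <= A -> 0 < A -> 0 <= s ->
  (P [set t | s < `|\sum_i b i * X i t|]%R <= (2 * expR (- (s ^+ 2 / (2 * A))))%:E)%E.
Proof.
move=> HX bA A0 s0.
have mS (r : R) : measurable [set x : measurableTypeR R | r < `|x|].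
  by apply: (@measurable_gt_norm R _ (measurableTypeR R) (fun x => x) r); exact: measurable_id.
rewrite (linear_law b HX (mS s)).
have sA : 0 < Num.sqrt A by rewrite sqrtr_gt0.
have st0 : 0 <= s / Num.sqrt A by rewrite divr_ge0// ltW.
have := gauss1_tail st0.
rewrite expr_div_n sqr_sqrtr ?(ltW A0)// -mulrA -invfM (mulrC A).
apply: le_trans; apply: le_measure; rewrite ?inE.
- exact: measurable_aff_preimage.
- exact: mS.
- move=> x /=; rewrite /aff add0r normrM (ger0_norm (sqrtr_ge0 _)) => h.
  rewrite ltr_pdivrMr//; apply: (lt_le_trans h); rewrite mulrC ler_wpM2l//.
  by rewrite ler_sqrt// ltW.
Qed.

Definition csq (x : measurableTypeR R) : measurableTypeR R := x ^+ 2 - 1.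

Lemma measurable_csq : measurable_fun setT csq.
Proof. by apply: measurable_funB => //; exact: exprn_measurable. Qed.

Lemma csq_mgf (th : R) (nu : law R) : `|th| <= 4^-1 ->
  isgauss 1 nu -> mgf_le th (4 * th ^+ 2) (push nu measurable_csq).
Proof.
move=> th4 gnu; rewrite /mgf_le.
have h : th < 2^-1 by have := ler_norm th; lra.
have E : (\int[push nu measurable_csq]_x (expR (th * x))%:E = \int[nu]_x (expR (th * csq x))%:E)%E.
  apply: (ge0_integral_pushforward measurable_csq) => //.
  exact: measurable_expRM.
rewrite E (integral_isgauss gnu); last 2 first.
- exact: (measurableT_comp (measurable_expRM th) measurable_csq).
- by move=> x; rewrite lee_fin expR_ge0.
rewrite sqrtr1.
have mq : measurable_fun [set: measurableTypeR R] (fun x : measurableTypeR R => (expR (th * x ^+ 2))%:E).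
  exact: (measurableT_comp (measurable_expRM th) (@exprn_measurable R setT 2)).
have ge0q (x : R) : (0 <= (expR (th * x ^+ 2))%:E)%E by rewrite lee_fin expR_ge0.
have ge0k : (0 <= (expR (- th))%:E)%E by rewrite lee_fin expR_ge0.
rewrite (_ : (\int[gauss1]_x _)%E = (\int[gauss1]_x ((expR (- th))%:E * (expR (th * x ^+ 2))%:E))%E); last first.
  apply: eq_integral => x _; rewrite mul1r -EFinM -expRD /csq; congr ((expR _)%:E); ring.
rewrite (ge0_integralZl gauss1 measurableT mq (fun x _ => ge0q x) ge0k).
by rewrite gauss1_sq_mgf// -EFinM lee_fin exp_chi_bound.
Qed.

(* The block sums are independent standard normals, so the sum of squares is chi-square. *)
Lemma chi_tail (I C : finType) (X : I -> T -> R) (g : I -> C) (b : I -> R)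
    (th s : R) :
  stdfam X -> (forall c, \sum_(i | g i == c) b i ^+ 2 = 1) ->
  0 <= th <= 4^-1 ->
  (P [set t | s < `|\sum_c (\sum_(i | g i == c) b i * X i t) ^+ 2 - #|C|%:R|]%R
   <= (2 * expR (- (th * s) + 4 * th ^+ 2 * #|C|%:R))%:E)%E.
Proof.
move=> HX b1 /andP[th0 th4].
have [rho Hrho gr] := stdfam_block g b HX.
have gr1 c : isgauss 1 (rho c) by have := gr c; rewrite b1.
have H1 := ifam_map (fun=> measurable_csq) Hrho.
pose Y t := \sum_c csq (\sum_(i | g i == c) b i * X i t).
have YE t : Y t = \sum_c (\sum_(i | g i == c) b i * X i t) ^+ 2 - #|C|%:R.
  by rewrite /Y /csq big_split /= sumr_const -mulNrn.
have mY : measurable_fun setT Y.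
  by apply: measurable_sum => c; have [/(_ c)] := H1.
have tail th' : `|th'| <= 4^-1 ->
    (P [set t | 1 < expR (- `|th'| * s) * expR (th' * Y t)]%R
     <= (expR (- (`|th'| * s) + 4 * th' ^+ 2 * #|C|%:R))%:E)%E.
  move=> th'4.
  (* A second use of block summation: all centred squares form a single block, and the transported
     property is now the moment bound instead of Gaussianity. *)
  have [r2 Hr2 mr2] := ifam_block_sum (fun=> tt) (Q := mgf_le th')
    (a := fun=> 4 * th' ^+ 2) (n0 := \d_(0 : measurableTypeR R)) H1
    (fun B mB => erefl) (mgf_le0 th') (fun _ _ _ _ => @mgf_le_conv R th' _ _ _ _)
    (fun c => csq_mgf th'4 (gr1 c)).
  have Hs : ifam P (fun (_ : unit) => Y) r2.
    by apply: ifam_ext Hr2 => -[] t; apply: eq_bigl.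
  pose f x := expR (- `|th'| * s) * expR (th' * x).
  have mf : measurable_fun [set: measurableTypeR R] (f : measurableTypeR R -> measurableTypeR R).
    apply: measurable_funM => //.
    by apply/measurable_EFinP; exact: measurable_expRM.
  have f0 x : 0 <= f x by rewrite /f mulr_ge0// expR_ge0.
  have mfB : measurable [set x : measurableTypeR R | 1 < f x].
    rewrite -[X in measurable X]setTI.
    have := mf measurableT `]1, +oo[%classic (measurable_itv _).
    by rewrite /preimage; under eq_set do rewrite /= in_itv /= andbT.
  rewrite (ifam_single Hs mfB); apply: (le_trans (markov_gt1 _ mf f0)).
  rewrite /f; under eq_integral do rewrite EFinM.
  have ge0e x : (0 <= (expR (th' * x))%:E)%E by rewrite lee_fin expR_ge0.
  have ge0k : (0 <= (expR (- `|th'| * s))%:E)%E by rewrite lee_fin expR_ge0.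
  rewrite (ge0_integralZl _ measurableT (measurable_expRM th') (fun x _ => ge0e x) ge0k).
  rewrite expRD EFinM mulNr; apply: lee_pmul => //; first exact: integral_ge0.
  apply: (le_trans (mr2 tt)); rewrite lee_fin ler_expR.
  by rewrite (eq_bigl predT)// sumr_const mulr_natr.
have [th00|thn0] := eqVneq th 0.
  apply: (@le_trans _ _ 1%E).
    by apply: probability_le1; under eq_set do rewrite -YE; exact: measurable_gt_norm.
  rewrite th00 expr0n/= !(mul0r, mulr0) oppr0 add0r expR0 mulr1 lee_fin; lra.
have thgt0 : 0 < th by rewrite lt0r thn0.
have mset th' : measurable [set t | 1 < expR (- `|th'| * s) * expR (th' * Y t)].
  have mf : measurable_fun setT (fun t => expR (- `|th'| * s) * expR (th' * Y t)).
    apply: measurable_funM => //; apply: measurableT_comp => //.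
    exact: measurable_funM.
  rewrite -[X in measurable X]setTI.
  have := mf measurableT `]1, +oo[%classic (measurable_itv _).
  by rewrite /preimage; under eq_set do rewrite /= in_itv /= andbT.
apply: (@le_trans _ _ (P ([set t | 1 < expR (- `|th| * s) * expR (th * Y t)] `|`
     [set t | 1 < expR (- `|- th| * s) * expR (- th * Y t)]))).
  apply: le_measure; rewrite ?inE.
  - by under eq_set do rewrite -YE; exact: measurable_gt_norm.
  - exact: measurableU.
  move=> t /=; rewrite -YE normrN (ger0_norm th0) -!expRD -expR0 !ltr_expR => h.
  have [y0|y0] := leP 0 (Y t).
    by left; move: h; rewrite ger0_norm// => h; rewrite mulNr addrC subr_gt0 ltr_pM2l.
  by right; move: h; rewrite ltr0_norm// => h; rewrite !mulNr addrC -mulrN subr_gt0 ltr_pM2l.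
apply: (le_trans (measureU2 _ _ _)) => //.
rewrite mulrDl mul1r EFinD; apply: leeD.
  by apply: (le_trans (tail _ _)); rewrite ger0_norm.
by apply: (le_trans (tail _ _)); rewrite normrN ger0_norm// sqrrN.
Qed.

Lemma chi_tail_scaled (I C : finType) (X : I -> T -> R) (g : I -> C) (b : I -> R)
    (th s tau : R) :
  stdfam X -> 0 < tau -> (forall c, \sum_(i | g i == c) b i ^+ 2 = tau) ->
  0 <= th <= 4^-1 ->
  (P [set t | s * tau < `|\sum_c (\sum_(i | g i == c) b i * X i t) ^+ 2 - #|C|%:R * tau|]%R
   <= (2 * expR (- (th * s) + 4 * th ^+ 2 * #|C|%:R))%:E)%E.
Proof.
move=> HX tau0 bt th0.
pose b' i := b i / Num.sqrt tau.
have st2 : Num.sqrt tau ^+ 2 = tau by rewrite sqr_sqrtr// ltW.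
have st0 : Num.sqrt tau != 0 by rewrite gt_eqF// sqrtr_gt0.
have b'1 c : \sum_(i | g i == c) b' i ^+ 2 = 1.
  under eq_bigr do rewrite /b' expr_div_n st2.
  by rewrite -mulr_suml bt divff// gt_eqF.
have := chi_tail s HX b'1 th0; congr (_ <= _)%E; congr (P _).
apply/eq_set => t.
have -> : \sum_c (\sum_(i | g i == c) b' i * X i t) ^+ 2 =
   (\sum_c (\sum_(i | g i == c) b i * X i t) ^+ 2) / tau.
  rewrite mulr_suml; apply: eq_bigr => c _.
  rewrite -st2 -expr_div_n mulr_suml; congr (_ ^+ 2).
  by apply: eq_bigr => i _; rewrite /b' mulrAC.
rewrite -(ltr_pM2r tau0) -[X in _ < _ * X](gtr0_norm tau0) -normrM mulrBl divfK//.
by rewrite gt_eqF.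
Qed.

End StdFam.

(** * Grid nets and operator norms *)

Section Net.
Variable R : realType.

(* The net of radius-2 lattice points: an entry [(-1)^s k / sqrt m] is encoded by the pair [(s, k)],
   so that [gridvec] is not injective, which is harmless since only cardinality is bounded. *)
Definition digit m := (bool * 'I_(4 * m).+1)%type.
Definition grid m := {ffun 'I_m -> digit m}.
Definition ingrid m (f : grid m) := (\sum_i (f i).2 ^ 2 <= 4 * m)%N.
Definition gridvec m (f : grid m) : vec R m :=
  fun i => (-1) ^+ (f i).1 * (f i).2%:R / Num.sqrt m%:R.

Lemma gridvec_sqr_sum m (f : grid m) : ingrid f ->
  \sum_i gridvec f i ^+ 2 <= 4.
Proof.
move=> hf; have [m0|m0] := posnP m; first by subst m; rewrite big_ord0.
have m0' : 0 < m%:R :> R by rewrite ltr0n.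
rewrite (eq_bigr (fun i => ((f i).2 ^ 2)%:R / m%:R)); last first.
  move=> i _; rewrite /gridvec expr_div_n sqr_sqrtr ?ler0n// exprMn sqrr_sign.
  by rewrite mul1r natrX.
by rewrite -mulr_suml ler_pdivrMr// -natr_sum -natrM ler_nat.
Qed.

Lemma int_near (y : R) (up : bool) : exists k : int,
  `|k%:~R - y| <= 1 /\ (if up then y <= k%:~R else k%:~R <= y).
Proof.
have /andP[h1 h2] := floor_itv y.
case: up; [exists (Num.floor y + 1)|exists (Num.floor y)]; split => //; try exact: ltW.
  by move: h1 h2; rewrite intrD ler_norml => h1 h2; apply/andP; split; lra.
by move: h1 h2; rewrite intrD ler_norml => h1 h2; apply/andP; split; lra.
Qed.

(** Each [x i * sqrt m] is moved to a neighbouring integer in the direction given by the sign of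
    [a i], so no term of the linear form decreases. With [K] the integer and [y] the number,
    [K^2 <= 2 y^2 + 2], and the sum over [i] is at most [4 m]. *)
Lemma round_grid m (x a : vec R m) : \sum_i x i ^+ 2 <= 1 ->
  exists2 f : grid m, ingrid f & \sum_i a i * x i <= \sum_i a i * gridvec f i.
Proof.
move=> hx; have [m0|m0] := posnP m.
  by subst m; exists [ffun=> (false, ord0)]; rewrite /ingrid ?big_ord0.
have m0' : 0 < m%:R :> R by rewrite ltr0n.
have sm0 : 0 < Num.sqrt m%:R :> R by rewrite sqrtr_gt0.
have [k Hk] := choice (fun i => int_near (x i * Num.sqrt m%:R) (0 <= a i)).
have ksum : (\sum_i `|k i|%N ^ 2 <= 4 * m)%N.
  rewrite -(ler_nat R) natr_sum natrM.
  apply: (@le_trans _ _ (\sum_(i < m) (2 * m%:R * x i ^+ 2 + 2))); last first.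
    by rewrite big_split /= -mulr_sumr sumr_const card_ord -mulr_natr; nra.
  apply: ler_sum => i _; have [hKy _] := Hk i.
  rewrite natrX natr_absz intr_norm -normrX ger0_norm ?sqr_ge0//.
  move: hKy; set K := (k i)%:~R; set y := x i * _ => hKy.
  have y2 : y ^+ 2 = m%:R * x i ^+ 2 by rewrite exprMn sqr_sqrtr ?ler0n// mulrC.
  rewrite -mulrA -y2.
  have : (K - y) ^+ 2 <= 1.
    move: hKy; rewrite ler_norml => /andP[h1 h2].
    have : 0 <= (1 - (K - y)) * (1 + (K - y)) by apply: mulr_ge0; lra.
    by nra.
  by move=> h; have := sqr_ge0 (K - 2 * y); nra.
(* A natural number is at most its square, so the bound on the sum of squares already makes every
   digit fit in ['I_(4 * m).+1]. *)
have kb i : (`|k i| <= 4 * m)%N.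
  apply: leq_trans ksum; rewrite (bigD1 i)//=; apply: leq_trans (leq_addr _ _).
  by case: `|k i|%N => // n; rewrite expnS leq_pmulr// expn_gt0.
exists [ffun i => (k i < 0, inord `|k i|%N)].
  by rewrite /ingrid; under eq_bigr do rewrite ffunE /= inordK ?ltnS//.
apply: ler_sum => i _; rewrite /gridvec ffunE /= inordK ?ltnS//.
have -> : (-1) ^+ (k i < 0)%R * `|k i|%:R = (k i)%:~R :> R.
  rewrite natr_absz intr_norm; case: (ltrP (k i) 0) => h /=.
    by rewrite expr1 mulN1r ltr0_norm ?opprK// ltrz0.
  by rewrite expr0 mul1r ger0_norm// ler0z.
have [_] := Hk i; case: (leP 0 (a i)) => a0 h.
  by rewrite ler_wpM2l// ler_pdivlMr.
by rewrite ler_wnM2l ?(ltW a0)// ler_pdivrMr.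
Qed.

Lemma geom_half n : \sum_(i < n) (2^-1 : R) ^+ i <= 2.
Proof.
suff -> : \sum_(i < n) (2^-1 : R) ^+ i = 2 - 2 * 2^-1 ^+ n.
  by rewrite gerBl mulr_ge0// exprn_ge0// invr_ge0.
elim: n => [|n IH]; first by rewrite big_ord0 expr0; ring.
by rewrite big_ord_recr /= IH exprS; field.
Qed.

(** Counting by weights: on the grid [sum k_i <= sum k_i^2 <= 4 m], so
    [2^(4 m) prod 2^(- k_i) >= 1]. Summed over all digits, each coordinate contributes at most [4]
    (two signs, a geometric series), whence [2^(4 m) 4^m]. *)
Lemma card_grid m : #|[pred f : grid m | ingrid f]|%:R <= 2 ^+ (6 * m) :> R.
Proof.
have e (f : grid m) : ingrid f ->
    1 <= (2 : R) ^+ (4 * m) * \prod_i 2^-1 ^+ (f i).2.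
  move=> hf; rewrite prodrXr exprVn ler_pdivlMr ?exprn_gt0// mul1r.
  rewrite ler_eXn2l ?ltr1n//; apply: leq_trans hf; apply: leq_sum => i _.
  by case: (nat_of_ord (f i).2) => // n; rewrite expnS leq_pmulr// expn_gt0.
rewrite -sum1_card natr_sum.
apply: (@le_trans _ _ (\sum_(f : grid m) (2 : R) ^+ (4 * m) * \prod_i 2^-1 ^+ (f i).2)).
  rewrite big_mkcond /=; apply: ler_sum => f _; rewrite inE; case: ifP => [/e//|_].
  by rewrite mulr_ge0 ?exprn_ge0// prodr_ge0// => i _; rewrite exprn_ge0// invr_ge0.
rewrite -mulr_sumr.
have -> : \sum_(f : grid m) \prod_i (2^-1 : R) ^+ (f i).2 =
   \prod_(i < m) \sum_(c : digit m) 2^-1 ^+ c.2.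
  by rewrite (bigA_distr_bigA (fun (_ : 'I_m) (c : digit m) => (2^-1 : R) ^+ c.2)).
rewrite (_ : 6 * m = 4 * m + 2 * m)%N; last by rewrite -mulnDl.
rewrite exprD ler_pM2l ?exprn_gt0// exprM -[m in leRHS]card_ord -prodr_const.
apply: ler_prod => i _; apply/andP; split.
  by apply: sumr_ge0 => c _; rewrite exprn_ge0// invr_ge0.
have -> : \sum_(c : digit m) (2^-1 : R) ^+ c.2 = \sum_(s : bool) \sum_(n < (4 * m).+1) (2^-1) ^+ n.
  by rewrite pair_big /=; apply: eq_bigr => -[].
rewrite sumr_const card_bool mulr2n.
have := geom_half (4 * m).+1; rewrite expr2; lra.
Qed.

End Net.

(** * Contractions, injective norm and Gram forms *)

Section Tensor.
Variable R : realType.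

Definition dot m (x y : vec R m) : R := \sum_i x i * y i.
Definition nrm2 m (x : vec R m) : R := \sum_i x i ^+ 2.

(** These bring mode 2 or 3 to the front. [perm13] is a cyclic shift, not a transposition: [i] stays
    before [j], so that [contr12] and [mat3] of a tensor are, by conversion, [contr23] and (up to
    names of indices) [mat1] of its shift. Every mode-1 lemma thereby serves all three modes. *)
Definition perm12 a b c (E : tensor3 R a b c) : tensor3 R b a c := fun j i k => E i j k.
Definition perm13 a b c (E : tensor3 R a b c) : tensor3 R c a b := fun k i j => E i j k.
Definition perm23 a b c (E : tensor3 R a b c) : tensor3 R a c b := fun i k j => E i j k.

Section contr.
Variables (a b c : nat).
Implicit Types (E : tensor3 R a b c) (x : vec R a) (y : vec R b) (z : vec R c).

Lemma contr123_dot1 E x y z : contr123 E x y z = dot x (contr23 E y z).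
Proof.
rewrite /contr123 /dot; apply: eq_bigr => i _; rewrite /contr23 mulr_sumr.
apply: eq_bigr => j _; rewrite mulr_sumr; apply: eq_bigr => k _; ring.
Qed.

Lemma contr123_perm12 E x y z : contr123 (perm12 E) y x z = contr123 E x y z.
Proof.
rewrite /contr123 exchange_big /=; apply: eq_bigr => i _; apply: eq_bigr => j _.
by apply: eq_bigr => k _; rewrite /perm12; ring.
Qed.

Lemma contr123_perm23 E x y z : contr123 (perm23 E) x z y = contr123 E x y z.
Proof.
rewrite /contr123; apply: eq_bigr => i _; rewrite exchange_big /=; apply: eq_bigr => j _.
by apply: eq_bigr => k _; rewrite /perm23; ring.
Qed.

End contr.

Lemma contr123_dot2 a b c (E : tensor3 R a b c) x y z : contr123 E x y z = dot y (contr13 E x z).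
Proof. by rewrite -contr123_perm12 contr123_dot1. Qed.

Lemma contr123_perm13 a b c (E : tensor3 R a b c) x y z :
  contr123 (perm13 E) z x y = contr123 E x y z.
Proof. by rewrite -(contr123_perm12 (perm13 E)); exact: contr123_perm23. Qed.

Lemma contr123_dot3 a b c (E : tensor3 R a b c) x y z :
  contr123 E x y z = dot z (contr12 E x y).
Proof. by rewrite -contr123_perm13 contr123_dot1. Qed.

Definition opn a b c (E : tensor3 R a b c) (s : R) :=
  forall x y z, nrm2 x <= 1 -> nrm2 y <= 1 -> nrm2 z <= 1 -> `|contr123 E x y z| <= s.

Lemma nrm2N m (x : vec R m) : nrm2 (fun i => - x i) = nrm2 x.
Proof. by apply: eq_bigr => i _; rewrite sqrrN. Qed.

Lemma dotNl m (x y : vec R m) : dot (fun i => - x i) y = - dot x y.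
Proof. by rewrite /dot -sumrN; apply: eq_bigr => i _; rewrite mulNr. Qed.

Lemma round_dot m (x y : vec R m) : nrm2 x <= 1 ->
  exists2 f : grid m, ingrid f & dot x y <= dot (gridvec R f) y.
Proof.
move=> hx; have [f hf h] := round_grid y hx; exists f => //.
by rewrite /dot; under eq_bigr do rewrite mulrC; under [leRHS]eq_bigr do rewrite mulrC.
Qed.

(* Each slot is rounded to the grid in the direction that increases the linear form in it, so no
   approximation error arises. *)
Lemma opn_net a b c (E : tensor3 R a b c) (s : R) :
  (forall f g h, ingrid f -> ingrid g -> ingrid h ->
     `|contr123 E (gridvec R f) (gridvec R g) (gridvec R h)| <= s) -> opn E s.
Proof.
move=> H.
have key x y z : nrm2 x <= 1 -> nrm2 y <= 1 -> nrm2 z <= 1 -> contr123 E x y z <= s.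
  move=> x1 y1 z1; rewrite contr123_dot1.
  have [f hf /le_trans-> //] := round_dot (contr23 E y z) x1.
  rewrite -contr123_dot1 contr123_dot2.
  have [g hg /le_trans-> //] := round_dot (contr13 E (gridvec R f) z) y1.
  rewrite -contr123_dot2 contr123_dot3.
  have [h hh /le_trans-> //] := round_dot (contr12 E (gridvec R f) (gridvec R g)) z1.
  by rewrite -contr123_dot3 (le_trans (ler_norm _))// H.
move=> x y z x1 y1 z1; rewrite ler_norml key// andbT lerNl.
by rewrite contr123_dot1 -dotNl -contr123_dot1 key// nrm2N.
Qed.

Definition gram m (C : finType) (M : 'I_m -> C -> R) (x : vec R m) : R :=
  \sum_c (\sum_i x i * M i c) ^+ 2.

(* By polarization: a quadratic form is bounded through its bilinear form, rounded slot by slot. *)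
Lemma gram_net m (C : finType) (M : 'I_m -> C -> R) (q D : R) :
  (forall f g : grid m, ingrid f -> ingrid g -> forall e : bool,
    let s := fun i => gridvec R f i + (-1) ^+ e * gridvec R g i in
    `|gram M s - q * nrm2 s| <= D) ->
  forall x, nrm2 x <= 1 -> `|gram M x - q * nrm2 x| <= D / 2.
Proof.
move=> H.
pose L (y : vec R m) : vec R m := fun i => \sum_c M i c * (\sum_l y l * M l c) - q * y i.
have BE x y : dot x (L y) = \sum_c (\sum_i x i * M i c) * (\sum_l y l * M l c) - q * dot x y.
  rewrite /dot /L; under eq_bigr do rewrite mulrBr mulr_sumr.
  rewrite sumrB; congr (_ - _).
    rewrite exchange_big /=; apply: eq_bigr => c _; rewrite mulr_suml.
    by apply: eq_bigr => i _; rewrite mulrA.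
  by rewrite mulr_sumr; apply: eq_bigr => i _; rewrite mulrCA.
have Bsym x y : dot x (L y) = dot y (L x).
  rewrite !BE; congr (_ - _ * _); last by apply: eq_bigr => i _; rewrite mulrC.
  by apply: eq_bigr => c _; rewrite mulrC.
have BQ x : dot x (L x) = gram M x - q * nrm2 x.
  by rewrite BE; congr (_ - _ * _); apply: eq_bigr => i _; rewrite expr2.
have Bpol x y : dot x (L y) = 4^-1 *
   ((gram M (fun i => x i + (-1) ^+ false * y i) - q * nrm2 (fun i => x i + (-1) ^+ false * y i)) -
    (gram M (fun i => x i + (-1) ^+ true * y i) - q * nrm2 (fun i => x i + (-1) ^+ true * y i))).
  rewrite BE /gram /nrm2 /dot.
  have e1 : \sum_c (\sum_i x i * M i c) * (\sum_l y l * M l c) =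
    4^-1 * (\sum_c (\sum_i (x i + (-1) ^+ false * y i) * M i c) ^+ 2 -
            \sum_c (\sum_i (x i + (-1) ^+ true * y i) * M i c) ^+ 2).
    rewrite -sumrB mulr_sumr; apply: eq_bigr => c _.
    have -> : \sum_i (x i + (-1) ^+ false * y i) * M i c =
       \sum_i x i * M i c + \sum_l y l * M l c.
      by rewrite -big_split; apply: eq_bigr => i _; rewrite expr0 mul1r mulrDl.
    have -> : \sum_i (x i + (-1) ^+ true * y i) * M i c =
       \sum_i x i * M i c - \sum_l y l * M l c.
      by rewrite -sumrB; apply: eq_bigr => i _; rewrite expr1 mulN1r mulrBl.
    by field.
  have e2 : \sum_i x i * y i = 4^-1 * (\sum_i (x i + (-1) ^+ false * y i) ^+ 2 -
        \sum_i (x i + (-1) ^+ true * y i) ^+ 2).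
    rewrite -sumrB mulr_sumr; apply: eq_bigr => i _; rewrite expr0 expr1; by field.
  rewrite e1 e2; ring.
have key x y : nrm2 x <= 1 -> nrm2 y <= 1 -> dot x (L y) <= D / 2.
  move=> x1 y1; have [f hf /le_trans-> //] := round_dot (L y) x1.
  rewrite Bsym; have [g hg /le_trans-> //] := round_dot (L (gridvec R f)) y1.
  rewrite Bpol.
  have := H g f hg hf false; have := H g f hg hf true; rewrite /= !ler_norml.
  by move=> /andP[h1 h2] /andP[h3 h4]; lra.
move=> x x1; rewrite -BQ ler_norml key// andbT lerNl -dotNl key// nrm2N.
by [].
Qed.

End Tensor.

Section Union.
Variables (R : realType) (d : measure_display) (T : measurableType d).
Variable P : probability T R.

Lemma measurable_exists (F : finType) (G : pred F) (Ev : F -> set T) :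
  (forall f, measurable (Ev f)) -> measurable [set t | exists2 f, G f & Ev f t].
Proof. by move=> mE; apply: (@fin_bigcup_measurable _ _ F G Ev). Qed.

Lemma union_bound (F : finType) (G : pred F) (Ev : F -> set T) (p : R) :
  (forall f, measurable (Ev f)) -> (forall f, G f -> P (Ev f) <= p%:E)%E ->
  (P [set t | exists2 f, G f & Ev f t] <= (#|G|%:R * p)%:E)%E.
Proof.
move=> mE HE.
have key : forall s : seq F, all G s ->
    (P [set t | exists2 f, f \in s & Ev f t] <= ((size s)%:R * p)%:E)%E.
  elim=> [_|f s IH /= /andP[Gf Gs]].
    rewrite (_ : [set t | _] = set0) ?measure0 ?mul0r//.
    by apply/seteqP; split=> [t [f]|].
  have -> : [set t | exists2 f', f' \in f :: s & Ev f' t] =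
     Ev f `|` [set t | exists2 f', f' \in s & Ev f' t].
    apply/seteqP; split => t /=.
      move=> [f']; rewrite in_cons => /orP[/eqP->|fs] Et; [by left|right].
      by exists f'.
    move=> [Et|[f' fs Et]]; first by exists f => //; rewrite mem_head.
    by exists f' => //; rewrite in_cons fs orbT.
  apply: (le_trans (measureU2 _ _ _)) => //; first exact: measurable_exists.
  have -> : (size s).+1%:R * p = p + (size s)%:R * p by rewrite -natr1; ring.
  rewrite EFinD; apply: leeD; [exact: (HE _ Gf)|exact: (IH Gs)].
have -> : [set t | exists2 f, G f & Ev f t] = [set t | exists2 f, f \in enum G & Ev f t].
  by apply/seteqP; split => t /= [f Gf Et]; exists f => //; move: Gf; rewrite mem_enum.
by rewrite cardE; apply: key; apply/allP => f; rewrite mem_enum.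
Qed.
End Union.

(** * Concentration of a Gaussian tensor *)

Section TensorProb.
Variables (R : realType) (d : measure_display) (T : measurableType d).
Variable P : probability T R.

Lemma ifam_reindex (I J : finType) (h : J -> I) (X : I -> T -> R) (nu : I -> law R) :
  bijective h -> ifam P X nu -> ifam P (fun j => X (h j)) (fun j => nu (h j)).
Proof.
move=> bh [mX HX]; split=> [j|B mB]; first exact: mX.
have [k hk kh] := bh.
have := HX (fun i => B (k i)) (fun i => mB (k i)).
rewrite (reindex h) /=; last exact: onW_bij.
under eq_bigr do rewrite hk.
move=> <-; congr (P _); apply/seteqP; split => t /= H i.
  by have := H (k i); rewrite kh.
by have := H (h i); rewrite hk.
Qed.

Definition stdtensor a b c (W : T -> tensor3 R a b c) :=
  stdfam P (fun (l : 'I_a * 'I_b * 'I_c) t => W t l.1.1 l.1.2 l.2).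

Lemma stdtensor_perm12 a b c (W : T -> tensor3 R a b c) :
  stdtensor W -> stdtensor (fun t => perm12 (W t)).
Proof.
apply: (ifam_reindex (h := fun l : 'I_b * 'I_a * 'I_c => (l.1.2, l.1.1, l.2))).
by exists (fun l : 'I_a * 'I_b * 'I_c => (l.1.2, l.1.1, l.2)) => -[[? ?] ?].
Qed.

Lemma stdtensor_perm13 a b c (W : T -> tensor3 R a b c) :
  stdtensor W -> stdtensor (fun t => perm13 (W t)).
Proof.
apply: (ifam_reindex (h := fun l : 'I_c * 'I_a * 'I_b => (l.1.2, l.2, l.1.1))).
by exists (fun l : 'I_a * 'I_b * 'I_c => (l.2, l.1.1, l.1.2)) => -[[? ?] ?].
Qed.

Lemma stdtensor_perm23 a b c (W : T -> tensor3 R a b c) :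
  stdtensor W -> stdtensor (fun t => perm23 (W t)).
Proof.
apply: (ifam_reindex (h := fun l : 'I_a * 'I_c * 'I_b => (l.1.1, l.2, l.1.2))).
by exists (fun l : 'I_a * 'I_b * 'I_c => (l.1.1, l.2, l.1.2)) => -[[? ?] ?].
Qed.

Lemma sum_triple a b c (F : 'I_a * 'I_b * 'I_c -> R) :
  \sum_l F l = \sum_i \sum_j \sum_k F (i, j, k).
Proof.
under [RHS]eq_bigr do rewrite pair_bigA.
rewrite pair_bigA /=.
rewrite (reindex (fun l : 'I_a * 'I_b * 'I_c => (l.1.1, (l.1.2, l.2)))) /=.
  by apply: eq_bigr => -[[]].
by exists (fun l => (l.1, l.2.1, l.2.2)) => [[[]]|[? []]].
Qed.

Lemma sum_block2 a b c (F : 'I_a * 'I_b * 'I_c -> R) j :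
  \sum_(l | l.1.2 == j) F l = \sum_i \sum_k F (i, j, k).
Proof.
rewrite big_mkcond sum_triple; apply: eq_bigr => i _ /=.
rewrite (bigD1 j)//= [X in _ + X]big1 ?addr0; last first.
  by move=> j' /negbTE j'j; apply: big1 => k _; rewrite j'j.
by apply: eq_bigr => k _; rewrite eqxx.
Qed.

Lemma sum_block23 a b c (F : 'I_a * 'I_b * 'I_c -> R) jk :
  \sum_(l | (l.1.2, l.2) == jk) F l = \sum_i F (i, jk.1, jk.2).
Proof.
rewrite big_mkcond sum_triple; apply: eq_bigr => i _ /=.
rewrite pair_bigA /= (bigD1 jk)//= [X in _ + X]big1 ?addr0; last first.
  by move=> j' /negbTE j'j; rewrite -surjective_pairing j'j.
by rewrite -surjective_pairing eqxx.
Qed.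

Lemma contr123_lin a b c (E : tensor3 R a b c) x y z :
  contr123 E x y z = \sum_l (x l.1.1 * y l.1.2 * z l.2) * E l.1.1 l.1.2 l.2.
Proof.
rewrite sum_triple; do 3 apply: eq_bigr => ? _ /=; ring.
Qed.

Lemma nrm2_outer a b c (x : vec R a) (y : vec R b) (z : vec R c) :
  \sum_(l : 'I_a * 'I_b * 'I_c) (x l.1.1 * y l.1.2 * z l.2) ^+ 2 = nrm2 x * nrm2 y * nrm2 z.
Proof.
rewrite sum_triple /nrm2 /= big_distrlr /= mulr_suml; apply: eq_bigr => i _.
rewrite mulr_suml; apply: eq_bigr => j _; rewrite mulr_sumr; apply: eq_bigr => k _.
by rewrite !exprMn.
Qed.

Lemma nrm2_ge0 m (x : vec R m) : 0 <= nrm2 x.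
Proof. by apply: sumr_ge0 => i _; exact: sqr_ge0. Qed.

(** [Q] need not be measurable, only hold off a measurable set of small probability: the norm and
    Gram bounds quantify over uncountably many vectors. *)
Definition whp (e : R) (Q : T -> Prop) :=
  exists B, [/\ measurable B, (P B <= e%:E)%E & forall t, ~ B t -> Q t].

Lemma whp_and e1 e2 Q1 Q2 : whp e1 Q1 -> whp e2 Q2 ->
  whp (e1 + e2) (fun t => Q1 t /\ Q2 t).
Proof.
move=> [B1 [m1 p1 h1]] [B2 [m2 p2 h2]]; exists (B1 `|` B2); split.
- exact: measurableU.
- by apply: (le_trans (measureU2 _ _ _)) => //; rewrite EFinD; exact: leeD.
- by move=> t /not_orP[b1 b2]; split; [exact: h1|exact: h2].
Qed.

Lemma whp_impl e1 e2 (Q1 Q2 : T -> Prop) : e1 <= e2 -> (forall t, Q1 t -> Q2 t) ->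
  whp e1 Q1 -> whp e2 Q2.
Proof.
move=> e12 h [B [m p hB]]; exists B; split => //.
  by apply: (le_trans p); rewrite lee_fin.
by move=> t /hB /h.
Qed.

Lemma whp_contr a b c (W : T -> tensor3 R a b c) x y z (M : R) :
  stdtensor W -> nrm2 x <= 1 -> nrm2 y <= 1 -> nrm2 z <= 1 -> 0 <= M ->
  whp (2 * expR (- (M ^+ 2 / 2))) (fun t => `|contr123 (W t) x y z| <= M).
Proof.
move=> HW x1 y1 z1 M0.
exists [set t | M < `|contr123 (W t) x y z|]; split.
- apply: measurable_gt_norm; under eq_fun do rewrite contr123_lin.
  exact: (measurable_linear _ HW).
- under eq_set do rewrite contr123_lin.
  rewrite -[X in M ^+ 2 / X]mulr1; apply: (linear_tail HW) => //.
  rewrite nrm2_outer; have := nrm2_ge0 x; have := nrm2_ge0 y; have := nrm2_ge0 z.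
  by move=> *; rewrite mulr_ile1 ?mulr_ge0 ?mulr_ile1.
- by move=> t /negP; rewrite -leNgt.
Qed.

(** Grid vectors have squared norm at most [4], so each form has variance at most [64], and the
    level [64 sqrt p] gives [2 exp(- 32 p)]. The union runs over at most [2^(18 p) <= exp(18 p)]
    triples. *)
Lemma whp_opn a b c (W : T -> tensor3 R a b c) (p : nat) :
  stdtensor W -> (a <= p)%N -> (b <= p)%N -> (c <= p)%N -> (0 < p)%N ->
  whp (2 * expR (- p%:R)) (fun t => opn (W t) (64 * Num.sqrt p%:R)).
Proof.
move=> HW ap bp cp p0; set s := 64 * Num.sqrt p%:R.
have s0 : 0 <= s by rewrite mulr_ge0.
pose Ev (F : grid a * grid b * grid c) : set T :=
  [set t | s < `|contr123 (W t) (gridvec R F.1.1) (gridvec R F.1.2) (gridvec R F.2)|].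
pose G (F : grid a * grid b * grid c) := [&& ingrid F.1.1, ingrid F.1.2 & ingrid F.2].
have mEv F : measurable (Ev F).
  apply: measurable_gt_norm; under eq_fun do rewrite contr123_lin.
  exact: (measurable_linear _ HW).
exists [set t | exists2 F, G F & Ev F t]; split.
- exact: measurable_exists.
- pose q := 2 * expR (- (32 * p%:R)) : R.
  have HE F : G F -> (P (Ev F) <= q%:E)%E.
    move=> /and3P[h1 h2 h3]; rewrite (_ : Ev F = [set t | s < `|\sum_l
      (gridvec R F.1.1 l.1.1 * gridvec R F.1.2 l.1.2 * gridvec R F.2 l.2) * W t l.1.1 l.1.2 l.2|]); last first.
      by apply/funext => t; rewrite /Ev /= contr123_lin.
    have -> : q = 2 * expR (- (s ^+ 2 / (2 * 64))).
      rewrite /q /s exprMn sqr_sqrtr//; congr (2 * expR (- _)); by field.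
    apply: (linear_tail (b := fun l => gridvec R F.1.1 l.1.1 * gridvec R F.1.2 l.1.2 * gridvec R F.2 l.2) HW) => //.
    rewrite nrm2_outer.
    have := gridvec_sqr_sum R h1; have := gridvec_sqr_sum R h2; have := gridvec_sqr_sum R h3.
    rewrite -!/(nrm2 _) => n3 n2 n1; rewrite (_ : 64 = 4 * 4 * 4); last by ring.
    by apply: ler_pM => //; rewrite ?mulr_ge0 ?nrm2_ge0//; apply: ler_pM => //; rewrite nrm2_ge0.
  apply: (le_trans (union_bound mEv HE)); rewrite lee_fin /q mulrCA ler_pM2l//.
  have cG : #|G|%:R <= 2 ^+ (18 * p) :> R.
    have -> : #|G| = (#|[pred f : grid a | ingrid f]| * #|[pred f : grid b | ingrid f]|
        * #|[pred f : grid c | ingrid f]|)%N.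
      by rewrite -!cardX; apply: eq_card => -[[]] f g h; rewrite !unfold_in /= -andbA.
    rewrite !natrM (_ : 18 * p = 6 * p + 6 * p + 6 * p)%N; last by rewrite -!mulnDl.
    rewrite (exprD _ (6 * p + 6 * p)) (exprD _ (6 * p)).
    have h m : (m <= p)%N -> #|[pred f : grid m | ingrid f]|%:R <= 2 ^+ (6 * p) :> R.
      by move=> mp; apply: (le_trans (card_grid R m)); rewrite ler_eXn2l ?ltr1n// leq_mul2l.
    by apply: ler_pM (h _ cp); rewrite ?mulr_ge0 ?ler0n//; apply: ler_pM (h _ ap) (h _ bp); rewrite ler0n.
  apply: (@le_trans _ _ (expR (18 * p%:R) * expR (- (32 * p%:R)))).
    rewrite ler_wpM2r ?expR_ge0//; apply: (le_trans cG).
    rewrite -natrM -[(18 * p)%:R]mulr1 expRM_natl; apply: lerXn2r; rewrite ?nnegrE ?expR_ge0//.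
    by have := expR_ge1Dx (1 : R); rewrite -(natrD _ 1 1).
  rewrite -expRD ler_expR; have : 0 <= p%:R :> R by []; lra.
- move=> t /forall2NP H; apply: opn_net => f g h hf hg hh.
  have [] := H (f, g, h); first by rewrite /G /= hf hg hh.
  by move=> /negP; rewrite /Ev /= -leNgt.
Qed.

End TensorProb.

(** * Gram matrices and quadratic forms of a Gaussian tensor *)

Section GramConcentration.
Variables (R : realType) (d : measure_display) (T : measurableType d).
Variable P : probability T R.

Lemma sum_sqr_eq0 m (x : vec R m) : nrm2 x = 0 -> forall i, x i = 0.
Proof.
move=> /eqP; rewrite psumr_eq0 => [/allP h i|i _]; last exact: sqr_ge0.
by have := h i (mem_index_enum i); rewrite /= sqrf_eq0 => /eqP.
Qed.

(** Adds the case [tau = 0] to [chi_tail_scaled]: all coefficients vanish and the event is empty. It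
    occurs, for instance, when the difference of two grid vectors is zero. *)
Lemma chi_event (I C : finType) (X : I -> T -> R) (g : I -> C) (b : I -> R)
    (th s tau D : R) :
  stdfam P X -> 0 <= tau -> (forall c, \sum_(i | g i == c) b i ^+ 2 = tau) ->
  0 <= th <= 4^-1 -> 0 <= s -> s * tau <= D ->
  let Ev := [set t | D < `|\sum_c (\sum_(i | g i == c) b i * X i t) ^+ 2 - #|C|%:R * tau|] in
  measurable Ev /\
  (P Ev <= (2 * expR (- (th * s) + 4 * th ^+ 2 * #|C|%:R))%:E)%E.
Proof.
move=> HX tau0 bt th0 s0 sD Ev.
have mY : measurable_fun setT (fun t => \sum_c (\sum_(i | g i == c) b i * X i t) ^+ 2 - #|C|%:R * tau).
  apply: measurable_funB => //; apply: measurable_sum => c; apply: measurable_funX.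
  under eq_fun do rewrite big_mkcond; apply: measurable_sum => i.
  case: (g i == c) => //; apply: measurable_funM => //; by case: HX => /(_ i).
have mEv r : measurable [set t | r < `|\sum_c (\sum_(i | g i == c) b i * X i t) ^+ 2 - #|C|%:R * tau|].
  exact: measurable_gt_norm.
split; first exact: mEv.
have [tau00|taun0] := eqVneq tau 0.
  rewrite (_ : Ev = set0); last first.
    apply/seteqP; split => // t; rewrite /Ev /=.
    have b0 i : b i = 0.
      have := bt (g i); rewrite tau00 (bigD1 i)//= => /eqP.
      rewrite paddr_eq0 ?sqr_ge0 ?sumr_ge0// => [/andP[/eqP + _]|j _]; last exact: sqr_ge0.
      by move/eqP; rewrite sqrf_eq0 => /eqP.
    rewrite big1 => [|c _]; last by rewrite big1 ?expr0n// => i _; rewrite b0 mul0r.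
    rewrite tau00 mulr0 subrr normr0 => /(le_lt_trans sD).
    by rewrite tau00 mulr0 ltxx.
  by rewrite measure0 lee_fin mulr_ge0 ?expR_ge0.
have taugt : 0 < tau by rewrite lt0r taun0.
apply: le_trans (chi_tail_scaled s HX taugt bt th0).
apply: le_measure; rewrite ?inE; [exact: mEv|exact: mEv|].
by move=> t; rewrite /Ev /=; apply: le_lt_trans.
Qed.

Lemma gram_mat1_block a b c (E : tensor3 R a b c) (s : vec R a) :
  gram (mat1 E) s = \sum_(jk : 'I_b * 'I_c)
     (\sum_(l : 'I_a * 'I_b * 'I_c | (l.1.2, l.2) == jk) s l.1.1 * E l.1.1 l.1.2 l.2) ^+ 2.
Proof. by apply: eq_bigr => jk _; rewrite sum_block23. Qed.

(** The Chernoff parameter is [1 / sqrt p], at most [1/4] since [p >= 16]. At level [20 p sqrt p]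
    the exponent is [- 20 p + 4 b c / p <= - 16 p], against [2 * 2^(12 p)] choices of two grid
    vectors and a sign. Their sum or difference has squared norm at most [16], so
    [D = 320 p sqrt p], and polarization halves it. *)
Lemma whp_gram a b c (W : T -> tensor3 R a b c) (p : nat) :
  stdtensor P W -> (a <= p)%N -> (b <= p)%N -> (c <= p)%N -> (16 <= p)%N ->
  whp P (4 * expR (- (4 * p%:R))) (fun t => forall x, nrm2 x <= 1 ->
    `|gram (mat1 (W t)) x - (b * c)%:R * nrm2 x| <= 160 * (p%:R * Num.sqrt p%:R)).
Proof.
move=> HW ap bp cp p16.
have p16' : 16 <= p%:R :> R by rewrite (ler_nat R 16).
have pgt0 : 0 < p%:R :> R by lra.
set sp := Num.sqrt p%:R.
have sp2 : sp ^+ 2 = p%:R by rewrite sqr_sqrtr// ltW.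
have sp4 : 4 <= sp.
  rewrite -(@ler_pXn2r _ 2) ?nnegrE ?sqrtr_ge0// sp2; lra.
have sp0 : 0 < sp by lra.
pose D := 16 * (20 * (p%:R * sp)).
pose sv (F : grid a * grid a * bool) : vec R a :=
  fun i => gridvec R F.1.1 i + (-1) ^+ F.2 * gridvec R F.1.2 i.
pose Ev (F : grid a * grid a * bool) : set T :=
  [set t | D < `|gram (mat1 (W t)) (sv F) - (b * c)%:R * nrm2 (sv F)|].
pose G (F : grid a * grid a * bool) := ingrid F.1.1 && ingrid F.1.2.
have bsum (s : vec R a) (jk : 'I_b * 'I_c) :
    \sum_(l : 'I_a * 'I_b * 'I_c | (l.1.2, l.2) == jk) s l.1.1 ^+ 2 = nrm2 s.
  by rewrite sum_block23.
have cC : #|{: 'I_b * 'I_c}|%:R = (b * c)%:R :> R by rewrite card_prod !card_ord.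
have th01 : 0 <= sp^-1 <= 4^-1.
  by rewrite invr_ge0 ltW//= lef_pV2 ?posrE.
have HEv F : let Q := 2 * expR (- (sp^-1 * (20 * (p%:R * sp))) + 4 * sp^-1 ^+ 2 * (b * c)%:R) in
    nrm2 (sv F) <= 16 -> (P (Ev F) <= Q%:E)%E.
  move=> Q n16.
  have s0 : 0 <= 20 * (p%:R * sp) by rewrite !mulr_ge0// ltW.
  have sD : 20 * (p%:R * sp) * nrm2 (sv F) <= D.
    by rewrite mulrC /D ler_wpM2r.
  have [_] := chi_event HW (nrm2_ge0 (sv F)) (bsum (sv F)) th01 s0 sD.
  rewrite cC; congr (P _ <= _)%E; apply/eq_set => t.
  by rewrite -gram_mat1_block.
have mEv F : measurable (Ev F).
  have s0 : 0 <= 20 * (p%:R * sp) by rewrite !mulr_ge0// ltW.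
  rewrite /Ev.
  have mY : measurable_fun setT (fun t => gram (mat1 (W t)) (sv F) - (b * c)%:R * nrm2 (sv F)).
    apply: measurable_funB => //; apply: measurable_sum => jk; apply: measurable_funX.
    apply: measurable_sum => i; apply: measurable_funM => //.
    by case: HW => /(_ (i, jk.1, jk.2)).
  exact: measurable_gt_norm.
exists [set t | exists2 F, G F & Ev F t]; split.
- exact: measurable_exists.
- pose q := 2 * expR (- (16 * p%:R)) : R.
  have HE F : G F -> (P (Ev F) <= q%:E)%E.
    move=> /andP[h1 h2].
    have := gridvec_sqr_sum R h1; have := gridvec_sqr_sum R h2.
    rewrite -!/(nrm2 _) => n2 n1.
    have n16 : nrm2 (sv F) <= 16.
      apply: (@le_trans _ _ (2 * nrm2 (gridvec R F.1.1) + 2 * nrm2 (gridvec R F.1.2))); last by lra.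
      rewrite /nrm2 !mulr_sumr -big_split; apply: ler_sum => i _; rewrite /sv /=.
      set u := gridvec R F.1.1 i; set v := gridvec R F.1.2 i.
      have : 0 <= (u - (-1) ^+ F.2 * v) ^+ 2 by exact: sqr_ge0.
      have : ((-1) ^+ F.2 * v) ^+ 2 = v ^+ 2 by rewrite exprMn sqrr_sign mul1r.
      by move: ((-1) ^+ F.2 * v) => v' <-; nra.
    apply: (le_trans (HEv F n16)); rewrite lee_fin /q ler_pM2l// ler_expR.
    rewrite exprVn sp2.
    have -> : sp^-1 * (20 * (p%:R * sp)) = 20 * p%:R by field; rewrite gt_eqF.
    have bc : (b * c)%:R <= p%:R * p%:R :> R by rewrite -natrM ler_nat leq_mul.
    have : 4 * p%:R^-1 * (b * c)%:R <= 4 * p%:R :> R.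
      rewrite -mulrA ler_pM2l// mulrC ler_pdivrMr//.
    lra.
  apply: (le_trans (union_bound mEv HE)); rewrite lee_fin /q.
  have cG : #|G|%:R <= 2 * 2 ^+ (12 * p) :> R.
    have -> : #|G| = (#|[pred f : grid a | ingrid f]| * #|[pred f : grid a | ingrid f]|
        * #|{: bool}|)%N.
      by rewrite -!cardX; apply: eq_card => -[[]] f g h; rewrite !unfold_in /= andbT.
    rewrite !natrM card_bool (_ : 12 * p = 6 * p + 6 * p)%N; last by rewrite -!mulnDl.
    rewrite (exprD _ (6 * p)) mulrC ler_pM2l//.
    have h : #|[pred f : grid a | ingrid f]|%:R <= 2 ^+ (6 * p) :> R.
      by apply: (le_trans (card_grid R a)); rewrite ler_eXn2l ?ltr1n// leq_mul2l.
    by apply: ler_pM (h) (h); rewrite ler0n.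
  have e12 : 2 ^+ (12 * p) <= expR (12 * p%:R) :> R.
    rewrite -natrM -[(12 * p)%:R]mulr1 expRM_natl; apply: lerXn2r; rewrite ?nnegrE ?expR_ge0//.
    by have := expR_ge1Dx (1 : R); rewrite -(natrD _ 1 1).
  have e16 : expR (12 * p%:R) * expR (- (16 * p%:R)) = expR (- (4 * p%:R)) :> R.
    by rewrite -expRD; congr expR; ring.
  have := expR_ge0 (- (16 * p%:R) : R).
  rewrite -e16; move: (expR (- _)) => y y0.
  have : #|G|%:R * y <= (2 * expR (12 * p%:R)) * y.
    by rewrite ler_wpM2r//; lra.
  lra.
- move=> t /forall2NP H x x1.
  apply: (le_trans (gram_net (D := D) (q := (b * c)%:R) _ x1)); last by rewrite /D; lra.
  move=> f g hf hg e.
  have [] := H (f, g, e); first by rewrite /G /= hf hg.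
  by move=> /negP; rewrite /Ev /= -leNgt.
Qed.

Definition delta m (i : 'I_m) : vec R m := fun l => (l == i)%:R.

Lemma dot_delta m (i : 'I_m) (x : vec R m) : dot (delta i) x = x i.
Proof.
rewrite /dot (bigD1 i)//= /delta eqxx mul1r big1 ?addr0// => l /negbTE ->.
by rewrite mul0r.
Qed.

Lemma nrm2_delta m (i : 'I_m) : nrm2 (delta i) = 1.
Proof.
rewrite /nrm2 (bigD1 i)//= /delta eqxx expr1n big1 ?addr0// => l /negbTE ->.
by rewrite expr0n.
Qed.

(** With [x = e_i] and [u] the true vector, [E(e_i, ., w)] is paired with [E(u, ., w)], the
    first-order error of [hat v] before projection: this is how the noise re-enters entry [i] at
    second order. *)
Definition quad12 a b c (E : tensor3 R a b c) (x u : vec R a) (w : vec R c) :=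
  dot (contr13 E x w) (contr13 E u w).

Lemma contr13_block a b c (E : tensor3 R a b c) (s : vec R a) (w : vec R c) j :
  contr13 E s w j = \sum_(l : 'I_a * 'I_b * 'I_c | l.1.2 == j)
     (s l.1.1 * w l.2) * E l.1.1 l.1.2 l.2.
Proof.
by rewrite sum_block2; do 2 apply: eq_bigr => ? _; ring.
Qed.

(** With Chernoff parameter [1 / sqrt p] the exponent is [- M + 4 b / p <= 4 - M]. The vectors are
    fixed, so there is no union bound to pay for and [M] can remain a constant. *)
Lemma whp_sqnorm a b c (W : T -> tensor3 R a b c) (s : vec R a) (w : vec R c) (p : nat) (M : R) :
  stdtensor P W -> (b <= p)%N -> (16 <= p)%N -> 0 <= M -> nrm2 w = 1 ->
  whp P (2 * expR (4 - M)) (fun t =>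
   `|nrm2 (contr13 (W t) s w) - b%:R * nrm2 s| <= M * Num.sqrt p%:R * nrm2 s).
Proof.
move=> HW bp p16 M0 w1.
have p16' : 16 <= p%:R :> R by rewrite (ler_nat R 16).
have pgt0 : 0 < p%:R :> R by lra.
set sp := Num.sqrt p%:R.
have sp2 : sp ^+ 2 = p%:R by rewrite sqr_sqrtr// ltW.
have sp4 : 4 <= sp.
  rewrite -(@ler_pXn2r _ 2) ?nnegrE ?sqrtr_ge0// sp2; lra.
have sp0 : 0 < sp by lra.
have th01 : 0 <= sp^-1 <= 4^-1.
  by rewrite invr_ge0 ltW//= lef_pV2 ?posrE.
have bsum (j : 'I_b) :
    \sum_(l : 'I_a * 'I_b * 'I_c | l.1.2 == j) (s l.1.1 * w l.2) ^+ 2 = nrm2 s.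
  rewrite sum_block2 -[RHS]mulr1 -w1 /nrm2 mulr_suml; apply: eq_bigr => i _.
  by rewrite mulr_sumr; apply: eq_bigr => k _; rewrite exprMn.
have s0 : 0 <= M * sp by rewrite mulr_ge0// ltW.
have [mE PE] := chi_event HW (nrm2_ge0 s) bsum th01 s0 (lexx _).
set Ev := (X in P X) in PE.
exists Ev; split => //.
- apply: (le_trans PE); rewrite lee_fin ler_pM2l// ler_expR card_ord exprVn sp2.
  have -> : sp^-1 * (M * sp) = M by field; rewrite gt_eqF.
  have : 4 * p%:R^-1 * b%:R <= 4 :> R.
    by rewrite -mulrA ler_piMr// mulrC ler_pdivrMr// mul1r ler_nat.
  lra.
- move=> t /negP; rewrite /Ev /= -leNgt card_ord.
  by congr (`|_ - _| <= _); apply: eq_bigr => j _; rewrite contr13_block.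
Qed.

(* By polarization [quad12] is a difference of two chi-square variables, whose means
   [b (2 + 2 u_i)] and [b (2 - 2 u_i)] account for the term [|u_i| p]. *)
Lemma whp_quad12 a b c (W : T -> tensor3 R a b c) (i : 'I_a) (u : vec R a) (w : vec R c)
    (p : nat) (M : R) :
  stdtensor P W -> (b <= p)%N -> (16 <= p)%N -> 0 <= M -> nrm2 u = 1 -> nrm2 w = 1 ->
  whp P (4 * expR (4 - M)) (fun t =>
   `|quad12 (W t) (delta i) u w| <= `|u i| * p%:R + M * Num.sqrt p%:R).
Proof.
move=> HW bp p16 M0 u1 w1.
pose s1 : vec R a := fun l => delta i l + u l.
pose s2 : vec R a := fun l => delta i l - u l.
have d1 := nrm2_delta i; have du := dot_delta i u.
have n1 : nrm2 s1 = 2 + 2 * u i.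
  rewrite (_ : nrm2 s1 = nrm2 (delta i) + 2 * dot (delta i) u + nrm2 u).
    by rewrite d1 du u1; ring.
  rewrite /nrm2 /dot mulr_sumr -!big_split.
  by apply: eq_bigr => l _ /=; rewrite /s1; ring.
have n2 : nrm2 s2 = 2 - 2 * u i.
  rewrite (_ : nrm2 s2 = nrm2 (delta i) - 2 * dot (delta i) u + nrm2 u).
    by rewrite d1 du u1; ring.
  rewrite /nrm2 /dot mulr_sumr -sumrN -!big_split.
  by apply: eq_bigr => l _ /=; rewrite /s2; ring.
apply: whp_impl (whp_and (whp_sqnorm s1 HW bp p16 M0 w1) (whp_sqnorm s2 HW bp p16 M0 w1)).
  by lra.
move=> t [].
have -> : quad12 (W t) (delta i) u w = 4^-1 * (nrm2 (contr13 (W t) s1 w) - nrm2 (contr13 (W t) s2 w)).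
  rewrite /quad12 /dot /nrm2 -sumrB mulr_sumr; apply: eq_bigr => j _.
  have -> : contr13 (W t) s1 w j = contr13 (W t) (delta i) w j + contr13 (W t) u w j.
    rewrite /contr13 -big_split; apply: eq_bigr => l _ /=; rewrite -big_split.
    by apply: eq_bigr => k _ /=; rewrite /s1; ring.
  have -> : contr13 (W t) s2 w j = contr13 (W t) (delta i) w j - contr13 (W t) u w j.
    rewrite /contr13 -sumrB; apply: eq_bigr => l _ /=; rewrite -sumrB.
    by apply: eq_bigr => k _ /=; rewrite /s2; ring.
  by field.
rewrite n1 n2 !ler_norml => /andP[h1 h2] /andP[h3 h4].
have bp' : b%:R <= p%:R :> R by rewrite ler_nat.
have b0 : 0 <= b%:R :> R by rewrite ler0n.
have hu : `|u i * b%:R| <= `|u i| * p%:R by rewrite normrM (ger0_norm b0) ler_wpM2l.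
move: hu; rewrite ler_norml => /andP[h5 h6].
set ms := M * _ in h1 h2 h3 h4 *.
by apply/andP; split; nra.
Qed.

End GramConcentration.

(** * The power iteration *)

Section Det.
Variable R : realType.

Lemma vnormE m (x : vec R m) : vnorm x = Num.sqrt (nrm2 x).
Proof. by []. Qed.

Lemma vnorm_ge0 m (x : vec R m) : 0 <= vnorm x.
Proof. exact: sqrtr_ge0. Qed.

Lemma vnorm_sqr m (x : vec R m) : vnorm x ^+ 2 = nrm2 x.
Proof. by rewrite sqr_sqrtr// nrm2_ge0. Qed.

Lemma vnorm_le m (x : vec R m) r : 0 <= r -> nrm2 x <= r ^+ 2 -> vnorm x <= r.
Proof.
by move=> r0 h; rewrite -(@ler_pXn2r _ 2) ?nnegrE ?vnorm_ge0// vnorm_sqr.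
Qed.

Lemma nrm2_le m (x : vec R m) r : vnorm x <= r -> nrm2 x <= r ^+ 2.
Proof.
move=> h; have r0 := le_trans (vnorm_ge0 x) h.
by rewrite -vnorm_sqr ler_pXn2r// nnegrE ?vnorm_ge0.
Qed.

Lemma vnorm1 m (x : vec R m) : vnorm x = 1 -> nrm2 x = 1.
Proof. by move=> h; rewrite -vnorm_sqr h expr1n. Qed.

Lemma dotC m (x y : vec R m) : dot x y = dot y x.
Proof. by apply: eq_bigr => i _; rewrite mulrC. Qed.

Lemma dotxx m (x : vec R m) : dot x x = nrm2 x.
Proof. by apply: eq_bigr => i _; rewrite expr2. Qed.

Lemma dotDr m (x y z : vec R m) : dot x (fun i => y i + z i) = dot x y + dot x z.
Proof. by rewrite /dot -big_split; apply: eq_bigr => i _; rewrite mulrDr. Qed.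

Lemma dotZr m s (x y : vec R m) : dot x (fun i => s * y i) = s * dot x y.
Proof. by rewrite /dot mulr_sumr; apply: eq_bigr => i _; rewrite mulrCA. Qed.

Lemma dotDl m (x y z : vec R m) : dot (fun i => y i + z i) x = dot y x + dot z x.
Proof. by rewrite dotC dotDr !(dotC x). Qed.

Lemma dotZl m s (x y : vec R m) : dot (fun i => s * y i) x = s * dot y x.
Proof. by rewrite dotC dotZr (dotC x). Qed.

Lemma nrm2D m (x y : vec R m) : nrm2 (fun i => x i + y i) = nrm2 x + 2 * dot x y + nrm2 y.
Proof. by rewrite -!dotxx dotDl !dotDr (dotC y x); ring. Qed.

Lemma nrm2Z m s (x : vec R m) : nrm2 (fun i => s * x i) = s ^+ 2 * nrm2 x.
Proof. by rewrite -!dotxx dotZl dotZr; ring. Qed.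

Lemma vnormZ m s (x : vec R m) : vnorm (fun i => s * x i) = `|s| * vnorm x.
Proof. by rewrite !vnormE nrm2Z sqrtrM ?sqr_ge0// sqrtr_sqr. Qed.

Lemma cauchy_schwarz m (x y : vec R m) : `|dot x y| <= vnorm x * vnorm y.
Proof.
have [y0|yn0] := eqVneq (nrm2 y) 0.
  rewrite /dot big1 ?normr0 ?mulr_ge0 ?vnorm_ge0// => i _.
  by rewrite (sum_sqr_eq0 y0) mulr0.
have ygt : 0 < nrm2 y by rewrite lt0r yn0 nrm2_ge0.
have h : 0 <= nrm2 (fun i => nrm2 y * x i + (- dot x y) * y i) by exact: nrm2_ge0.
move: h; rewrite nrm2D !nrm2Z dotZl dotZr => h.
rewrite -(@ler_pXn2r _ 2) ?nnegrE ?mulr_ge0 ?vnorm_ge0// exprMn !vnorm_sqr.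
rewrite real_normK ?num_real//.
rewrite -subr_ge0 -(pmulr_rge0 _ ygt); move: h; congr (0 <= _); ring.
Qed.

Lemma vnormD m (x y : vec R m) : vnorm (fun i => x i + y i) <= vnorm x + vnorm y.
Proof.
apply: vnorm_le; first by rewrite addr_ge0// vnorm_ge0.
rewrite nrm2D sqrrD !vnorm_sqr mulr2n.
by have := le_trans (ler_norm _) (cauchy_schwarz x y); lra.
Qed.

Lemma opn_hom a b c (E : tensor3 R a b c) e x y z : opn E e ->
  `|contr123 E x y z| <= e * vnorm x * vnorm y * vnorm z.
Proof.
move=> HE.
have sc m (t : vec R m) : exists t', nrm2 t' <= 1 /\ forall i, t i = vnorm t * t' i.
  have [t0|tn0] := eqVneq (vnorm t) 0.
    exists (fun=> 0); split; first by rewrite /nrm2 big1 ?ler01// => i _; rewrite expr0n.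
    have n0 : nrm2 t = 0 by rewrite -vnorm_sqr t0 expr0n.
    by move=> i; rewrite (sum_sqr_eq0 n0) mulr0.
  exists (fun i => (vnorm t)^-1 * t i); split.
    by rewrite nrm2Z exprVn -vnorm_sqr mulVf// expf_neq0.
  by move=> i; rewrite mulrA divff// mul1r.
have [x' [x1 xE]] := sc _ x; have [y' [y1 yE]] := sc _ y; have [z' [z1 zE]] := sc _ z.
have -> : contr123 E x y z = vnorm x * vnorm y * vnorm z * contr123 E x' y' z'.
  rewrite /contr123 mulr_sumr; apply: eq_bigr => i _; rewrite mulr_sumr.
  apply: eq_bigr => j _; rewrite mulr_sumr; apply: eq_bigr => k _.
  by rewrite xE yE zE; ring.
rewrite normrM ger0_norm ?mulr_ge0 ?vnorm_ge0//.
rewrite [leRHS](_ : _ = vnorm x * vnorm y * vnorm z * e); last by ring.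
by rewrite ler_wpM2l ?mulr_ge0 ?vnorm_ge0// HE.
Qed.

Lemma opn_ge0 a b c (E : tensor3 R a b c) e : opn E e -> 0 <= e.
Proof.
move=> /(_ (fun=> 0) (fun=> 0) (fun=> 0)) h; apply: le_trans (normr_ge0 _) (h _ _ _);
 by rewrite /nrm2 big1 ?ler01// => i _; rewrite expr0n.
Qed.

(** Duality: the trilinear form is tested on the contracted vector itself, and one factor of its
    norm cancels. *)
Lemma opn_contr23 a b c (E : tensor3 R a b c) e y z : opn E e ->
  vnorm (contr23 E y z) <= e * vnorm y * vnorm z.
Proof.
move=> HE; have := opn_hom (contr23 E y z) y z HE.
rewrite contr123_dot1 dotxx -vnorm_sqr => h.
have e0 := opn_ge0 HE.
have [->|n0] := eqVneq (vnorm (contr23 E y z)) 0; first by rewrite !mulr_ge0 ?vnorm_ge0.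
have ngt : 0 < vnorm (contr23 E y z) by rewrite lt0r n0 vnorm_ge0.
rewrite -(ler_pM2l ngt); have := le_trans (ler_norm _) h.
by rewrite expr2 => /le_trans; apply; rewrite le_eqVlt; apply/orP; left; apply/eqP; ring.
Qed.

Lemma opn_perm12 a b c (E : tensor3 R a b c) e : opn E e -> opn (perm12 E) e.
Proof. by move=> HE y x z y1 x1 z1; rewrite contr123_perm12; exact: HE. Qed.

Lemma opn_perm13 a b c (E : tensor3 R a b c) e : opn E e -> opn (perm13 E) e.
Proof. by move=> HE y x z y1 x1 z1; rewrite contr123_perm13; exact: HE. Qed.

Lemma contr23_delta a b c (E : tensor3 R a b c) y z i :
  contr23 E y z i = contr123 E (delta R i) y z.
Proof. by rewrite contr123_dot1 dot_delta. Qed.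

Lemma contr23Dl a b c (E : tensor3 R a b c) y y' z i :
  contr23 E (fun j => y j + y' j) z i = contr23 E y z i + contr23 E y' z i.
Proof.
rewrite /contr23 -big_split; apply: eq_bigr => j _ /=; rewrite -big_split.
by apply: eq_bigr => k _ /=; ring.
Qed.

Lemma contr23Dr a b c (E : tensor3 R a b c) y z z' i :
  contr23 E y (fun j => z j + z' j) i = contr23 E y z i + contr23 E y z' i.
Proof.
rewrite /contr23 -big_split; apply: eq_bigr => j _ /=; rewrite -big_split.
by apply: eq_bigr => k _ /=; ring.
Qed.

Lemma contr23Z a b c (E : tensor3 R a b c) s y s' z i :
  contr23 E (fun j => s * y j) (fun k => s' * z k) i = s * s' * contr23 E y z i.
Proof.
rewrite /contr23 mulr_sumr; apply: eq_bigr => j _ /=; rewrite mulr_sumr.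
by apply: eq_bigr => k _ /=; ring.
Qed.

Definition proj m (u g : vec R m) : vec R m := fun i => g i - dot u g * u i.

Lemma dot_proj m (u g : vec R m) : nrm2 u = 1 -> dot u (proj u g) = 0.
Proof.
move=> u1; rewrite /proj (_ : (fun i => _) = (fun i => g i + (- dot u g) * u i)).
  by rewrite dotDr dotZr dotxx u1; ring.
by apply/funext => i; ring.
Qed.

Lemma nrm2_proj m (u g : vec R m) : nrm2 u = 1 -> nrm2 (proj u g) <= nrm2 g.
Proof.
move=> u1; rewrite /proj (_ : (fun i => _) = (fun i => g i + (- dot u g) * u i)).
  rewrite nrm2D nrm2Z dotZr u1 (dotC g); have := sqr_ge0 (dot u g); nra.
by apply/funext => i; ring.
Qed.

Lemma vnorm_proj m (u g : vec R m) : nrm2 u = 1 -> vnorm (proj u g) <= vnorm g.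
Proof.
by move=> u1; apply: vnorm_le; rewrite ?vnorm_ge0// vnorm_sqr; exact: nrm2_proj.
Qed.

(* [uh] is the normalization, up to sign, of [u + x] with [x] orthogonal to [u]. *)
Definition tang m (u uh x : vec R m) := exists s,
  [/\ s ^+ 2 * (1 + nrm2 x) = 1, dot u x = 0 & forall i, uh i = s * (u i + x i)].

Definition model a b c (u : vec R a) (v : vec R b) (w : vec R c) (E A : tensor3 R a b c) :=
  forall i j k, A i j k = u i * v j * w k + E i j k.

Lemma contr23_model a b c u v w (E A : tensor3 R a b c) y z i : model u v w E A ->
  contr23 A y z i = dot v y * dot w z * u i + contr23 E y z i.
Proof.
move=> HA; rewrite /contr23 /dot [X in X * _ + _]big_distrlr /= mulr_suml -big_split.
apply: eq_bigr => j _ /=; rewrite mulr_suml -big_split.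
by apply: eq_bigr => k _ /=; rewrite HA; ring.
Qed.

Section step.
Variables (a b c : nat) (u : vec R a) (v : vec R b) (w : vec R c).
Variables (E A : tensor3 R a b c) (e : R).
Hypotheses (u1 : nrm2 u = 1) (v1 : nrm2 v = 1) (w1 : nrm2 w = 1).
Hypotheses (HE : opn E e) (e8 : e <= 8^-1) (HA : model u v w E A).

(** For [y] orthogonal to [v] and [z] orthogonal to [w], contracting the model with [v + y] and
    [w + z] gives exactly [u + gvec y z]. Its component along [u] is [1 + theta], and division by it
    restores the shape [u + x] with [x] orthogonal to [u]; that [x] is [newx]. *)
Definition gvec (y : vec R b) (z : vec R c) : vec R a :=
  contr23 E (fun j => v j + y j) (fun k => w k + z k).
Definition theta (y : vec R b) (z : vec R c) : R := dot u (gvec y z).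
Definition newx (y : vec R b) (z : vec R c) : vec R a :=
  fun i => (1 + theta y z)^-1 * proj u (gvec y z) i.

Let e0 : 0 <= e. Proof. exact: opn_ge0 HE. Qed.
Let nv : vnorm v = 1. Proof. by rewrite vnormE v1 sqrtr1. Qed.
Let nw : vnorm w = 1. Proof. by rewrite vnormE w1 sqrtr1. Qed.
Let nu : vnorm u = 1. Proof. by rewrite vnormE u1 sqrtr1. Qed.

Lemma gvec_le y z : vnorm y <= 1 -> vnorm z <= 1 -> vnorm (gvec y z) <= 4 * e.
Proof.
move=> y1 z1; apply: le_trans (opn_contr23 _ _ HE) _.
have h1 := vnormD v y; have h2 := vnormD w z; rewrite nv in h1; rewrite nw in h2.
have := vnorm_ge0 (fun j => v j + y j); have := vnorm_ge0 (fun k => w k + z k).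
set p := vnorm _ in h2 *; set q := vnorm _ in h1 * => p0 q0.
have p2 : p <= 2 by lra.
have q2 : q <= 2 by lra.
apply: (@le_trans _ _ (e * 2 * 2)); last by lra.
by apply: ler_pM => //; rewrite ?mulr_ge0// ler_wpM2l.
Qed.

Lemma theta_le y z : vnorm y <= 1 -> vnorm z <= 1 -> `|theta y z| <= 4 * e.
Proof.
move=> y1 z1; apply: le_trans (cauchy_schwarz _ _) _.
by rewrite nu mul1r gvec_le.
Qed.

Lemma theta_ge y z : vnorm y <= 1 -> vnorm z <= 1 -> 2^-1 <= 1 + theta y z.
Proof. by move=> y1 z1; have := theta_le y1 z1; rewrite ler_norml => /andP[h1 h2]; have := e8; lra. Qed.

Lemma newx_le y z : vnorm y <= 1 -> vnorm z <= 1 -> vnorm (newx y z) <= 8 * e.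
Proof.
move=> y1 z1; rewrite /newx vnormZ.
have h := theta_ge y1 z1; have t0 : 0 < 1 + theta y z by lra.
rewrite ger0_norm ?invr_ge0 ?(ltW t0)// ler_pdivrMl//.
apply: le_trans (vnorm_proj _ u1) _; apply: le_trans (gvec_le y1 z1) _.
have : 0 <= e * (1 + theta y z - 2^-1) by apply: mulr_ge0 => //; lra.
nra.
Qed.

Lemma newx_eq y z i : vnorm y <= 1 -> vnorm z <= 1 ->
  u i + newx y z i = (1 + theta y z)^-1 * (u i + gvec y z i).
Proof.
move=> y1 z1; have h := theta_ge y1 z1.
have t0 : 1 + theta y z != 0 by rewrite gt_eqF//; lra.
rewrite /newx /proj -/(theta y z); by field.
Qed.

(** The scales of the two inputs factor out of the contraction, and normalization removes them up to
    a sign, which [tang] leaves free. Since [1 + theta] is nonzero the contraction is too, so that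
    [normalize] does not divide by zero. *)
Lemma step_tang vh wh y z : tang v vh y -> tang w wh z -> vnorm y <= 1 -> vnorm z <= 1 ->
  tang u (normalize (contr23 A vh wh)) (newx y z).
Proof.
move=> [s [sn vy vhE]] [s' [sn' wz whE]] y1 z1.
have h := theta_ge y1 z1; have t0 : 1 + theta y z != 0 by rewrite gt_eqF//; lra.
have s0 : s != 0 by apply: contra_eq_neq sn => ->; rewrite expr0n mul0r eq_sym oner_neq0.
have s0' : s' != 0 by apply: contra_eq_neq sn' => ->; rewrite expr0n mul0r eq_sym oner_neq0.
set q := s * s' * (1 + theta y z).
have q0 : q != 0 by rewrite !mulf_neq0.
have cE i : contr23 A vh wh i = q * (u i + newx y z i).
  have -> : vh = (fun j => s * (v j + y j)) by apply/funext => j.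
  have -> : wh = (fun j => s' * (w j + z j)) by apply/funext => j.
  rewrite contr23Z (contr23_model _ _ _ HA) !dotDr !dotxx v1 w1 vy wz newx_eq//.
  rewrite !addr0 !mul1r /q -/(gvec y z); by field.
have du : dot u (newx y z) = 0 by rewrite /newx dotZr dot_proj// mulr0.
have nE : nrm2 (contr23 A vh wh) = q ^+ 2 * (1 + nrm2 (newx y z)).
  have -> : contr23 A vh wh = (fun i => q * (u i + newx y z i)) by apply/funext.
  by rewrite nrm2Z nrm2D u1 du mulr0 addr0.
have n0 : 0 < 1 + nrm2 (newx y z) by rewrite ltr_pwDl ?nrm2_ge0.
have nc0 : 0 < nrm2 (contr23 A vh wh) by rewrite nE mulr_gt0// exprn_even_gt0//= q0.
exists (q / vnorm (contr23 A vh wh)); split => //.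
  rewrite expr_div_n vnorm_sqr nE invfM mulrA divff ?expf_neq0// mul1r mulVf//.
  by rewrite gt_eqF.
by move=> i; rewrite /normalize cE mulrAC.
Qed.

Lemma gvec_split y z i : gvec y z i =
  contr23 E v w i + (contr23 E y w i + contr23 E v z i + contr23 E y z i).
Proof. by rewrite /gvec contr23Dl !contr23Dr; ring. Qed.

Let dg y z : vec R a := fun i => contr23 E y w i + contr23 E v z i + contr23 E y z i.

Let dg_le y z : vnorm y <= 8 * e -> vnorm z <= 8 * e -> vnorm (dg y z) <= 24 * e ^+ 2.
Proof.
move=> y8 z8.
apply: le_trans (vnormD (fun i => contr23 E y w i + contr23 E v z i) (contr23 E y z)) _.
have h1 := vnormD (contr23 E y w) (contr23 E v z).
have h2 := opn_contr23 y w HE; have h3 := opn_contr23 v z HE; have h4 := opn_contr23 y z HE.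
rewrite nw mulr1 in h2; rewrite nv mulr1 in h3.
have y0 := vnorm_ge0 y; have z0 := vnorm_ge0 z.
have h5 : e * vnorm y <= e * (8 * e) by rewrite ler_wpM2l.
have h6 : e * vnorm z <= e * (8 * e) by rewrite ler_wpM2l.
have h7 : e * vnorm y * vnorm z <= e * (8 * e) * 1.
  by apply: ler_pM => //; rewrite ?mulr_ge0//; have := e8; lra.
lra.
Qed.

Lemma theta_near y z : vnorm y <= 8 * e -> vnorm z <= 8 * e ->
  `|theta y z - contr123 E u v w| <= 24 * e ^+ 2.
Proof.
move=> y8 z8.
have -> : theta y z - contr123 E u v w = dot u (dg y z).
  rewrite /theta contr123_dot1 (_ : gvec y z = (fun i => contr23 E v w i + dg y z i)).
    by rewrite dotDr; ring.
  by apply/funext => i; rewrite gvec_split.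
by apply: le_trans (cauchy_schwarz _ _) _; rewrite nu mul1r dg_le.
Qed.

(** The difference equals [- theta * newx] plus the projection of [dg], the part of [gvec] that
    involves [y] or [z]. These contribute [4 e * 8 e] and [24 e^2]; [64] leaves room. *)
Lemma newx_near y z : vnorm y <= 8 * e -> vnorm z <= 8 * e ->
  vnorm (fun i => newx y z i - proj u (contr23 E v w) i) <= 64 * e ^+ 2.
Proof.
move=> y8 z8.
have y1 : vnorm y <= 1 by have := e8; lra.
have z1 : vnorm z <= 1 by have := e8; lra.
have h := theta_ge y1 z1; have t0 : 1 + theta y z != 0 by rewrite gt_eqF//; lra.
have -> : (fun i => newx y z i - proj u (contr23 E v w) i) =
   (fun i => (- theta y z) * newx y z i + proj u (dg y z) i).
  apply/funext => i.
  have e1 : proj u (gvec y z) i = proj u (contr23 E v w) i + proj u (dg y z) i.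
    rewrite /proj (_ : gvec y z = (fun i => contr23 E v w i + dg y z i)).
      by rewrite dotDr; ring.
    by apply/funext => l; rewrite gvec_split.
  rewrite /newx e1; by field.
apply: le_trans (vnormD _ _) _; rewrite vnormZ normrN.
have h1 := theta_le y1 z1; have h2 := newx_le y1 z1.
have h3 := vnorm_proj (dg y z) u1; have h4 := dg_le y8 z8.
have h5 : `|theta y z| * vnorm (newx y z) <= (4 * e) * (8 * e).
  by apply: ler_pM => //; rewrite vnorm_ge0.
have := sqr_ge0 e; nra.
Qed.

(** In [E(e_i, y, w)], replacing [y] by its first-order term costs [e * 64 e^2] and leaves [quad12]
    minus [E(u, v, w) E(e_i, v, w)], the latter produced by the projection. The [z] slot is
    symmetric. The term containing both [y] and [z] is already cubic, [64 e^3], whence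
    [192 = 3 * 64]. *)
Lemma entry_near y z i :
  vnorm y <= 8 * e -> vnorm z <= 8 * e ->
  vnorm (fun j => y j - proj v (contr13 E u w) j) <= 64 * e ^+ 2 ->
  vnorm (fun k => z k - proj w (contr12 E u v) k) <= 64 * e ^+ 2 ->
  `|gvec y z i - contr123 E (delta R i) v w| <=
    `|quad12 E (delta R i) u w| + `|quad12 (perm23 E) (delta R i) u v|
    + 2 * (`|contr123 E u v w| * `|contr123 E (delta R i) v w|) + 192 * e ^+ 3.
Proof.
move=> y8 z8 yn zn.
rewrite gvec_split -contr23_delta addrAC subrr add0r.
have nd : vnorm (delta R i) = 1 by rewrite vnormE nrm2_delta sqrtr1.
set xi := contr23 E v w i; set g0 := contr123 E u v w.
have A1 : `|contr23 E y w i| <= `|quad12 E (delta R i) u w| + `|g0| * `|xi| + 64 * e ^+ 3.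
  have -> : contr23 E y w i = (quad12 E (delta R i) u w - g0 * xi) +
     contr123 E (delta R i) (fun j => y j - proj v (contr13 E u w) j) w.
    rewrite contr23_delta !contr123_dot2 /g0 /xi contr23_delta !contr123_dot2 /quad12.
    rewrite (_ : (fun j => _) = (fun j => y j + (-1) * (contr13 E u w j + (- dot v (contr13 E u w)) * v j))).
      by rewrite dotDl dotZl dotDl dotZl (dotC (contr13 E u w)); ring.
    by apply/funext => j; rewrite /proj; ring.
  apply: le_trans (ler_normD _ _) _; apply: lerD.
    by apply: le_trans (ler_normB _ _) _; rewrite normrM.
  apply: le_trans (opn_hom _ _ _ HE) _; rewrite nd nw !mulr1 exprS mulrCA.
  by rewrite ler_wpM2l.
have A2 : `|contr23 E v z i| <= `|quad12 (perm23 E) (delta R i) u v| + `|g0| * `|xi| + 64 * e ^+ 3.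
  have -> : contr23 E v z i = (quad12 (perm23 E) (delta R i) u v - g0 * xi) +
     contr123 E (delta R i) v (fun k => z k - proj w (contr12 E u v) k).
    rewrite contr23_delta !contr123_dot3 /g0 /xi contr23_delta !contr123_dot3 /quad12.
    rewrite (_ : (fun j => _) = (fun j => z j + (-1) * (contr12 E u v j + (- dot w (contr12 E u v)) * w j))).
      rewrite dotDl dotZl dotDl dotZl (dotC (contr12 E u v)).
      by rewrite -!/(contr13 (perm23 E) _ _); ring.
    by apply/funext => j; rewrite /proj; ring.
  apply: le_trans (ler_normD _ _) _; apply: lerD.
    by apply: le_trans (ler_normB _ _) _; rewrite normrM.
  apply: le_trans (opn_hom _ _ _ HE) _; rewrite nd nv !mulr1 exprS mulrCA.
  by rewrite ler_wpM2l.
have A3 : `|contr23 E y z i| <= 64 * e ^+ 3.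
  rewrite contr23_delta; apply: le_trans (opn_hom _ _ _ HE) _; rewrite nd mulr1.
  apply: (@le_trans _ _ (e * (8 * e) * (8 * e))); last by rewrite le_eqVlt; apply/orP; left; apply/eqP; ring.
  by apply: ler_pM; rewrite ?mulr_ge0 ?vnorm_ge0//; rewrite ler_wpM2l.
apply: le_trans (ler_normD _ _) _; have := ler_normD (contr23 E y w i) (contr23 E v z i).
lra.
Qed.

End step.
End Det.

(** * Spectral initialization and propagation of the errors *)

Section Iter.
Variable R : realType.

(** The shift [q * nrm2] is the same for all unit vectors, so maximality at [x], tested against [u],
    compares [s^2] with [1] up to [2 e + del] on each side: [s^2 >= 1 - 4 e - 2 del >= 1/2]. The
    tangent vector [x / s - u] then has squared norm [1 / s^2 - 1 <= 1]. *)
Lemma init_tang a b c (u : vec R a) (v : vec R b) (w : vec R c) (E A : tensor3 R a b c)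
    (e q del : R) (x : vec R a) :
  nrm2 u = 1 -> nrm2 v = 1 -> nrm2 w = 1 -> model u v w E A -> opn E e ->
  (forall x, nrm2 x <= 1 -> `|gram (mat1 E) x - q * nrm2 x| <= del) ->
  e <= 16^-1 -> del <= 8^-1 -> leading_lsv (mat1 A) x ->
  exists2 y, tang u x y & vnorm y <= 1.
Proof.
move=> u1 v1 w1 HA HE Hg e16 d8 [/vnorm1 x1 xmax].
have gE (t : vec R a) : gram (mat1 A) t =
    dot u t ^+ 2 + 2 * dot u t * contr123 E t v w + gram (mat1 E) t.
  have -> : dot u t ^+ 2 = \sum_(jk : 'I_b * 'I_c) (dot u t * (v jk.1 * w jk.2)) ^+ 2.
    rewrite -(pair_bigA _ (fun j k => (dot u t * (v j * w k)) ^+ 2)) /=.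
    rewrite -[LHS]mulr1 -[X in _ * X]mulr1 -{1}v1 -w1 /nrm2 big_distrlr /= mulr_sumr.
    apply: eq_bigr => j _; rewrite mulr_sumr; apply: eq_bigr => k _; by rewrite !exprMn.
  have -> : contr123 E t v w = \sum_(jk : 'I_b * 'I_c) v jk.1 * w jk.2 * \sum_i t i * mat1 E i jk.
    rewrite -(pair_bigA _ (fun j k => v j * w k * \sum_i t i * mat1 E i (j, k))) /= /contr123.
    under [RHS]eq_bigr do under eq_bigr do rewrite mulr_sumr.
    under [RHS]eq_bigr do rewrite exchange_big.
    rewrite [RHS]exchange_big /=; apply: eq_bigr => i _; apply: eq_bigr => j _.
    by apply: eq_bigr => k _; rewrite /mat1 /=; ring.
  rewrite mulr_sumr -!big_split /gram; apply: eq_bigr => jk _ /=.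
  have -> : \sum_i t i * mat1 A i jk = dot u t * (v jk.1 * w jk.2) + \sum_i t i * mat1 E i jk.
    rewrite /dot mulr_suml -big_split; apply: eq_bigr => i _ /=.
    by rewrite /mat1 HA; ring.
  ring.
have vu : vnorm u = 1 by rewrite vnormE u1 sqrtr1.
have := xmax u vu; rewrite -!/(gram (mat1 A) _) !gE dotxx u1.
have := HE x v w; have := HE u v w; rewrite x1 u1 v1 w1 !lexx => /(_ isT isT isT) hu /(_ isT isT isT) hx.
have := Hg x; have := Hg u; rewrite x1 u1 !lexx => /(_ isT) gu /(_ isT) gx.
have hdot : `|dot u x| <= 1.
  by apply: le_trans (cauchy_schwarz _ _) _; rewrite vu mul1r vnormE x1 sqrtr1.
have hp : `|dot u x * contr123 E x v w| <= e.
  rewrite normrM; apply: le_trans (ler_pM _ _ hdot hx) _; rewrite ?mul1r//.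
move: hu hp gu gx; rewrite !ler_norml => /andP[a1 a2] /andP[b1 b2] /andP[c1 c2] /andP[d1 d2] mx.
set s := dot u x in mx b1 b2 *.
have s2 : 2^-1 <= s ^+ 2.
  by move: mx; rewrite expr1n -!mulrA; set K := s * _ in b1 b2 *; lra.
have s0 : s != 0 by apply: contraTneq s2 => ->; rewrite expr0n -ltNge invr_gt0.
pose y : vec R a := fun i => s^-1 * x i + (-1) * u i.
have yn : nrm2 y = (s ^+ 2)^-1 - 1.
  by rewrite nrm2D !nrm2Z dotZl dotZr x1 u1 (dotC x u) -/s; field.
exists y.
  exists s; split.
  - by rewrite yn addrC subrK divff// expf_neq0.
  - by rewrite dotDr !dotZr dotxx u1 -/s mulVf//; ring.
  - by move=> i; rewrite /y; field.
apply: vnorm_le => //; rewrite yn expr1n lerBlDr.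
have : (s ^+ 2)^-1 <= (2^-1)^-1 by rewrite lef_pV2 ?posrE ?invr_gt0// exprn_even_gt0//= s0.
by rewrite invrK; lra.
Qed.

Lemma normalize_scale m (s : R) (x : vec R m) : 0 < s ->
  normalize (fun i => s * x i) = normalize x.
Proof.
move=> s0; apply/funext => i; rewrite /normalize vnormZ gtr0_norm// invfM mulrACA.
by rewrite divff ?mul1r ?gt_eqF.
Qed.

Lemma contr23_scale a b c (A A' : tensor3 R a b c) (s : R) y z :
  (forall i j k, A i j k = s * A' i j k) ->
  contr23 A y z = (fun i => s * contr23 A' y z i).
Proof.
move=> H; apply/funext => i; rewrite /contr23 mulr_sumr; apply: eq_bigr => j _.
by rewrite mulr_sumr; apply: eq_bigr => k _; rewrite H; ring.
Qed.

Lemma power_iter_scale a b c (A A' : tensor3 R a b c) (s : R) u0 v0 w0 t : 0 < s ->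
  (forall i j k, A i j k = s * A' i j k) ->
  power_iter A u0 v0 w0 t = power_iter A' u0 v0 w0 t.
Proof.
move=> s0 H; elim: t => //= t ->; case: (power_iter A' u0 v0 w0 t) => -[u v] w.
congr (_, _, _).
- by rewrite (contr23_scale _ _ H) normalize_scale.
- have H' : forall i j k, perm12 A i j k = s * perm12 A' i j k by move=> *; exact: H.
  by have := contr23_scale u w H' => /= h; rewrite -[contr13 A u w]/(contr23 (perm12 A) u w) h normalize_scale.
- have H' : forall i j k, perm13 A i j k = s * perm13 A' i j k by move=> *; exact: H.
  by have := contr23_scale u v H' => /= h; rewrite -[contr12 A u v]/(contr23 (perm13 A) u v) h normalize_scale.
Qed.

Lemma leading_lsv_scale m (C : finType) (M M' : 'I_m -> C -> R) (s : R) x : 0 < s ->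
  (forall i c, M i c = s * M' i c) -> leading_lsv M x -> leading_lsv M' x.
Proof.
move=> s0 H [x1 xmax]; split => // y y1; have := xmax y y1.
have E t : \sum_(c : C) (\sum_(i < m) t i * M i c) ^+ 2 =
    s ^+ 2 * \sum_(c : C) (\sum_(i < m) t i * M' i c) ^+ 2.
  rewrite mulr_sumr; apply: eq_bigr => c _; rewrite -exprMn mulr_sumr.
  by congr (_ ^+ 2); apply: eq_bigr => i _; rewrite H mulrCA.
by rewrite !E ler_pM2l// exprn_gt0.
Qed.

Lemma contr12_perm12 a b c (E : tensor3 R a b c) u v : contr12 (perm12 E) v u = contr12 E u v.
Proof.
apply/funext => k; rewrite /contr12 exchange_big /=; apply: eq_bigr => i _.
by apply: eq_bigr => j _; rewrite /perm12; ring.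
Qed.

Lemma contr13_perm13 a b c (E : tensor3 R a b c) v w : contr13 (perm13 E) w v = contr23 E v w.
Proof.
apply/funext => i; rewrite /contr13 /contr23 exchange_big /=; apply: eq_bigr => j _.
by apply: eq_bigr => k _; rewrite /perm13; ring.
Qed.

Lemma contr12_perm13 a b c (E : tensor3 R a b c) u w : contr12 (perm13 E) w u = contr13 E u w.
Proof.
apply/funext => j; rewrite /contr12 /contr13 exchange_big /=; apply: eq_bigr => i _.
by apply: eq_bigr => k _; rewrite /perm13; ring.
Qed.

Section iter.
Variables (a b c : nat) (u : vec R a) (v : vec R b) (w : vec R c).
Variables (E A : tensor3 R a b c) (e : R).
Hypotheses (u1 : nrm2 u = 1) (v1 : nrm2 v = 1) (w1 : nrm2 w = 1).
Hypotheses (HE : opn E e) (e8 : e <= 8^-1) (HA : model u v w E A).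

Let HA2 : model v u w (perm12 E) (perm12 A).
Proof. by move=> j i k; rewrite /perm12 HA; ring. Qed.
Let HA3 : model w u v (perm13 E) (perm13 A).
Proof. by move=> k i j; rewrite /perm13 HA; ring. Qed.
Let HE2 := opn_perm12 HE.
Let HE3 := opn_perm13 HE.

(* The error of iterate [n] is at most [1] at the start, of order [e] after one step and within
   [O(e^2)] of its first-order term after two. *)
Definition state (n : nat) (uh : vec R a) (vh : vec R b) (wh : vec R c) x y z :=
  [/\ tang u uh x, tang v vh y & tang w wh z] /\
  [/\ vnorm x <= 1, vnorm y <= 1 & vnorm z <= 1] /\
  ((0 < n)%N -> [/\ vnorm x <= 8 * e, vnorm y <= 8 * e & vnorm z <= 8 * e]) /\
  ((1 < n)%N -> [/\ vnorm (fun i => x i - proj u (contr23 E v w) i) <= 64 * e ^+ 2,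
     vnorm (fun j => y j - proj v (contr13 E u w) j) <= 64 * e ^+ 2
   & vnorm (fun k => z k - proj w (contr12 E u v) k) <= 64 * e ^+ 2]).

Lemma state_step n uh vh wh x y z : state n uh vh wh x y z ->
  state n.+1 (normalize (contr23 A vh wh)) (normalize (contr13 A uh wh))
    (normalize (contr12 A uh vh))
    (newx u v w E y z) (newx v u w (perm12 E) x z) (newx w u v (perm13 E) x y).
Proof.
move=> [[tx ty tz] [[x1 y1 z1] [H1 _]]].
have l1 := newx_le u1 v1 w1 HE e8 y1 z1.
have l2 := newx_le v1 u1 w1 HE2 e8 x1 z1.
have l3 := newx_le w1 u1 v1 HE3 e8 x1 y1.
split; [split|split; [split|split]].
- exact: (step_tang u1 v1 w1 HE e8 HA ty tz y1 z1).
- exact: (step_tang v1 u1 w1 HE2 e8 HA2 tx tz x1 z1).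
- exact: (step_tang w1 u1 v1 HE3 e8 HA3 tx ty x1 y1).
- by have := e8; lra.
- by have := e8; lra.
- by have := e8; lra.
- by move=> _; split.
move=> n1; have [] := H1; first by case: (n) n1.
move=> x8 y8 z8; split.
- exact: (newx_near u1 v1 w1 HE e8 y8 z8).
- exact: (newx_near v1 u1 w1 HE2 e8 x8 z8).
- exact: (newx_near w1 u1 v1 HE3 e8 x8 y8).
Qed.

Lemma state_iter u0 v0 w0 x y z n : state 0 u0 v0 w0 x y z ->
  let: (uh, vh, wh) := power_iter A u0 v0 w0 n in
  exists x' y' z', state n uh vh wh x' y' z'.
Proof.
move=> s0; elim: n => /= [|n]; first by exists x, y, z.
case: (power_iter A u0 v0 w0 n) => -[uh vh] wh [x' [y' [z' s]]].
by do 3 eexists; exact: (state_step s).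
Qed.

Lemma near1_mul (f g al be : R) : `|f - 1| <= al -> `|g - 1| <= be ->
  `|f * g - 1| <= al + be + al * be.
Proof.
move=> hf hg; rewrite (_ : f * g - 1 = (f - 1) + (g - 1) + (f - 1) * (g - 1)); last by ring.
apply: le_trans (ler_normD _ _) _; apply: lerD.
  by apply: le_trans (ler_normD _ _) _; exact: lerD.
by rewrite normrM; apply: ler_pM.
Qed.

Lemma near1_inv (t k : R) : `|t| <= k -> k <= 100^-1 -> `|(1 + t)^-1 - 1| <= 2 * k.
Proof.
move=> /[dup] ht; rewrite ler_norml => /andP[h1 h2] k1.
have p : 0 < 1 + t by lra.
rewrite (_ : (1 + t)^-1 - 1 = - t / (1 + t)); last by field; rewrite gt_eqF.
rewrite normrM normrN normfV (gtr0_norm p) ler_pdivrMr//.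
have : 0 <= k by apply: le_trans ht. nra.
Qed.

Lemma near1_prod (k e0 t1 t2 t3 n1 n2 n3 : R) : k <= 100^-1 ->
  `|e0| <= k -> `|t1| <= k -> `|t2| <= k -> `|t3| <= k ->
  `|n1| <= k -> `|n2| <= k -> `|n3| <= k ->
  `|(1 + e0) * ((1 + t1)^-1 * (1 + t2)^-1 * (1 + t3)^-1 *
     ((1 + n1)^-1 * (1 + n2)^-1 * (1 + n3)^-1)) - 1| <= 16 * k.
Proof.
move=> k1 he h1 h2 h3 m1 m2 m3.
have k0 : 0 <= k by apply: le_trans he.
have kk : k * k <= 100^-1 * k by rewrite ler_wpM2r.
have e1 : `|1 + e0 - 1| <= k by rewrite addrAC subrr add0r.
have I t : `|t| <= k -> `|(1 + t)^-1 - 1| <= 2 * k by move=> ht; exact: near1_inv.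
have T : forall t1 t2 t3, `|t1| <= k -> `|t2| <= k -> `|t3| <= k ->
    `|(1 + t1)^-1 * (1 + t2)^-1 * (1 + t3)^-1 - 1| <= 7 * k.
  move=> s1 s2 s3 g1 g2 g3.
  have p2 : `|(1 + s1)^-1 * (1 + s2)^-1 - 1| <= 5 * k.
    by apply: le_trans (near1_mul (I _ g1) (I _ g2)) _; nra.
  have p3 := near1_mul p2 (I _ g3).
  have p3' : `|(1 + s1)^-1 * (1 + s2)^-1 * (1 + s3)^-1 - 1| <= 7 * k + 10 * (k * k).
    by apply: le_trans p3 _; nra.
  have p2' : `|(1 + s1)^-1 * (1 + s2)^-1 - 1| <= 4 * k + 4 * (k * k).
    by apply: le_trans (near1_mul (I _ g1) (I _ g2)) _; nra.
  apply: le_trans (near1_mul p2' (I _ g3)) _; nra.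
have p := near1_mul (T _ _ _ h1 h2 h3) (T _ _ _ m1 m2 m3).
apply: le_trans (near1_mul e1 p) _.
nra.
Qed.

Lemma tang_scale m (x : vec R m) (s k : R) : s ^+ 2 * (1 + nrm2 x) = 1 -> nrm2 x <= k ->
  [/\ `|s| <= 1, s ^+ 2 = (1 + nrm2 x)^-1 & (1 + k)^-1 <= `|s|].
Proof.
move=> h nk; have n0 := nrm2_ge0 x; have p : 0 < 1 + nrm2 x by lra.
have s2 : s ^+ 2 = (1 + nrm2 x)^-1.
  by apply: (mulIf (x := 1 + nrm2 x)); rewrite ?gt_eqF// h mulVf ?gt_eqF.
have s1 : `|s| <= 1.
  rewrite -(@ler_pXn2r _ 2) ?nnegrE// expr1n real_normK ?num_real// s2.
  by rewrite invf_le1//; lra.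
split=> //; apply: (@le_trans _ _ (s ^+ 2)).
  by rewrite s2 lef_pV2 ?posrE//; lra.
by rewrite -(real_normK (num_real s)) expr2 ler_piMl.
Qed.

(** The interval width is built from entries of the estimate, so their magnitudes must be bounded
    below. The constant comes from [(1 + k)^-2 >= 1 - 2 k]. *)
Lemma entry_ge (k t s U g : R) : 0 <= k -> k <= 100^-1 -> `|t| <= k -> (1 + k)^-1 <= `|s| ->
  (1 - 2 * k) * `|U + g| <= `|s * ((1 + t)^-1 * (U + g))|.
Proof.
move=> k0 k1; rewrite ler_norml => /andP[h1 h2] hs.
have p : 0 < 1 + t by lra.
have pk : 0 < 1 + k by lra.
rewrite !normrM mulrA ler_wpM2r// normfV (gtr0_norm p).
apply: (@le_trans _ _ ((1 + k)^-1 * (1 + k)^-1)).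
  by rewrite -invfM -[leRHS]mul1r ler_pdivlMr ?mulr_gt0//; nra.
by apply: ler_pM; rewrite ?invr_ge0 ?(ltW pk)// lef_pV2 ?posrE//; lra.
Qed.

Lemma contr123_near x y z : vnorm x <= 8 * e -> vnorm y <= 8 * e -> vnorm z <= 8 * e ->
  `|contr123 E (fun i => u i + x i) (fun j => v j + y j) (fun k => w k + z k)
    - contr123 E u v w| <= 64 * e ^+ 2.
Proof.
move=> x8 y8 z8; have he0 := opn_ge0 HE; have he8 := e8.
have y1 : vnorm y <= 1 by lra.
have z1 : vnorm z <= 1 by lra.
have h1 := theta_near u1 v1 w1 HE e8 y8 z8.
have h2 := gvec_le v1 w1 HE y1 z1.
have h3 := cauchy_schwarz x (gvec v w E y z).
have h4 : vnorm x * vnorm (gvec v w E y z) <= (8 * e) * (4 * e).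
  by apply: ler_pM; rewrite ?vnorm_ge0.
have -> : contr123 E (fun i => u i + x i) (fun j => v j + y j) (fun k => w k + z k)
    - contr123 E u v w = dot x (gvec v w E y z) + (theta u v w E y z - contr123 E u v w).
  by rewrite contr123_dot1 dotDl /theta /gvec; ring.
apply: le_trans (ler_normD _ _) _; have := sqr_ge0 e; nra.
Qed.

Lemma contr123_model x y z : model u v w E A ->
  contr123 A x y z = dot u x * dot v y * dot w z + contr123 E x y z.
Proof.
move=> H; rewrite !contr123_dot1 (_ : contr23 A y z = (fun i => (dot v y * dot w z) * u i + contr23 E y z i)).
  by rewrite dotDr dotZr (dotC x u); ring.
by apply/funext => i; rewrite (contr23_model _ _ _ H).
Qed.

(** Both [contr123 A U V W] and [U i * V j * W k] carry the factor [s1 * s2 * s3], so their product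
    contains only squares, equal to [(1 + nrm2 x)^-1]: the signs disappear, and all normalizations
    are collected in [cc]. The last update is separated from the first [n] because its entries are
    those of [gvec] at arguments already known up to [O(e^2)]. *)
Lemma det_final n uh vh wh x y z i j k : (1 < n)%N -> state n uh vh wh x y z ->
  let U := normalize (contr23 A vh wh) in let V := normalize (contr13 A uh wh) in
  let W := normalize (contr12 A uh vh) in
  let g0 := contr123 E u v w in
  let kap := `|g0| + 64 * e ^+ 2 in
  kap <= 100^-1 ->
  contr123 A U V W != 0 /\ exists cc g1 g2 g3,
  [/\ contr123 A U V W * U i * V j * W k = cc * (u i + g1) * (v j + g2) * (w k + g3),
      `|cc - 1| <= 16 * kap & `|contr123 A U V W| <= 1 + kap] /\
  [/\ (1 - 2 * kap) * `|u i + g1| <= `|U i|, (1 - 2 * kap) * `|v j + g2| <= `|V j|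
    & (1 - 2 * kap) * `|w k + g3| <= `|W k|] /\
  [/\ `|g1 - contr123 E (delta R i) v w| <=
        `|quad12 E (delta R i) u w| + `|quad12 (perm23 E) (delta R i) u v|
         + 2 * (`|g0| * `|contr123 E (delta R i) v w|) + 192 * e ^+ 3,
      `|g2 - contr123 E u (delta R j) w| <=
        `|quad12 (perm12 E) (delta R j) v w| + `|quad12 (perm23 (perm12 E)) (delta R j) v u|
         + 2 * (`|g0| * `|contr123 E u (delta R j) w|) + 192 * e ^+ 3
    & `|g3 - contr123 E u v (delta R k)| <=
        `|quad12 (perm13 E) (delta R k) w v| + `|quad12 (perm23 (perm13 E)) (delta R k) w u|
         + 2 * (`|g0| * `|contr123 E u v (delta R k)|) + 192 * e ^+ 3].
Proof.
move=> n1 st U V W g0 kap kap1.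
have he0 := opn_ge0 HE; have he8 := e8; have hee := sqr_ge0 e.
have kap0 : 0 <= kap by rewrite addr_ge0// mulr_ge0.
have [[[s1 [sn1 dx UE]] [s2 [sn2 dy VE]] [s3 [sn3 dz WE]]] [_ [H1 _]]] := state_step st.
have [X8 Y8 Z8] := H1 isT.
have [_ [[x1 y1 z1] [H8 Hn]]] := st.
have [x8 y8 z8] := H8 (ltnW n1); have [xn yn zn] := Hn n1.
set X := newx u v w E y z in UE sn1 dx X8.
set Y := newx v u w (perm12 E) x z in VE sn2 dy Y8.
set Z := newx w u v (perm13 E) x y in WE sn3 dz Z8.
have {}UE : forall l, U l = s1 * (u l + X l) by exact: UE.
have {}VE : forall l, V l = s2 * (v l + Y l) by exact: VE.
have {}WE : forall l, W l = s3 * (w l + Z l) by exact: WE.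
have nk m (t : vec R m) : vnorm t <= 8 * e -> nrm2 t <= kap.
  by move=> /nrm2_le h; apply: le_trans h _; rewrite /kap exprMn; have := normr_ge0 g0; nra.
have [a1 q1 l1] := tang_scale sn1 (nk _ _ X8).
have [a2 q2 l2] := tang_scale sn2 (nk _ _ Y8).
have [a3 q3 l3] := tang_scale sn3 (nk _ _ Z8).
have tk (t : R) : `|t - g0| <= 64 * e ^+ 2 -> `|t| <= kap.
  by move=> h; rewrite -[t](subrK g0) addrC; apply: le_trans (ler_normD _ _) _; rewrite lerD2l.
have e24 : 24 * e ^+ 2 <= 64 * e ^+ 2 by rewrite ler_wpM2r ?sqr_ge0// ler_nat.
have T1 : `|theta u v w E y z| <= kap.
  by apply: tk; apply: le_trans (theta_near u1 v1 w1 HE e8 y8 z8) e24.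
have T2 : `|theta v u w (perm12 E) x z| <= kap.
  by apply: tk; have := theta_near v1 u1 w1 HE2 e8 x8 z8; rewrite contr123_perm12 => /le_trans; apply.
have T3 : `|theta w u v (perm13 E) x y| <= kap.
  by apply: tk; have := theta_near w1 u1 v1 HE3 e8 x8 y8; rewrite contr123_perm13 => /le_trans; apply.
have XE := newx_eq u1 v1 w1 HE e8 i y1 z1.
have YE := newx_eq v1 u1 w1 HE2 e8 j x1 z1.
have ZE := newx_eq w1 u1 v1 HE3 e8 k x1 y1.
pose E0 := contr123 E (fun i => u i + X i) (fun j => v j + Y j) (fun k => w k + Z k).
have E0k : `|E0| <= kap by apply: tk; exact: contr123_near.
have CE : contr123 A U V W = s1 * s2 * s3 * (1 + E0).
  have -> : U = (fun i => s1 * (u i + X i)) by apply/funext => l; rewrite UE.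
  have -> : V = (fun i => s2 * (v i + Y i)) by apply/funext => l; rewrite VE.
  have -> : W = (fun i => s3 * (w i + Z i)) by apply/funext => l; rewrite WE.
  have -> : contr123 A (fun i => s1 * (u i + X i)) (fun i => s2 * (v i + Y i)) (fun i => s3 * (w i + Z i)) =
     s1 * s2 * s3 * contr123 A (fun i => u i + X i) (fun j => v j + Y j) (fun k => w k + Z k).
    rewrite /contr123 mulr_sumr; apply: eq_bigr => l1' _; rewrite mulr_sumr.
    apply: eq_bigr => l2' _; rewrite mulr_sumr; apply: eq_bigr => l3' _; ring.
  rewrite (contr123_model _ _ _ HA) !dotDr !dotxx u1 v1 w1 dx dy dz !addr0 !mulr1.
  by [].
have C0 : contr123 A U V W != 0.
  have sn0 m (t : vec R m) s : s ^+ 2 * (1 + nrm2 t) = 1 -> s != 0.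
    by move=> h; apply: contra_eq_neq h => ->; rewrite expr0n mul0r eq_sym oner_neq0.
  rewrite CE !mulf_neq0 ?(sn0 _ _ _ sn1) ?(sn0 _ _ _ sn2) ?(sn0 _ _ _ sn3)//.
  by rewrite gt_eqF//; move: E0k; rewrite ler_norml => /andP[h _]; clear - h kap1; lra.
split=> //.
exists ((1 + E0) * ((1 + theta u v w E y z)^-1 * (1 + theta v u w (perm12 E) x z)^-1
    * (1 + theta w u v (perm13 E) x y)^-1 *
    ((1 + nrm2 X)^-1 * (1 + nrm2 Y)^-1 * (1 + nrm2 Z)^-1))).
exists (gvec v w E y z i), (gvec u w (perm12 E) x z j), (gvec u v (perm13 E) x y k).
split; [split|split; split].
- rewrite CE UE VE WE XE YE ZE -q1 -q2 -q3; ring.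
- have nn m (t : vec R m) : vnorm t <= 8 * e -> `|nrm2 t| <= kap.
    by move=> h; rewrite ger0_norm ?nrm2_ge0// nk.
  by apply: near1_prod => //; apply: nn.
- rewrite CE !normrM; apply: (@le_trans _ _ (1 * (1 + kap))); last by rewrite mul1r.
  apply: ler_pM; rewrite ?mulr_ge0//.
    by apply: mulr_ile1; rewrite ?mulr_ge0//; apply: mulr_ile1.
  by apply: le_trans (ler_normD _ _) _; rewrite normr1 lerD2l.
- by rewrite UE XE; exact: entry_ge.
- by rewrite VE YE; exact: entry_ge.
- by rewrite WE ZE; exact: entry_ge.
- exact: (entry_near v1 w1 HE i y8 z8 yn zn).
- have := entry_near (u := v) u1 w1 HE2 j x8 z8 xn.
  rewrite contr12_perm12 => /(_ zn).
  by rewrite (contr123_perm12 E u (delta R j) w) (contr123_perm12 E u v w).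
- have := entry_near (u := w) u1 v1 HE3 k x8 y8.
  rewrite contr13_perm13 contr12_perm13 => /(_ xn yn).
  by rewrite (contr123_perm13 E u v (delta R k)) (contr123_perm13 E u v w).
Qed.

End iter.
End Iter.

(** * Error of the estimated entry *)

Section Expansion.
Variable R : realType.

(** Here [s] is a truncated magnitude and [L] stands for [sqrt (log p)]. The chain [M |A| <= M^2 /
    mu <= tau L / mu <= 2 tau s] shows that the noise [A], even multiplied by [M], is a [tau]
    fraction of [s]. *)
Lemma near_scale (mu L tau M U A s : R) : 0 < mu -> 0 < tau -> tau <= 100^-1 ->
  1 <= M -> `|mu * A| <= M -> M ^+ 2 <= tau * L -> 0 <= s ->
  (1 - 2 * tau) * `|U + A| <= s -> L <= (1 + tau) * (mu * s) ->
  [/\ M * `|A| <= 2 * tau * s & `|U| <= (1 + 6 * tau) * s].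
Proof.
move=> mu0 t0 t1 M1 hA ML s0 hs hL.
have MA : M * `|A| <= 2 * tau * s.
  rewrite -(ler_pM2l mu0); move: hA; rewrite normrM (gtr0_norm mu0) => hA.
  have h1 : M * (mu * `|A|) <= M * M by rewrite ler_wpM2l//; lra.
  have h2 : tau * L <= tau * ((1 + tau) * (mu * s)) by rewrite ler_wpM2l// ltW.
  have ms : 0 <= mu * s by rewrite mulr_ge0// ltW.
  have h3 : tau * ((1 + tau) * (mu * s)) <= tau * (2 * (mu * s)).
    by rewrite ler_wpM2l ?ler_wpM2r ?(ltW t0)//; lra.
  by move: ML; rewrite expr2; lra.
split=> //.
have A0 := normr_ge0 A.
have h1 : `|A| <= 2 * tau * s by apply: le_trans MA; rewrite ler_peMl.
have h2 : `|U + A| <= (1 + 4 * tau) * s.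
  have h : 0 <= tau * (1 - 4 * tau) by rewrite mulr_ge0//; lra.
  have p : 0 < 1 - 2 * tau by lra.
  rewrite -(ler_pM2l p); apply: le_trans hs _; rewrite mulrA ler_peMl//; nra.
have h3 : `|U| <= `|U + A| + `|A|.
  by rewrite -{1}(addrK A U); exact: ler_normB.
lra.
Qed.

(** In each error term of the expanded product, two factors are controlled by truncated magnitudes
    whose product is at most [S], and what is left is of size [tau]. The second conclusion compares
    [S] with the variance of the linear form, cross terms apart. *)
Lemma cov_alg (mu L tau M U V W A B D xi eta zeta cc su sv sw S : R) :
  0 < mu -> 0 < tau -> tau <= 100^-1 -> 1 <= M -> M ^+ 2 <= tau * L ->
  `|mu * A| <= M -> `|mu * B| <= M -> `|mu * D| <= M ->
  `|mu * A - xi| <= tau -> `|mu * B - eta| <= tau -> `|mu * D - zeta| <= tau ->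
  `|cc - 1| * M <= tau -> mu * `|cc - 1| * `|U| <= tau ->
  0 <= su -> 0 <= sv -> 0 <= sw ->
  (1 - 2 * tau) * `|U + A| <= su -> (1 - 2 * tau) * `|V + B| <= sv ->
  (1 - 2 * tau) * `|W + D| <= sw ->
  L <= (1 + tau) * (mu * su) -> L <= (1 + tau) * (mu * sv) -> L <= (1 + tau) * (mu * sw) ->
  0 <= S -> S ^+ 2 = su ^+ 2 * sv ^+ 2 + sv ^+ 2 * sw ^+ 2 + sw ^+ 2 * su ^+ 2 ->
  `|mu * cc * (U + A) * (V + B) * (W + D) - mu * U * V * W| <=
     `|xi * (V * W) + eta * (U * W) + zeta * (U * V)| + 60 * tau * S /\
  (U * V) ^+ 2 + (V * W) ^+ 2 + (W * U) ^+ 2 <= ((1 + 6 * tau) ^+ 2 * S) ^+ 2.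
Proof.
move=> mu0 t0 t1 M1 ML hA hB hD hxi heta hzeta ccM ccU su0 sv0 sw0 hu hv hw Lu Lv Lw S0 SE.
have [MA Ub] := near_scale mu0 t0 t1 M1 hA ML su0 hu Lu.
have [MB Vb] := near_scale mu0 t0 t1 M1 hB ML sv0 hv Lv.
have [MD Wb] := near_scale mu0 t0 t1 M1 hD ML sw0 hw Lw.
have A0 := normr_ge0 A; have B0 := normr_ge0 B; have D0 := normr_ge0 D.
have U0 := normr_ge0 U; have V0 := normr_ge0 V; have W0 := normr_ge0 W.
have two x y : x <= (1 + 6 * tau) * y -> 0 <= y -> x <= 2 * y.
  by move=> h y0; apply: le_trans h _; rewrite ler_wpM2r//; clear - t1; lra.
have U2 := two _ _ Ub su0; have V2 := two _ _ Vb sv0; have W2 := two _ _ Wb sw0.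
have leS x y : 0 <= x -> 0 <= y -> x ^+ 2 * y ^+ 2 <= S ^+ 2 -> x * y <= S.
  by move=> x0 y0 h; rewrite -(@ler_pXn2r _ 2) ?nnegrE ?mulr_ge0// exprMn.
have p1 : 0 <= su ^+ 2 * sv ^+ 2 by rewrite mulr_ge0 ?sqr_ge0.
have p2 : 0 <= sv ^+ 2 * sw ^+ 2 by rewrite mulr_ge0 ?sqr_ge0.
have p3 : 0 <= sw ^+ 2 * su ^+ 2 by rewrite mulr_ge0 ?sqr_ge0.
have uvS : su * sv <= S by apply: leS => //; clear - SE p1 p2 p3; lra.
have vwS : sv * sw <= S by apply: leS => //; clear - SE p1 p2 p3; lra.
have wuS : sw * su <= S by apply: leS => //; clear - SE p1 p2 p3; lra.
have uv0 : 0 <= su * sv by rewrite mulr_ge0.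
have vw0 : 0 <= sv * sw by rewrite mulr_ge0.
have wu0 : 0 <= sw * su by rewrite mulr_ge0.
have UV : `|U| * `|V| <= 4 * S.
  apply: (@le_trans _ _ ((2 * su) * (2 * sv))); [exact: ler_pM|clear - uvS vwS wuS; lra].
have VW : `|V| * `|W| <= 4 * S.
  apply: (@le_trans _ _ ((2 * sv) * (2 * sw))); [exact: ler_pM|clear - uvS vwS wuS; lra].
have UW : `|U| * `|W| <= 4 * S.
  apply: (@le_trans _ _ ((2 * su) * (2 * sw))); [exact: ler_pM|clear - uvS vwS wuS; lra].
have UV0 : 0 <= `|U| * `|V| by rewrite mulr_ge0.
have VW0 : 0 <= `|V| * `|W| by rewrite mulr_ge0.
have UW0 : 0 <= `|U| * `|W| by rewrite mulr_ge0.
have c1 : `|cc - 1| <= tau by apply: le_trans ccM; rewrite ler_peMr.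
have c2 : `|cc| <= 2.
  rewrite -(subrK 1 cc); apply: le_trans (ler_normD _ _) _; rewrite normr1; clear - c1 t1; lra.
have lin x y q : `|mu * x| <= M -> `|mu * x - y| <= tau -> 0 <= q -> q <= 4 * S ->
    `|cc * (mu * x) - y| * q <= 8 * tau * S.
  move=> hx hxy q0 q4; apply: (@le_trans _ _ ((2 * tau) * (4 * S))); last by clear; lra.
  apply: ler_pM => //.
  rewrite (_ : cc * (mu * x) - y = (cc - 1) * (mu * x) + (mu * x - y)); last by ring.
  apply: le_trans (ler_normD _ _) _.
  have : `|(cc - 1) * (mu * x)| <= `|cc - 1| * M by rewrite normrM ler_wpM2l.
  clear - ccM hxy; lra.
split; last first.
  rewrite !exprMn SE.
  have sq x y : `|x| <= (1 + 6 * tau) * y -> 0 <= y -> x ^+ 2 <= (1 + 6 * tau) ^+ 2 * y ^+ 2.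
    move=> h y0; rewrite -(real_normK (num_real x)) -exprMn ler_pXn2r ?nnegrE//.
    by rewrite mulr_ge0//; clear - t0; lra.
  have Us := sq _ _ Ub su0; have Vs := sq _ _ Vb sv0; have Ws := sq _ _ Wb sw0.
  have m2 x y x' y' : x ^+ 2 <= (1 + 6 * tau) ^+ 2 * x' ^+ 2 -> y ^+ 2 <= (1 + 6 * tau) ^+ 2 * y' ^+ 2 ->
    x ^+ 2 * y ^+ 2 <= (1 + 6 * tau) ^+ 2 ^+ 2 * (x' ^+ 2 * y' ^+ 2).
    move=> h1 h2.
    rewrite (_ : _ * (x' ^+ 2 * y' ^+ 2) = (1 + 6 * tau) ^+ 2 * x' ^+ 2 *
      ((1 + 6 * tau) ^+ 2 * y' ^+ 2)); last by ring.
    by apply: ler_pM => //; exact: sqr_ge0.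
  rewrite !mulrDr.
  have := m2 _ _ _ _ Us Vs; have := m2 _ _ _ _ Vs Ws; have := m2 _ _ _ _ Ws Us.
  clear; lra.
(* The remainder consists of the rescaled signal, the linear terms minus their Gaussian
   counterparts, the pairs of noises and the triple of noises, worth [4], [24], [24] and [4] times
   [tau * S]. *)
set G := xi * _ + _ + _.
rewrite (_ : _ - _ = G + (mu * (cc - 1) * U * (V * W)
  + ((cc * (mu * A) - xi) * (V * W) + (cc * (mu * B) - eta) * (U * W)
    + (cc * (mu * D) - zeta) * (U * V))
  + cc * (mu * A * B * W + mu * A * D * V + mu * B * D * U) + cc * (mu * A * B * D))); last first.
  by rewrite /G; ring.
apply: le_trans (ler_normD _ _) _; rewrite lerD2l.
have q1 : `|mu * (cc - 1) * U * (V * W)| <= 4 * tau * S.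
  rewrite normrM (_ : `|mu * (cc - 1) * U| = mu * `|cc - 1| * `|U|); last first.
    by rewrite !normrM (gtr0_norm mu0).
  rewrite normrM; apply: (@le_trans _ _ (tau * (4 * S))); last by clear; lra.
  by apply: ler_pM => //; rewrite !mulr_ge0// ltW.
have l1 := lin _ _ _ hA hxi VW0 VW; have l2 := lin _ _ _ hB heta UW0 UW.
have l3 := lin _ _ _ hD hzeta UV0 UV.
have tS : 0 <= tau * S by rewrite mulr_ge0// ltW.
have quad x y q s s' : `|mu * x| <= M -> M * `|y| <= 2 * tau * s -> `|q| <= 2 * s' ->
    s * s' <= S -> 0 <= s' -> `|mu * x * y * q| <= 4 * tau * S.
  move=> hx hy hq ss s'0; rewrite normrM normrM.
  have h1 : `|mu * x| * `|y| <= 2 * tau * s by apply: le_trans hy; rewrite ler_wpM2r.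
  apply: (@le_trans _ _ ((2 * tau * s) * (2 * s'))).
    by apply: ler_pM; rewrite ?mulr_ge0.
  have : tau * (s * s') <= tau * S by rewrite ler_wpM2l// ltW.
  clear; lra.
have d1 := quad _ _ _ _ _ hA MB W2 vwS sw0.
have d2 : `|mu * A * D * V| <= 4 * tau * S.
  by apply: (quad _ _ _ sw sv) => //; rewrite mulrC.
have d3 : `|mu * B * D * U| <= 4 * tau * S by apply: (quad _ _ _ sw su).
have d4' : `|mu * A * B * D| <= 2 * tau * S.
  rewrite normrM normrM.
  have h1 : `|mu * A| * `|B| <= 2 * tau * sv by apply: le_trans MB; rewrite ler_wpM2r.
  have h2 : `|D| <= sw.
    apply: (@le_trans _ _ (2 * tau * sw)).
      by apply: le_trans MD; rewrite ler_peMl.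
    by rewrite ler_piMl//; clear - t1; lra.
  apply: (@le_trans _ _ ((2 * tau * sv) * sw)).
    by apply: ler_pM; rewrite ?mulr_ge0.
  have : tau * (sv * sw) <= tau * S by rewrite ler_wpM2l// ltW.
  clear; lra.
have n1 : `|(cc * (mu * A) - xi) * (V * W) + (cc * (mu * B) - eta) * (U * W)
    + (cc * (mu * D) - zeta) * (U * V)| <= 24 * tau * S.
  apply: le_trans (ler_normD _ _) _.
  have := ler_normD ((cc * (mu * A) - xi) * (V * W)) ((cc * (mu * B) - eta) * (U * W)).
  by move: l1 l2 l3; rewrite -!normrM; clear; lra.
have n2 : `|cc * (mu * A * B * W + mu * A * D * V + mu * B * D * U)| <= 24 * tau * S.
  rewrite normrM; apply: (@le_trans _ _ (2 * (12 * tau * S))); last by clear; lra.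
  apply: ler_pM => //; apply: le_trans (ler_normD _ _) _.
  have := ler_normD (mu * A * B * W) (mu * A * D * V); clear - d1 d2 d3; lra.
have n3 : `|cc * (mu * A * B * D)| <= 4 * tau * S.
  rewrite normrM; apply: (@le_trans _ _ (2 * (2 * tau * S))); last by clear; lra.
  exact: ler_pM.
apply: le_trans (ler_normD _ _) _; apply: (@le_trans _ _ (56 * tau * S + 4 * tau * S)); last by clear; lra.
apply: lerD => //; apply: le_trans (ler_normD _ _) _.
apply: (@le_trans _ _ (32 * tau * S + 24 * tau * S)); last by clear; lra.
apply: lerD => //; apply: le_trans (ler_normD _ _) _; clear - q1 n1 tS; lra.
Qed.

Lemma outer_dot a b c (x x' : vec R a) (y y' : vec R b) (z z' : vec R c) :
  \sum_(l : 'I_a * 'I_b * 'I_c) (x l.1.1 * y l.1.2 * z l.2) * (x' l.1.1 * y' l.1.2 * z' l.2)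
  = dot x x' * dot y y' * dot z z'.
Proof.
rewrite sum_triple /dot /= big_distrlr /= mulr_suml; apply: eq_bigr => i _.
rewrite mulr_suml; apply: eq_bigr => j _; rewrite mulr_sumr; apply: eq_bigr => k _.
ring.
Qed.

(* Coefficients of the first-order term of [hat T_ijk - T_ijk] as a linear form in the noise. *)
Definition gcoef a b c (u : vec R a) (v : vec R b) (w : vec R c) i j k
    (l : 'I_a * 'I_b * 'I_c) : R :=
  (v j * w k) * (delta R i l.1.1 * v l.1.2 * w l.2) +
  (u i * w k) * (u l.1.1 * delta R j l.1.2 * w l.2) +
  (u i * v j) * (u l.1.1 * v l.1.2 * delta R k l.2).

Lemma gcoef_lin a b c (u : vec R a) (v : vec R b) (w : vec R c) i j k (E : tensor3 R a b c) :
  \sum_l gcoef u v w i j k l * E l.1.1 l.1.2 l.2 =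
  contr123 E (delta R i) v w * (v j * w k) + contr123 E u (delta R j) w * (u i * w k)
  + contr123 E u v (delta R k) * (u i * v j).
Proof.
rewrite !contr123_lin !mulr_suml -!big_split; apply: eq_bigr => l _ /=.
by rewrite /gcoef; ring.
Qed.

(** The three rank-one tensors are not orthogonal. Each pair, with its coefficients, has inner
    product [(u i * v j * w k) ^+ 2], and twice three pairs give the [6]; smallness of [u i] later
    absorbs this term. *)
Lemma gcoef_sq a b c (u : vec R a) (v : vec R b) (w : vec R c) i j k :
  nrm2 u = 1 -> nrm2 v = 1 -> nrm2 w = 1 ->
  \sum_l gcoef u v w i j k l ^+ 2 =
  (u i * v j) ^+ 2 + (v j * w k) ^+ 2 + (w k * u i) ^+ 2 + 6 * (u i * v j * w k) ^+ 2.
Proof.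
move=> u1 v1 w1.
pose x l : R := delta R i l.1.1 * v l.1.2 * w l.2.
pose y l : R := u l.1.1 * delta R j l.1.2 * w l.2.
pose z l : R := u l.1.1 * v l.1.2 * delta R k l.2.
transitivity ((v j * w k) ^+ 2 * (\sum_(l : 'I_a * 'I_b * 'I_c) x l * x l)
  + (u i * w k) ^+ 2 * (\sum_(l : 'I_a * 'I_b * 'I_c) y l * y l)
  + (u i * v j) ^+ 2 * (\sum_(l : 'I_a * 'I_b * 'I_c) z l * z l)
  + 2 * ((v j * w k) * (u i * w k)) * (\sum_(l : 'I_a * 'I_b * 'I_c) x l * y l)
  + 2 * ((v j * w k) * (u i * v j)) * (\sum_(l : 'I_a * 'I_b * 'I_c) x l * z l)
  + 2 * ((u i * w k) * (u i * v j)) * (\sum_(l : 'I_a * 'I_b * 'I_c) y l * z l)).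
  rewrite !mulr_sumr -!big_split; apply: eq_bigr => l _ /=.
  by rewrite /gcoef -/(x l) -/(y l) -/(z l); ring.
rewrite /x /y /z !outer_dot !dotxx !nrm2_delta u1 v1 w1 !dot_delta.
rewrite !(dotC _ (delta R _)) !dot_delta; ring.
Qed.

End Expansion.

(** * Gaussian mass of intervals and quantiles *)

Section GaussInterval.
Variable R : realType.
Local Notation gauss1 := (@gauss1 R).
Notation mu := (@lebesgue_measure R).

Lemma normal_peak1_le1 : normal_peak (1 : R) <= 1.
Proof.
rewrite /normal_peak expr1n mul1r invf_le1.
  rewrite -[leLHS]sqrtr1 ler_sqrt; last by rewrite mulrn_wge0// pi_ge0.
  by have := pi_ge2 R; rewrite mulr2n; lra.
by rewrite sqrtr_gt0 mulrn_wgt0// pi_gt0.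
Qed.

Lemma gauss1_oc_le (y z : R) : y <= z -> (gauss1 `]y, z]%classic <= (z - y)%:E)%E.
Proof.
move=> yz; rewrite gauss1E.
apply: (@le_trans _ _ (\int[mu]_(x in `]y, z]) (cst 1%:E x))%E).
  apply: ge0_le_integral => //.
  - by move=> x _; rewrite lee_fin normal_pdf_ge0.
  - by apply: measurable_funTS; apply/measurable_EFinP; exact: measurable_normal_pdf.
  - move=> x _; rewrite lee_fin; apply: le_trans normal_peak1_le1.
    by apply: normal_pdf_ub; exact: oner_neq0.
rewrite integral_cst// mul1e.
have HL : (lebesgue_measure (`]y, z]%classic : set R) <= (z - y)%:E)%E.
  rewrite lebesgue_measure_itv /= lte_fin.
  by case: ifP => _; rewrite -?EFinD// lee_fin subr_ge0.
exact: HL.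
Qed.

Lemma gauss1_sym_half (y : R) : gauss1 `]y, +oo[%classic = gauss1 `]-oo, - y[%classic.
Proof.
rewrite -(gauss1N (measurable_itv `]-oo, - y[)); congr (gauss1 _).
by apply/seteqP; split => x; rewrite /= !in_itv /= andbT ltrN2.
Qed.

Definition gaussR (A : set (measurableTypeR R)) : R := fine (gauss1 A).

Lemma gaussRE A : measurable A -> gauss1 A = (gaussR A)%:E.
Proof. by move=> mA; rewrite fineK// fin_num_measure. Qed.

Lemma gaussR_le A B : measurable A -> measurable B -> A `<=` B -> gaussR A <= gaussR B.
Proof.
by move=> mA mB AB; rewrite -lee_fin -!gaussRE//; apply: le_measure; rewrite ?inE.
Qed.

Lemma gaussR_leU A B : measurable A -> measurable B ->
  gaussR (A `|` B) <= gaussR A + gaussR B.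
Proof.
move=> mA mB; rewrite -lee_fin EFinD -!gaussRE//; last exact: measurableU.
exact: measureU2.
Qed.

Lemma gaussR_C A : measurable A -> gaussR (~` A) = 1 - gaussR A.
Proof.
move=> mA; apply: EFin_inj; rewrite EFinB -!gaussRE//; last exact: measurableC.
exact: probability_setC.
Qed.

Lemma gaussR_upper (z al : R) : std_normal_cdf z = (1 - al)%:E ->
  gaussR `]z, +oo[%classic = al.
Proof.
move=> h; rewrite -setCitvl gaussR_C; last exact: measurable_itv.
have -> : gaussR `]-oo, z]%classic = 1 - al.
  by apply: EFin_inj; rewrite -gaussRE ?h//; exact: measurable_itv.
ring.
Qed.

Lemma gaussR_oc_le (y z : R) : y <= z -> gaussR `]y, z]%classic <= z - y.
Proof.
by move=> yz; rewrite -lee_fin -gaussRE ?gauss1_oc_le//; exact: measurable_itv.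
Qed.

(* If [z <= 0], the upper tail beyond [z] is at least as heavy as the mirror image of the
   lower tail, up to a short interval, which contradicts the tail masses. *)
Lemma gauss_quantile_gt0 (z al : R) : al < 1 ->
  std_normal_cdf z = (1 - al / 2)%:E -> 0 < z.
Proof.
move=> a1 h; rewrite ltNge; apply/negP => z0.
pose ep : R := (1 - al) / 4.
have ep0 : 0 < ep by rewrite /ep; lra.
have U := gaussR_upper h.
have L : gaussR `]-oo, z]%classic = 1 - al / 2.
  by apply: EFin_inj; rewrite -gaussRE ?h//; exact: measurable_itv.
have h1 : gaussR `]-oo, z - ep[%classic <= gaussR `]z, +oo[%classic.
  have -> : gaussR `]-oo, z - ep[%classic = gaussR `]ep - z, +oo[%classic.
    by rewrite /gaussR gauss1_sym_half opprB.
  apply: gaussR_le; [exact: measurable_itv|exact: measurable_itv|].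
  by move=> x; rewrite /= !in_itv /= !andbT; apply: le_lt_trans; lra.
have h2 : gaussR `]-oo, z]%classic <= gaussR `]-oo, z - ep[%classic + gaussR `]z - 2 * ep, z]%classic.
  apply: le_trans (gaussR_leU _ _); try exact: measurable_itv.
  apply: gaussR_le; first exact: measurable_itv.
    by apply: measurableU; exact: measurable_itv.
  move=> x; rewrite /= !in_itv /= => xz; have [|xe] := ltP x (z - ep); first by left.
  by right; rewrite xz andbT; apply: lt_le_trans xe; lra.
have h3 : gaussR `]z - 2 * ep, z]%classic <= 2 * ep.
  by apply: le_trans (gaussR_oc_le _) _; lra.
by rewrite /ep in h3; lra.
Qed.

(** The density is at most one, so shrinking the half-width from [z] to [y] adds at most [z - y] to
    each tail. *)
Lemma gauss_two_sided (y z al : R) : 0 <= y <= z ->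
  std_normal_cdf z = (1 - al / 2)%:E ->
  ((1 - al - 2 * (z - y))%:E <= gauss1 [set x : R | `|x| <= y]%R)%E.
Proof.
move=> /andP[y0 yz] h; have U := gaussR_upper h.
have mP : measurable (`]y, +oo[%classic : set (measurableTypeR R)) by exact: measurable_itv.
have mN : measurable (`]-oo, - y[%classic : set (measurableTypeR R)) by exact: measurable_itv.
have mS : measurable (`]-oo, - y[%classic `|` `]y, +oo[%classic : set (measurableTypeR R)).
  exact: measurableU.
rewrite (_ : [set _ | _] = ~` (`]-oo, - y[%classic `|` `]y, +oo[%classic)); last first.
  apply/seteqP; split => x /=; rewrite !in_itv /= andbT ler_norml.
    by move=> /andP[a1 a2] [|]; rewrite ltNge ?a1 ?a2.
  by move=> /not_orP[/negP + /negP]; rewrite -!leNgt => -> ->.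
rewrite gaussRE ?lee_fin; last exact: measurableC.
rewrite gaussR_C//.
have h1 := gaussR_leU mN mP.
have h2 : gaussR `]-oo, - y[%classic = gaussR `]y, +oo[%classic by rewrite /gaussR gauss1_sym_half.
have h3 : gaussR `]y, +oo[%classic <= gaussR `]y, z]%classic + gaussR `]z, +oo[%classic.
  apply: le_trans (gaussR_leU _ _); try exact: measurable_itv.
  apply: gaussR_le => //; first by apply: measurableU; exact: measurable_itv.
  move=> x; rewrite /= !in_itv /= !andbT => xy; have [xz|] := leP x z; last by right.
  by left; rewrite xy.
have h4 := gaussR_oc_le yz.
lra.
Qed.
End GaussInterval.

Section CoverageDet.
Variable R : realType.

Definition tscale a b c (E : tensor3 R a b c) (q : R) : tensor3 R a b c :=
  fun i j k => E i j k / q.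

Lemma contr123_tscale a b c (E : tensor3 R a b c) q x y z :
  contr123 (tscale E q) x y z = contr123 E x y z / q.
Proof.
rewrite /contr123 mulr_suml; apply: eq_bigr => i _; rewrite mulr_suml.
apply: eq_bigr => j _; rewrite mulr_suml; apply: eq_bigr => k _.
by rewrite /tscale; ring.
Qed.

Lemma contr13_tscale a b c (E : tensor3 R a b c) q x z j :
  contr13 (tscale E q) x z j = contr13 E x z j / q.
Proof.
rewrite /contr13 mulr_suml; apply: eq_bigr => i _; rewrite mulr_suml.
by apply: eq_bigr => k _; rewrite /tscale; ring.
Qed.

Lemma quad12_tscale a b c (E : tensor3 R a b c) q x y z :
  quad12 (tscale E q) x y z = quad12 E x y z / q ^+ 2.
Proof.
rewrite /quad12 /dot mulr_suml; apply: eq_bigr => j _; rewrite !contr13_tscale.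
by rewrite expr2 invfM; ring.
Qed.

Lemma gram_tscale a b c (E : tensor3 R a b c) q x :
  gram (mat1 (tscale E q)) x = gram (mat1 E) x / q ^+ 2.
Proof.
rewrite /gram mulr_suml; apply: eq_bigr => jk _; rewrite -expr_div_n; congr (_ ^+ 2).
by rewrite mulr_suml; apply: eq_bigr => i _; rewrite /mat1 /tscale mulrA.
Qed.

Lemma opn_tscale a b c (E : tensor3 R a b c) s q : 0 < q -> opn E s -> opn (tscale E q) (s / q).
Proof.
move=> q0 HE x y z x1 y1 z1; rewrite contr123_tscale normrM normfV (gtr0_norm q0).
by rewrite ler_pM2r ?invr_gt0// HE.
Qed.

Lemma gram_dev_tscale a b c (E : tensor3 R a b c) (r s q : R) : 0 < q ->
  (forall x, nrm2 x <= 1 -> `|gram (mat1 E) x - r * nrm2 x| <= s) ->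
  forall x, nrm2 x <= 1 -> `|gram (mat1 (tscale E q)) x - (r / q ^+ 2) * nrm2 x| <= s / q ^+ 2.
Proof.
move=> q0 H x x1; rewrite gram_tscale [X in `|X|](_ : _ = (gram (mat1 E) x - r * nrm2 x) / q ^+ 2).
  by rewrite normrM normfV (gtr0_norm (exprn_gt0 2 q0)) ler_pM2r ?invr_gt0 ?exprn_gt0// H.
by ring.
Qed.

End CoverageDet.

Section Coverage.
Variable R : realType.

(* Bounds the relative error of [hat lambda] and of the normalizing factors. *)
Definition kap0 (p mu M : R) := M / mu + 64 * (64 * Num.sqrt p / mu) ^+ 2.

(* The remainder in an entry of [hat u] beyond its Gaussian first-order term, in units of
   [sigma / lambda]. *)
Definition entry_small (p mu M tau x : R) :=
  (2 * (x * p + M * Num.sqrt p) + 2 * M ^+ 2) / mu + 192 * (mu * (64 * Num.sqrt p / mu) ^+ 3) <= tau.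

(** In order: [e] and the Gram deviation are small enough for [init_tang]; the scale error [16 kap0]
    is negligible against the noise and against the signal [mu * x1]; truncation dominates noise;
    the cross terms of [gcoef_sq] are negligible; the three entrywise remainders are small. *)
Definition small_noise (p mu M tau L x1 x2 x3 : R) : Prop :=
  [/\ 64 * Num.sqrt p / mu <= 16^-1, 160 * (p * Num.sqrt p) / mu ^+ 2 <= 8^-1,
     16 * kap0 p mu M * (M + 1) <= tau & mu * (16 * kap0 p mu M) * x1 <= tau] /\
  [/\ (M + 1) ^+ 2 <= tau * L, 6 * x1 ^+ 2 <= tau, entry_small p mu M tau x1,
     entry_small p mu M tau x2 & entry_small p mu M tau x3].

Definition quad_good a b c (W : tensor3 R a b c) (u : vec R a) v w i (p M : R) :=
  `|quad12 W (delta R i) u w| <= `|u i| * p + M * Num.sqrt p /\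
  `|quad12 (perm23 W) (delta R i) u v| <= `|u i| * p + M * Num.sqrt p.

(** The centre [q] stays existential because a multiple of the identity does not affect which
    singular vector leads. *)
Definition gram_good a b c (W : tensor3 R a b c) (p : R) :=
  exists q, forall x, nrm2 x <= 1 -> `|gram (mat1 W) x - q * nrm2 x| <= 160 * (p * Num.sqrt p).

(** Only the first four properties are uniform over vectors. The others concern four linear and six
    quadratic forms at fixed vectors, which is why [M] may be independent of [p]. *)
Definition good a b c (W : tensor3 R a b c) (u : vec R a) v w i j k (p M : R) : Prop :=
  [/\ opn W (64 * Num.sqrt p), gram_good W p, gram_good (perm12 W) p & gram_good (perm13 W) p] /\
  [/\ `|contr123 W u v w| <= M, `|contr123 W (delta R i) v w| <= M,
     `|contr123 W u (delta R j) w| <= M & `|contr123 W u v (delta R k)| <= M] /\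
  [/\ quad_good W u v w i p M, quad_good (perm12 W) v u w j p M
     & quad_good (perm13 W) w u v k p M].

Lemma entry_bound (p mu M tau x q1 q2 g xi g0 : R) : 0 < mu -> 0 <= p -> 0 <= M ->
  `|q1| <= x * p + M * Num.sqrt p -> `|q2| <= x * p + M * Num.sqrt p ->
  `|g0| <= M -> `|xi| <= M -> entry_small p mu M tau x ->
  `|g - xi / mu| <= `|q1 / mu ^+ 2| + `|q2 / mu ^+ 2| + 2 * (`|g0 / mu| * `|xi / mu|)
     + 192 * (64 * Num.sqrt p / mu) ^+ 3 ->
  `|mu * g - xi| <= tau.
Proof.
move=> mu0 p0 M0 h1 h2 hg hx hs h.
have muN : mu != 0 by rewrite gt_eqF.
have -> : mu * g - xi = mu * (g - xi / mu) by field.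
rewrite normrM (gtr0_norm mu0); apply: le_trans hs.
apply: (@le_trans _ _ (mu * ((x * p + M * Num.sqrt p) / mu ^+ 2 + (x * p + M * Num.sqrt p) / mu ^+ 2
    + 2 * (M / mu * (M / mu)) + 192 * (64 * Num.sqrt p / mu) ^+ 3))); last first.
  rewrite le_eqVlt; apply/orP; left; apply/eqP.
  set y := (64 * Num.sqrt p / mu) ^+ 3; by field.
rewrite ler_wpM2l ?(ltW mu0)//; apply: le_trans h _; rewrite lerD2r.
have m2 : 0 < (mu ^+ 2)^-1 by rewrite invr_gt0 exprn_gt0.
have m1 : 0 < mu^-1 by rewrite invr_gt0.
apply: lerD; first apply: lerD.
- by rewrite normrM (gtr0_norm m2) ler_pM2r.
- by rewrite normrM (gtr0_norm m2) ler_pM2r.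
rewrite ler_pM2l//; apply: ler_pM => //.
- by rewrite normrM (gtr0_norm m1) ler_pM2r.
- by rewrite normrM (gtr0_norm m1) ler_pM2r.
Qed.

(** A statement about a single sample point. The threshold is [z] lowered by [60 tau], which pays
    for the remainder of [cov_alg], and divided by [(1 + 6 tau) ^+ 3], which pays for replacing the
    deviation [B] by [S]. *)
Lemma coverage_det a b c (u : vec R a) (v : vec R b) (w : vec R c)
    (Z : tensor3 R a b c) (u0 : vec R a) (v0 : vec R b) (w0 : vec R c) (lam sigma : R) i j k
    (tmax : nat) (p lnp M tau z B : R) :
  let W := tscale Z sigma in
  let A : tensor3 R a b c := fun i j k => rank1 lam u v w i j k + Z i j k in
  let mu := lam / sigma in
  0 < lam -> 0 < sigma -> nrm2 u = 1 -> nrm2 v = 1 -> nrm2 w = 1 -> 0 <= p -> 0 <= lnp ->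
  leading_lsv (mat1 A) u0 -> leading_lsv (mat2 A) v0 -> leading_lsv (mat3 A) w0 ->
  (3 <= tmax)%N -> 0 < M -> 0 < tau -> tau <= 100^-1 -> 60 * tau <= z ->
  small_noise p mu M tau (Num.sqrt lnp) `|u i| `|v j| `|w k| ->
  good W u v w i j k p M ->
  0 <= B -> B ^+ 2 = \sum_l gcoef u v w i j k l ^+ 2 ->
  `|\sum_l gcoef u v w i j k l * W l.1.1 l.1.2 l.2| <= (z - 60 * tau) / (1 + 6 * tau) ^+ 3 * B ->
  let: (lh, uh, vh, wh) := alg4 A u0 v0 w0 tmax in
  let s := fun t : R => Num.max t (lnp * sigma ^+ 2 / lh ^+ 2) in
  let S := Num.sqrt (s (uh i ^+ 2) * s (vh j ^+ 2) + s (vh j ^+ 2) * s (wh k ^+ 2)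
                   + s (wh k ^+ 2) * s (uh i ^+ 2)) in
  let That := rank1 lh uh vh wh i j k in
  rank1 lam u v w i j k \in `[That - z * sigma * S, That + z * sigma * S].
Proof.
move=> W A mu lam0 sig0 u1 v1 w1 p0 lnp0 lu lv lw t3 M0 tau0 tau1 ztau.
move=> [[e16 d8 kM kU] [ML U6 es1 es2 es3]].
move=> [[HW G1 G2 G3] [[c0 c1 c2 c3] [[q11 q12] [q21 q22] [q31 q32]]]].
move=> B0 BE HG.
have mu0 : 0 < mu by rewrite divr_gt0.
have muN : mu != 0 by rewrite gt_eqF.
pose E := tscale W mu.
pose A' : tensor3 R a b c := fun i j k => u i * v j * w k + E i j k.
have HA : model u v w E A' by [].
have HAs i' j' k' : A i' j' k' = lam * A' i' j' k'.
  rewrite /A /A' /E /W /tscale /rank1 /mu; field.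
  by rewrite !gt_eqF.
have HA2 : model v u w (perm12 E) (perm12 A') by move=> ? ? ?; rewrite /perm12 HA; ring.
have HA3 : model w u v (perm13 E) (perm13 A') by move=> ? ? ?; rewrite /perm13 HA; ring.
set e := 64 * Num.sqrt p / mu in e16.
have HE : opn E e by apply: opn_tscale.
have HE2 := opn_perm12 HE; have HE3 := opn_perm13 HE.
have e8 : e <= 8^-1 by apply: le_trans e16 _; clear; lra.
have [q1 {}G1] := G1; have [q2 {}G2] := G2; have [q3 {}G3] := G3.
have lu' : leading_lsv (mat1 A') u0 by apply: leading_lsv_scale lam0 _ lu => ? ?; exact: HAs.
have lv' : leading_lsv (mat1 (perm12 A')) v0 by apply: leading_lsv_scale lam0 _ lv => ? ?; exact: HAs.
have lw' : leading_lsv (mat1 (perm13 A')) w0 by apply: leading_lsv_scale lam0 _ lw => ? ?; exact: HAs.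
have [x tx x1] := init_tang u1 v1 w1 HA HE (gram_dev_tscale mu0 G1) e16 d8 lu'.
have [y ty y1] := init_tang v1 u1 w1 HA2 HE2 (gram_dev_tscale mu0 G2) e16 d8 lv'.
have [t tt t1] := init_tang w1 u1 v1 HA3 HE3 (gram_dev_tscale mu0 G3) e16 d8 lw'.
have st0 : state u v w E e 0 u0 v0 w0 x y t by [].
rewrite /alg4 (power_iter_scale _ _ _ _ lam0 HAs).
case: tmax t3 => // n n2.
have := state_iter u1 v1 w1 HE e8 HA n st0; rewrite /=.
case: (power_iter A' u0 v0 w0 n) => -[uh vh] wh [x' [y' [z' st]]].
have e0 := opn_ge0 HE.
have gk : `|contr123 E u v w| + 64 * e ^+ 2 <= kap0 p mu M.
  rewrite /kap0 lerD2r contr123_tscale normrM normfV (gtr0_norm mu0).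
  by rewrite ler_pM2r ?invr_gt0.
set kap := _ + _ in gk.
have kap_ge0 : 0 <= kap by rewrite addr_ge0// mulr_ge0// sqr_ge0.
have kpt : 16 * kap0 p mu M <= tau.
  apply: le_trans kM; rewrite ler_peMr//; last by move: M0; clear; lra.
  by rewrite mulr_ge0//; apply: le_trans gk.
have kap1 : kap <= 100^-1 by clear - kpt gk tau1 kap_ge0; lra.
have kapt : kap <= tau by clear - kpt gk kap_ge0; lra.
have := det_final u1 v1 w1 HE e8 HA i j k n2 st kap1.
set U := normalize (contr23 A' vh wh); set V := normalize (contr13 A' uh wh).
set Wv := normalize (contr12 A' uh vh).
move=> /= [C0 [cc [g1 [g2 [g3 [[TE cc1 C1] [[n1 n2' n3] [r1 r2 r3]]]]]]]].
have lhE : contr123 A U V Wv = lam * contr123 A' U V Wv.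
  rewrite /contr123 mulr_sumr; apply: eq_bigr => ? _; rewrite mulr_sumr.
  apply: eq_bigr => ? _; rewrite mulr_sumr; apply: eq_bigr => ? _.
  by rewrite HAs; ring.
rewrite lhE; set lh := contr123 A' U V Wv in C0 C1 TE *.
pose s (r : R) := Num.max r (lnp * sigma ^+ 2 / (lam * lh) ^+ 2).
set S := Num.sqrt _.
pose su := Num.sqrt (s (U i ^+ 2)); pose sv := Num.sqrt (s (V j ^+ 2)).
pose sw := Num.sqrt (s (Wv k ^+ 2)).
have sge0 r : 0 <= r -> 0 <= s r by move=> r0; rewrite /s le_max r0.
have SE : S ^+ 2 = su ^+ 2 * sv ^+ 2 + sv ^+ 2 * sw ^+ 2 + sw ^+ 2 * su ^+ 2.
  rewrite !sqr_sqrtr ?sge0 ?sqr_ge0//.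
  by rewrite !addr_ge0 ?mulr_ge0 ?sge0 ?sqr_ge0.
have sE r : `|r| <= Num.sqrt (s (r ^+ 2)).
  by rewrite -sqrtr_sqr ler_sqrt ?sge0 ?sqr_ge0// /s le_max lexx.
(* The truncation level uses the estimate [lam * lh]. As [|lh| <= 1 + tau], its root is at least
   [sqrt lnp / mu] up to that factor; [lh != 0] matters, since division by zero would turn the level
   into [0]. *)
have sL r : Num.sqrt lnp <= (1 + tau) * (mu * Num.sqrt (s (r ^+ 2))).
  have h : Num.sqrt (lnp * sigma ^+ 2 / (lam * lh) ^+ 2) <= Num.sqrt (s (r ^+ 2)).
    by rewrite ler_sqrt ?sge0 ?sqr_ge0// /s le_max lexx orbT.
  have he : Num.sqrt (lnp * sigma ^+ 2 / (lam * lh) ^+ 2) = Num.sqrt lnp / (mu * `|lh|).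
    rewrite -mulrA sqrtrM// -expr_div_n sqrtr_sqr normrM normfV normrM.
    rewrite (gtr0_norm sig0) (gtr0_norm lam0); congr (_ * _); rewrite /mu; field.
    by rewrite normr_eq0 C0 !gt_eqF.
  have lh0 : 0 < `|lh| by rewrite normr_gt0.
  move: h; rewrite he (ler_pdivrMr _ _ (mulr_gt0 mu0 lh0)) => h; apply: le_trans h _.
  rewrite [leLHS](_ : _ = `|lh| * (mu * Num.sqrt (s (r ^+ 2)))); last by ring.
  rewrite (ler_wpM2r (mulr_ge0 (ltW mu0) (sqrtr_ge0 _)))//.
  by apply: le_trans C1 _; rewrite lerD2l.
have a1 : `|mu * g1 - contr123 W (delta R i) v w| <= tau.
  apply: (entry_bound mu0 p0 (ltW M0) q11 q12 c0 c1 es1).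
  by move: r1; rewrite -/e !contr123_tscale quad12_tscale (quad12_tscale (perm23 W)).
have a2 : `|mu * g2 - contr123 W u (delta R j) w| <= tau.
  apply: (entry_bound mu0 p0 (ltW M0) q21 q22 c0 c2 es2).
  move: r2; rewrite -/e !contr123_tscale (quad12_tscale (perm12 W)).
  by rewrite (quad12_tscale (perm23 (perm12 W))).
have a3 : `|mu * g3 - contr123 W u v (delta R k)| <= tau.
  apply: (entry_bound mu0 p0 (ltW M0) q31 q32 c0 c3 es3).
  move: r3; rewrite -/e !contr123_tscale (quad12_tscale (perm13 W)).
  by rewrite (quad12_tscale (perm23 (perm13 W))).
have bM q xi : `|mu * q - xi| <= tau -> `|xi| <= M -> `|mu * q| <= M + 1.
  move=> h1 h2; rewrite -(subrK xi (mu * q)); apply: le_trans (ler_normD _ _) _.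
  by clear - h1 h2 tau1; lra.
have n' (q r q' : R) : (1 - 2 * kap) * `|q + r| <= `|q'| -> (1 - 2 * tau) * `|q + r| <= Num.sqrt (s (q' ^+ 2)).
  move=> h; apply: le_trans (sE _); apply: le_trans h; rewrite ler_wpM2r//.
  by clear - kapt; lra.
have M1 : 1 <= M + 1 by rewrite lerDr ltW.
have ccM : `|cc - 1| * (M + 1) <= tau.
  apply: le_trans kM; rewrite ler_wpM2r//; first by clear - M1; lra.
  by apply: le_trans cc1 _; rewrite ler_pM2l.
have ccU : mu * `|cc - 1| * `|u i| <= tau.
  apply: le_trans kU; rewrite ler_wpM2r// ler_pM2l//.
  by apply: le_trans cc1 _; rewrite ler_pM2l.
have S0 : 0 <= S by exact: sqrtr_ge0.
have [main V0] := cov_alg mu0 tau0 tau1 M1 ML (bM _ _ a1 c1) (bM _ _ a2 c2) (bM _ _ a3 c3)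
  a1 a2 a3 ccM ccU (sqrtr_ge0 _) (sqrtr_ge0 _) (sqrtr_ge0 _) (n' _ _ _ n1) (n' _ _ _ n2')
  (n' _ _ _ n3) (sL _) (sL _) (sL _) S0 SE.
move: main; rewrite -gcoef_lin => main.
have t6 : 0 < 1 + 6 * tau by clear - tau0; lra.
(* The cross terms cost a factor [1 + tau <= (1 + 6 tau)^2] in the variance, and [cov_alg] supplies
   [(1 + 6 tau)^4]. *)
have BS : B <= (1 + 6 * tau) ^+ 3 * S.
  rewrite -(@ler_pXn2r _ 2) ?nnegrE ?mulr_ge0 ?exprn_ge0 ?(ltW t6)// BE gcoef_sq//.
  set Y := (u i * v j) ^+ 2 + _ + _ in V0 *.
  have hY : 6 * (u i * v j * w k) ^+ 2 <= tau * Y.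
    have -> : (u i * v j * w k) ^+ 2 = `|u i| ^+ 2 * (v j * w k) ^+ 2.
      by rewrite (real_normK (num_real _)); ring.
    rewrite mulrA; apply: ler_pM (sqr_ge0 _) U6 _; first by rewrite mulr_ge0// sqr_ge0.
    by rewrite /Y; have := sqr_ge0 (u i * v j); have := sqr_ge0 (w k * u i); clear; lra.
  have Y0 : 0 <= Y by rewrite !addr_ge0 ?sqr_ge0.
  apply: (@le_trans _ _ ((1 + 6 * tau) ^+ 2 * Y)).
    apply: (@le_trans _ _ (Y + tau * Y)); first by rewrite lerD2l.
    by move: Y0 tau0; clear; nra.
  rewrite [leRHS](_ : _ = (1 + 6 * tau) ^+ 2 * ((1 + 6 * tau) ^+ 2 * S) ^+ 2); last by ring.
  by rewrite ler_pM2l ?exprn_gt0.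
have GS : `|\sum_l gcoef u v w i j k l * W l.1.1 l.1.2 l.2| <= (z - 60 * tau) * S.
  apply: le_trans HG _; rewrite -mulrA; apply: ler_wpM2l; first by rewrite subr_ge0.
  by rewrite ler_pdivrMl ?exprn_gt0.
have key : `|rank1 (lam * lh) U V Wv i j k - rank1 lam u v w i j k| <= z * sigma * S.
  have -> : rank1 (lam * lh) U V Wv i j k - rank1 lam u v w i j k =
     sigma * (mu * cc * (u i + g1) * (v j + g2) * (w k + g3) - mu * u i * v j * w k).
    rewrite /rank1 (_ : lam * lh * U i * V j * Wv k = lam * (lh * U i * V j * Wv k)); last by ring.
    by rewrite TE /mu; field; rewrite gt_eqF.
  rewrite normrM (gtr0_norm sig0) [leRHS](_ : _ = sigma * (z * S)); last by ring.
  rewrite ler_pM2l//; apply: le_trans main _; apply: le_trans (lerD GS (lexx _)) _.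
  by rewrite le_eqVlt; apply/orP; left; apply/eqP; ring.
move: key; rewrite ler_norml in_itv /= => /andP[k1 k2].
by apply/andP; split; clear - k1 k2; lra.
Qed.

End Coverage.

(** * Coverage *)

Section ModelCoverage.
Variable R : realType.

Lemma limn_einf_ge (x : (\bar R)^nat) (l : R) :
  (forall eta : R, 0 < eta -> \forall n \near \oo, ((l - eta)%:E <= x n)%E) ->
  (l%:E <= limn_einf x)%E.
Proof.
move=> H; rewrite limn_einf_lim; apply/lee_addgt0Pr => e e0.
have [N _ HN] := H e e0.
have h : ((l - e)%:E <= limn (einfs x))%E.
  apply: lime_ge; first exact: is_cvg_einfs.
  exists N => // m /= Nm; apply: le_ereal_inf_tmp => _ [k /= mk <-].
  by apply: HN => /=; exact: leq_trans Nm mk.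
by rewrite -leeBlDr// -EFinB.
Qed.

Section good.
Variables (d : measure_display) (T : measurableType d) (P : probability T R).

Lemma stdtensor_of_model a b c (Z : T -> tensor3 R a b c) (sigma : R) : 0 < sigma ->
  (forall i j k, measurable_fun setT (fun t => Z t i j k)) ->
  (forall i j k (B : set R), measurable B ->
     P ((fun t => Z t i j k) @^-1` B) = normal_prob 0 sigma B) ->
  mutually_independent P (fun (l : 'I_a * 'I_b * 'I_c) t => Z t l.1.1 l.1.2 l.2) ->
  stdtensor P (fun t => tscale (Z t) sigma).
Proof.
move=> s0 mZ lawZ indZ; split=> [l|B mB]; first exact: measurable_funM.
have md : measurable_fun setT (fun x : measurableTypeR R => x / sigma : measurableTypeR R).
  exact: measurable_funM.
pose B' l := (fun x : R => x / sigma) @^-1` B l.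
have mB' l : measurable (B' l).
  by rewrite /B' -[X in measurable X]setTI; exact: (md measurableT _ (mB l)).
have := indZ [set: _]%SET B' mB'.
rewrite (_ : \bigcap_(i in _) _ = [set t | forall l, B l (tscale (Z t) sigma l.1.1 l.1.2 l.2)]).
  move=> ->; rewrite (eq_bigl predT) => [|l]; last by rewrite inE.
  apply: eq_bigr => l _; rewrite (lawZ _ _ _ _ (mB' l)) (normal_prob_aff _ s0 (mB' l)).
  congr (gauss1 _ _).
  by apply/seteqP; split => x; rewrite /B' /aff /= add0r mulrAC divff ?mul1r ?gt_eqF.
apply/seteqP; split => t /= H l; first by apply: (H l); rewrite /= inE.
by move=> _; exact: H.
Qed.

(** One norm bound and three Gram bounds give the terms decaying in [p]; four linear forms give
    [8 = 4 * 2], and six quadratic forms give [24 = 6 * 4]. *)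
Lemma whp_good a b c (W : T -> tensor3 R a b c) (u : vec R a) (v : vec R b) (w : vec R c)
    i j k (p : nat) (M : R) :
  stdtensor P W -> (a <= p)%N -> (b <= p)%N -> (c <= p)%N -> (16 <= p)%N -> 0 <= M ->
  nrm2 u = 1 -> nrm2 v = 1 -> nrm2 w = 1 ->
  whp P (2 * expR (- p%:R) + 12 * expR (- (4 * p%:R)) + (8 * expR (- (M ^+ 2 / 2)) + 24 * expR (4 - M)))
    (fun t => good (W t) u v w i j k p%:R M).
Proof.
move=> HW ap bp cp p16 M0 u1 v1 w1.
have HW12 := stdtensor_perm12 HW; have HW13 := stdtensor_perm13 HW.
have p0 : (0 < p)%N by apply: leq_trans p16.
have GG a' b' c' (W' : T -> tensor3 R a' b' c') : stdtensor P W' -> (a' <= p)%N -> (b' <= p)%N -> (c' <= p)%N ->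
    whp P (4 * expR (- (4 * p%:R))) (fun t => gram_good (W' t) p%:R).
  move=> H1 h1 h2 h3; apply: whp_impl (whp_gram H1 h1 h2 h3 p16) => // t h.
  by exists (b' * c')%:R.
have QG a' b' c' (W' : T -> tensor3 R a' b' c') (x : vec R a') (y : vec R b') (z : vec R c') l :
    stdtensor P W' -> (b' <= p)%N -> (c' <= p)%N -> nrm2 x = 1 -> nrm2 y = 1 -> nrm2 z = 1 ->
    whp P (4 * expR (4 - M) + 4 * expR (4 - M)) (fun t => quad_good (W' t) x y z l p%:R M).
  move=> H1 h2 h3 x1 y1 z1.
  exact: (whp_and (whp_quad12 l H1 h2 p16 M0 x1 z1)
    (whp_quad12 l (stdtensor_perm23 H1) h3 p16 M0 x1 y1)).
have CG x y z : nrm2 x = 1 -> nrm2 y = 1 -> nrm2 z = 1 ->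
    whp P (2 * expR (- (M ^+ 2 / 2))) (fun t => `|contr123 (W t) x y z| <= M).
  by move=> x1 y1 z1; apply: whp_contr => //; rewrite ?x1 ?y1 ?z1.
have E1 := whp_and (whp_opn HW ap bp cp p0)
  (whp_and (GG _ _ _ _ HW ap bp cp) (whp_and (GG _ _ _ _ HW12 bp ap cp) (GG _ _ _ _ HW13 cp ap bp))).
have E2 := whp_and (whp_and (CG _ _ _ u1 v1 w1) (CG _ _ _ (nrm2_delta R i) v1 w1))
  (whp_and (CG _ _ _ u1 (nrm2_delta R j) w1) (CG _ _ _ u1 v1 (nrm2_delta R k))).
have E3 := whp_and (QG _ _ _ _ u v w i HW bp cp u1 v1 w1)
  (whp_and (QG _ _ _ _ v u w j HW12 ap cp v1 u1 w1) (QG _ _ _ _ w u v k HW13 ap bp w1 u1 v1)).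
apply: whp_impl (whp_and E1 (whp_and E2 E3)); first by lra.
by move=> t [[h1 [h2 [h3 h4]]] [[[c1 c2] [c3 c4]] [q1 [q2 q3]]]]; split; [split|split; split].
Qed.

(** The linear form is distributed as [B] times a standard normal. Only the inclusion of [|x| <= y]
    in [|B x| <= y B] is used, so [B = 0] is allowed. *)
Lemma coverage_prob a b c (W : T -> tensor3 R a b c) (C : set T) (u : vec R a) (v : vec R b)
    (w : vec R c) i j k (err y : R) (Q : T -> Prop) :
  stdtensor P W -> measurable C -> 0 <= y -> whp P err Q ->
  let B := Num.sqrt (\sum_l gcoef u v w i j k l ^+ 2) in
  (forall t, Q t -> `|\sum_l gcoef u v w i j k l * W t l.1.1 l.1.2 l.2| <= y * B -> C t) ->
  (gauss1 R [set x : R | `|x| <= y]%R <= P C + err%:E)%E.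
Proof.
move=> HW mC y0 [Bad [mBad PBad HBad]] B H.
have mle (r : R) : measurable [set x : measurableTypeR R | `|x| <= r].
  rewrite (_ : [set _ | _] = ~` [set x : measurableTypeR R | r < `|x|]).
    apply: measurableC.
    by apply: (@measurable_gt_norm R _ (measurableTypeR R) (fun x => x)); exact: measurable_id.
  by apply/seteqP; split => x /=; rewrite leNgt => /negP.
pose Ev := [set t | `|\sum_l gcoef u v w i j k l * W t l.1.1 l.1.2 l.2| <= y * B].
have mEv : measurable Ev.
  rewrite (_ : Ev = ~` [set t | y * B < `|\sum_l gcoef u v w i j k l * W t l.1.1 l.1.2 l.2|]).
    apply: measurableC; apply: measurable_gt_norm; exact: (measurable_linear _ HW).
  by apply/seteqP; split => t /=; rewrite /Ev /= leNgt => /negP.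
have PEv : P Ev = gauss1 R (aff 0 B @^-1` [set x : R | `|x| <= y * B]).
  exact: (linear_law (gcoef u v w i j k) HW (mle (y * B))).
apply: (@le_trans _ _ (P Ev)).
  rewrite PEv; apply: le_measure; rewrite ?inE.
  - exact: mle.
  - exact: measurable_aff_preimage.
  - move=> x /= xy; rewrite /aff add0r normrM (ger0_norm (sqrtr_ge0 _)) mulrC.
    by rewrite ler_wpM2r// sqrtr_ge0.
apply: (@le_trans _ _ (P (C `|` Bad))).
  apply: le_measure; rewrite ?inE//; first exact: measurableU.
  by move=> t Et; have [?|nB] := pselect (Bad t); [right|left; apply: H => //; exact: HBad].
by apply: (le_trans (measureU2 _ _ _)) => //; exact: leeD2l.
Qed.

End good.

(** With [r = p^(1/4)] and [q = 1 / mu], fractional powers disappear: [e] is [64 r^2 q], the Gram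
    deviation is a multiple of [(r^3 q)^2], and [mu (r^2 q)^3 = (r^3 q)^2]. The signal condition
    [r^3 q <= k] and incoherence [x p q <= k] then bound every term by a multiple of [k]. *)
Lemma small_noise_ok (k p mu M tau L x1 x2 x3 r : R) :
  0 < tau -> tau <= 1 -> 0 <= M -> 1 <= r -> p = r ^+ 4 -> 0 < k ->
  400 * (64 ^+ 3 * (k * (M + 1) ^+ 2)) <= tau ->
  0 < mu -> r ^+ 3 <= k * mu ->
  (M + 1) ^+ 2 <= tau * L ->
  (forall x, x = x1 \/ x = x2 \/ x = x3 -> 0 <= x /\ x <= k /\ x * p <= k * mu) ->
  small_noise p mu M tau L x1 x2 x3.
Proof.
move=> t0 t1 M0 r1 pE k0; set c : R := 64 ^+ 3 => kN mu0 rk ML Hx.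
have r0 : 0 < r by lra.
have sp : Num.sqrt p = r ^+ 2.
  by rewrite pE (_ : r ^+ 4 = (r ^+ 2) ^+ 2) ?sqrtr_sqr ?ger0_norm ?sqr_ge0//; ring.
have c64 : 64 <= c by rewrite /c exprS ler_peMr// exprn_ege1// ler1n.
have cE (y : R) : (64 * y) ^+ 3 = c * y ^+ 3 by rewrite exprMn.
have cE2 (y : R) : 64 * (64 * y) ^+ 2 = c * y ^+ 2 by rewrite exprMn mulrA -exprS.
move: c => c in c64 cE cE2 kN *.
pose q := mu^-1.
have q0 : 0 < q by rewrite invr_gt0.
have r3 : r ^+ 3 * q <= k by rewrite /q ler_pdivrMr.
have rle m : (m <= 3)%N -> r ^+ m * q <= k.
  by move=> m3; apply: le_trans r3; rewrite ler_pM2r// ler_weXn2l.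
have r2 := rle 2 isT.
have q1 : q <= k by have := rle 0%N isT; rewrite expr0 mul1r.
have r2q0 : 0 <= r ^+ 2 * q by rewrite mulr_ge0 ?(ltW q0)// exprn_ge0// ltW.
have r3q0 : 0 <= r ^+ 3 * q by rewrite mulr_ge0 ?(ltW q0)// exprn_ge0// ltW.
have NM : 1 <= (M + 1) ^+ 2 /\ M <= (M + 1) ^+ 2 /\ M ^+ 2 <= (M + 1) ^+ 2.
  by rewrite sqrrD1 mulr2n; move: M0 (sqr_ge0 M); clear; lra.
set N := (M + 1) ^+ 2 in kN NM ML *.
have [N1 [NM1 NM2]] := NM.
have kN1 : k <= k * N by rewrite ler_peMr// ltW.
have kM : k * M <= k * N by rewrite ler_pM2l.
have kM2 : k * M ^+ 2 <= k * N by rewrite ler_pM2l.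
have c1 : 1 <= c by move: c64; clear; lra.
have c0 : 0 <= c := le_trans ler01 c1.
have kNc : k * N <= c * (k * N) by rewrite ler_peMl// mulr_ge0 ?(ltW k0)// (le_trans ler01).
have ck : c * k <= c * (k * N) by rewrite ler_wpM2l.
have k64 : 64 * k <= c * k by rewrite ler_pM2r.
set K := c * (k * N) in kN kNc ck.
have kk : k * k <= k.
  by rewrite ler_piMl// ?(ltW k0)//; move: k64 ck kN t1 k0; clear; lra.
have e2 : (r ^+ 2 * q) ^+ 2 <= k.
  by apply: le_trans kk; rewrite expr2; exact: ler_pM.
have r32 : (r ^+ 3 * q) ^+ 2 <= k.
  by apply: le_trans kk; rewrite expr2; exact: ler_pM.
have muq : mu * q = 1 by rewrite divff// gt_eqF.
have e3 : mu * (r ^+ 2 * q) ^+ 3 <= k.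
  have -> : mu * (r ^+ 2 * q) ^+ 3 = (r ^+ 3 * q) ^+ 2 * (mu * q) by ring.
  by rewrite muq mulr1.
have eE : 64 * Num.sqrt p / mu = 64 * (r ^+ 2 * q) by rewrite sp mulrA.
have kapE : kap0 p mu M = M * q + c * (r ^+ 2 * q) ^+ 2.
  by rewrite /kap0 eE cE2.
have Mq : M * q <= k * M by rewrite mulrC ler_wpM2r.
have es x : 0 <= x /\ x <= k /\ x * p <= k * mu -> entry_small p mu M tau x.
  move=> [x0 [xk xp]]; rewrite /entry_small eE sp cE -/q.
  have xpq : x * p * q <= k by rewrite ler_pdivrMr.
  have mr : M * (r ^+ 2 * q) <= k * M by rewrite mulrC ler_wpM2r.
  have m2 : M ^+ 2 * q <= k * M ^+ 2 by rewrite mulrC ler_wpM2r ?sqr_ge0.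
  have ce3 : c * (mu * (r ^+ 2 * q) ^+ 3) <= c * k by rewrite ler_wpM2l.
  rewrite (_ : _ + _ = 2 * (x * p * q) + 2 * (M * (r ^+ 2 * q)) + 2 * (M ^+ 2 * q)
     + 192 * (c * (mu * (r ^+ 2 * q) ^+ 3))); last first.
    by rewrite -/q; ring.
  by move: xpq mr m2 ce3 kM kM2 kN1 kNc ck kN t0; clear; lra.
have [x10 [x1k x1p]] := Hx x1 (or_introl erefl).
split; split.
- by rewrite eE; move: r2 k64 ck kN t1; clear; lra.
- have -> : 160 * (p * Num.sqrt p) / mu ^+ 2 = 160 * (r ^+ 3 * q) ^+ 2.
    by rewrite sp pE exprMn exprVn; ring.
  by move: r32 k64 ck kN t1; clear; lra.
- rewrite kapE.
  have h1 : M * q + c * (r ^+ 2 * q) ^+ 2 <= c * (k * (M + 1)).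
    have kM0 : 0 <= k * M by rewrite mulr_ge0// ltW.
    have : k * M <= c * (k * M) by rewrite ler_peMl.
    have : c * (r ^+ 2 * q) ^+ 2 <= c * k by rewrite ler_wpM2l.
    rewrite mulrDr mulr1 mulrDr; move: Mq; clear; lra.
  apply: (@le_trans _ _ (16 * (c * (k * (M + 1))) * (M + 1))).
    by rewrite ler_wpM2r ?ler_pM2l//; move: M0; clear; lra.
  rewrite [leLHS](_ : _ = 16 * K); last by rewrite /K /N; ring.
  by move: kN t0; clear; lra.
- rewrite kapE.
  rewrite [leLHS](_ : _ = 16 * (M * x1 * (mu * q) + c * (x1 * p * q * (mu * q)))); last first.
    by rewrite pE; ring.
  rewrite muq !mulr1.
  have h1 : M * x1 <= k * M by rewrite mulrC ler_wpM2r.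
  have h2 : c * (x1 * p * q) <= c * k by rewrite ler_wpM2l// ler_pdivrMr.
  by move: h1 h2 kM ck kNc kN t0; clear; lra.
- exact: ML.
- have : x1 ^+ 2 <= k by apply: le_trans kk; rewrite expr2; exact: ler_pM.
  by move: k64 ck kN t0 k0; clear; lra.
- by apply: es; apply: Hx; left.
- by apply: es; apply: Hx; right; left.
- by apply: es; apply: Hx; right; right.
Qed.

Lemma exists_small_scale (c N tau : R) : 0 < c -> 0 < N -> 0 < tau ->
  exists2 k, 0 < k & 400 * (c * (k * N)) <= tau.
Proof.
move=> c0 N0 t0; have den0 : 0 < 400 * (c * N) by rewrite mulr_gt0 ?mulr_gt0.
exists (tau / (400 * (c * N))); first exact: divr_gt0.
set k := tau / _; rewrite (_ : _ * _ = k * (400 * (c * N))); last by ring.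
by rewrite divfK// gt_eqF.
Qed.

Lemma expR_neg_le (y : R) : 0 <= y -> expR (- y) <= (1 + y)^-1.
Proof.
move=> y0; rewrite expRN lef_pV2 ?posrE ?expR_gt0 ?expR_ge1Dx//.
lra.
Qed.

(** Since [(1 + 6 tau)^-3 >= 1 - 18 tau], the loss [z - y] is at most [tau (60 + 18 z)]. *)
Lemma quantile_gap (tau z eta : R) : 0 < z -> 0 < eta -> 0 < tau -> tau <= 100^-1 ->
  60 * tau <= z -> tau * (4 * (60 + 18 * z)) <= eta ->
  let y := (z - 60 * tau) / (1 + 6 * tau) ^+ 3 in 0 <= y <= z /\ 2 * (z - y) <= eta / 2.
Proof.
move=> z0 eta0 t0 t1 tz te y.
have p3 : 1 <= (1 + 6 * tau) ^+ 3 by rewrite exprn_ege1//; lra.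
have yz : y <= z - 60 * tau.
  by rewrite /y ler_pdivrMr ?(lt_le_trans ltr01 p3)// ler_peMr// subr_ge0.
have y0 : 0 <= y by rewrite /y divr_ge0 ?subr_ge0// (le_trans ler01 p3).
have lo : (z - 60 * tau) * (1 - 18 * tau) <= y.
  rewrite /y ler_pdivlMr ?(lt_le_trans ltr01 p3)// -mulrA ler_piMr ?subr_ge0//.
  have : 0 <= tau ^+ 2 by exact: sqr_ge0.
  have h : 0 <= tau * tau * tau * (10 - tau) by rewrite !mulr_ge0 ?(ltW t0)//; lra.
  rewrite (_ : (1 - 18 * tau) * (1 + 6 * tau) ^+ 3 = 1 - 216 * (tau * tau) - 1728 * (tau * tau * tau)
     - 3888 * (tau * tau * tau * tau)); last by ring.
  have : 0 <= tau * tau by rewrite mulr_ge0 ?(ltW t0).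
  have : 0 <= tau * tau * tau by rewrite !mulr_ge0 ?(ltW t0).
  have : 0 <= tau * tau * tau * tau by rewrite !mulr_ge0 ?(ltW t0).
  lra.
have tt : 0 <= tau * tau by rewrite mulr_ge0 ?(ltW t0).
split; first by rewrite y0 (le_trans yz)// gerBl; lra.
by move: lo te tt t0; clear; lra.
Qed.

End ModelCoverage.

Theorem theorem8 (R : realType) (d : measure_display) (Omega : measurableType d)
    (P : probability Omega R) (p1 p2 p3 : nat -> nat) :
  let p := fun n => maxn (p1 n) (maxn (p2 n) (p3 n)) in
  (* p -> infinity *)
  (fun n => (p n)%:R : R) @ \oo --> +oo ->
  (* p_j comparable to p *)
  (exists c : R, 0 < c /\ forall n,
     c * (p n)%:R <= (p1 n)%:R /\ c * (p n)%:R <= (p2 n)%:R /\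
     c * (p n)%:R <= (p3 n)%:R) ->
  exists C1 : R, 0 < C1 /\
  forall (tmax : nat -> nat) (lam sigma : nat -> R)
    (u : forall n, vec R (p1 n)) (v : forall n, vec R (p2 n))
    (w : forall n, vec R (p3 n))
    (Z : forall n, Omega -> tensor3 R (p1 n) (p2 n) (p3 n))
    (u0 : forall n, Omega -> vec R (p1 n)) (v0 : forall n, Omega -> vec R (p2 n))
    (w0 : forall n, Omega -> vec R (p3 n))
    (i : forall n, 'I_(p1 n)) (j : forall n, 'I_(p2 n)) (k : forall n, 'I_(p3 n))
    (alpha z : R),
  let T := fun n => rank1 (lam n) (u n) (v n) (w n) in
  let A := fun n (om : Omega) => fun a b c => T n a b c + Z n om a b c in
  (* model *)
  (forall n, 0 < lam n) ->
  (forall n, 0 < sigma n) ->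
  (forall n, vnorm (u n) = 1 /\ vnorm (v n) = 1 /\ vnorm (w n) = 1) ->
  (forall n a b c, measurable_fun setT (fun om => Z n om a b c)) ->
  (forall n a b c (B : set R), measurable B ->
     P ((fun om => Z n om a b c) @^-1` B) = normal_prob 0 (sigma n) B) ->
  (forall n, mutually_independent P
     (fun abc : 'I_(p1 n) * 'I_(p2 n) * 'I_(p3 n) =>
        fun om => Z n om abc.1.1 abc.1.2 abc.2)) ->
  (* Algorithm 4: initialization and number of iterations *)
  (forall n om, leading_lsv (mat1 (A n om)) (u0 n om) /\
                leading_lsv (mat2 (A n om)) (v0 n om) /\
                leading_lsv (mat3 (A n om)) (w0 n om)) ->
  (forall n, C1 * ln ((p n)%:R) <= (tmax n)%:R) ->
  (* confidence level *)
  0 < alpha < 1 ->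
  std_normal_cdf z = (1 - alpha / 2)%:E ->
  (* signal strength and incoherence of the chosen entries *)
  (fun n => lam n / sigma n / ((p n)%:R `^ (3 / 4))) @ \oo --> +oo ->
  (fun n => `|u n (i n)| /
     Num.min (lam n / (sigma n * (p n)%:R)) (Num.sqrt (ln ((p n)%:R)))^-1)
    @ \oo --> 0 ->
  (fun n => `|v n (j n)| /
     Num.min (lam n / (sigma n * (p n)%:R)) (Num.sqrt (ln ((p n)%:R)))^-1)
    @ \oo --> 0 ->
  (fun n => `|w n (k n)| /
     Num.min (lam n / (sigma n * (p n)%:R)) (Num.sqrt (ln ((p n)%:R)))^-1)
    @ \oo --> 0 ->
  let coverage := fun n => [set om : Omega |
    let: (lh, uh, vh, wh) := alg4 (A n om) (u0 n om) (v0 n om) (w0 n om) (tmax n) in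
    let s := fun t : R => Num.max t (ln ((p n)%:R) * sigma n ^+ 2 / lh ^+ 2) in
    let S := Num.sqrt (s (uh (i n) ^+ 2) * s (vh (j n) ^+ 2)
                     + s (vh (j n) ^+ 2) * s (wh (k n) ^+ 2)
                     + s (wh (k n) ^+ 2) * s (uh (i n) ^+ 2)) in
    let That := rank1 lh uh vh wh (i n) (j n) (k n) in
    T n (i n) (j n) (k n) \in `[That - z * sigma n * S, That + z * sigma n * S]] in
  (* the coverage events are events *)
  (forall n, measurable (coverage n)) ->
  ((1 - alpha)%:E <= limn_einf (fun n => P (coverage n)))%E.
Proof.
move=> p pinf _; exists 1; split; first exact: ltr01.
move=> tmax lam sigma u v w Z u0 v0 w0 i j k alpha z T A lam0 sig0 units mZ lawZ indZ init.
move=> Htmax /andP[al0 al1] Hz snr Hu Hv Hw coverage mcov.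
have z0 := gauss_quantile_gt0 al1 Hz.
apply: limn_einf_ge => eta eta0.
(* This makes [expR (4 - M) <= eta / 128], so the [8 + 24] error terms depending on [M] cost
   [eta / 4]. The [2 + 12] terms decaying in [p] will be at most [eta / 56] each and cost another
   [eta / 4]. *)
pose M : R := 4 + 128 / eta.
have e128 : 0 < 128 / eta by rewrite divr_gt0.
have M4 : 4 <= M by rewrite /M lerDl ltW.
(* The caps serve, in order, the algebra of the expansion, nonnegativity of [z - 60 tau], and
   [quantile_gap]. *)
pose tau : R := Num.min 100^-1 (Num.min (z / 60) (eta / (4 * (60 + 18 * z)))).
have tau0 : 0 < tau by rewrite !lt_min invr_gt0 !divr_gt0 ?mulr_gt0//; lra.
have tau1 : tau <= 100^-1 by rewrite ge_min lexx.
have tauz : 60 * tau <= z.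
  by rewrite mulrC -ler_pdivlMr// !ge_min lexx orbT.
have taue : tau * (4 * (60 + 18 * z)) <= eta.
  by rewrite -ler_pdivlMr ?mulr_gt0//; [rewrite !ge_min lexx !orbT|lra].
have ME : M = 4 + 128 / eta by [].
move: M tau => M tau in M4 ME tau0 tau1 tauz taue *.
have M10 : 0 < M + 1 by move: M4; clear; lra.
have N0 : 0 < (M + 1) ^+ 2 by rewrite exprn_gt0.
have c0 : 0 < 64 ^+ 3 :> R by rewrite exprn_gt0.
have [kk kk0 kkN] := exists_small_scale c0 N0 tau0.
(* Once [ln p >= D], its square root is at least [(M + 1) ^+ 2 / tau], the margin by which
   truncation beats noise. *)
pose D : R := ((M + 1) ^+ 2 / tau) ^+ 2.
pose y := (z - 60 * tau) / (1 + 6 * tau) ^+ 3.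
have [yz gap] := quantile_gap z0 eta0 tau0 tau1 tauz taue; rewrite -/y in yz gap.
near=> n.
(* [16] keeps the Chernoff parameter [1 / sqrt p] below [1/4], [56 / eta] is for the error budget,
   and the exponential gives [ln p >= D + 3], where [3] is the number of iterations. *)
have pX : 16 + 56 / eta + expR (D + 3) <= (p n)%:R.
  by near: n; exact: cvgry_ge.
have snrn : kk^-1 <= lam n / sigma n / ((p n)%:R `^ (3 / 4)).
  by near: n; exact: cvgry_ge.
have Hun : `| `|u n (i n)| / Num.min (lam n / (sigma n * (p n)%:R)) (Num.sqrt (ln ((p n)%:R)))^-1 | <= kk.
  by near: n; exact: cvgr0_norm_le.
have Hvn : `| `|v n (j n)| / Num.min (lam n / (sigma n * (p n)%:R)) (Num.sqrt (ln ((p n)%:R)))^-1 | <= kk.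
  by near: n; exact: cvgr0_norm_le.
have Hwn : `| `|w n (k n)| / Num.min (lam n / (sigma n * (p n)%:R)) (Num.sqrt (ln ((p n)%:R)))^-1 | <= kk.
  by near: n; exact: cvgr0_norm_le.
set q : R := (p n)%:R in pX snrn Hun Hvn Hwn.
have e56 : 0 < 56 / eta by rewrite divr_gt0.
have expD := expR_gt0 (D + 3).
have q16 : 16 <= q by move: pX e56 expD; clear; lra.
have p16 : (16 <= p n)%N by rewrite -(ler_nat R).
have q0 : 0 < q by move: q16; clear; lra.
have D0 : 0 <= D by exact: sqr_ge0.
have lnq : D + 3 <= ln q.
  rewrite -ler_expR lnK ?posrE//; move: pX e56; clear; lra.
have ln0 : 0 <= ln q by move: lnq D0; clear; lra.
set L := Num.sqrt (ln q) in Hun Hvn Hwn.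
have L1 : 1 <= L by rewrite -[leLHS]sqrtr1 ler_sqrt//; move: lnq D0; clear; lra.
have ML : (M + 1) ^+ 2 <= tau * L.
  rewrite mulrC -ler_pdivrMr//.
  have : Num.sqrt D <= L by rewrite ler_sqrt//; move: lnq; clear; lra.
  by rewrite sqrtr_sqr ger0_norm// divr_ge0 ?sqr_ge0// ltW.
have t3 : (3 <= tmax n)%N.
  rewrite -(ltr_nat R) //; have := Htmax n; rewrite mul1r -/q.
  by apply: lt_le_trans; move: lnq D0; clear; lra.
pose r : R := Num.sqrt (Num.sqrt q).
have r1 : 1 <= r by rewrite -[leLHS]sqrtr1 ler_sqrt ?sqrtr_ge0// -[leLHS]sqrtr1 ler_sqrt ?(ltW q0)//;
  move: q16; clear; lra.
have r4 : q = r ^+ 4.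
  rewrite (_ : r ^+ 4 = (r ^+ 2) ^+ 2); last by ring.
  by rewrite sqr_sqrtr ?sqrtr_ge0// sqr_sqrtr// ltW.
have r3 : q `^ (3 / 4) = r ^+ 3.
  rewrite (_ : 3 / 4 = 2^-1 * 2^-1 * 3%:R); last by field.
  by rewrite !powRrM powR12_sqrt ?(ltW q0)// powR12_sqrt ?sqrtr_ge0// powR_mulrn// sqrtr_ge0.
pose mu := lam n / sigma n.
have mu0 : 0 < mu by rewrite divr_gt0.
have r0 : 0 < r := lt_le_trans ltr01 r1.
have rk : r ^+ 3 <= kk * mu.
  move: snrn; rewrite r3 -/mu ler_pdivlMr ?exprn_gt0// ler_pdivrMl//.
have entry (x : R) : `| `|x| / Num.min (lam n / (sigma n * q)) L^-1 | <= kk ->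
    0 <= `|x| /\ `|x| <= kk /\ `|x| * q <= kk * mu.
  have m1 : 0 < lam n / (sigma n * q) by rewrite divr_gt0// mulr_gt0.
  have L0 : 0 < L := lt_le_trans ltr01 L1.
  have m0 : 0 < Num.min (lam n / (sigma n * q)) L^-1 by rewrite lt_min m1 invr_gt0.
  rewrite ger0_norm ?divr_ge0 ?(ltW m0)// ler_pdivrMr// => hx; split => //; split.
    apply: le_trans hx _; rewrite ler_piMr ?(ltW kk0)// ge_min invf_le1// L1 orbT.
    by [].
  rewrite -ler_pdivlMr//; apply: le_trans hx _.
  have -> : kk * mu / q = kk * (lam n / (sigma n * q)) by rewrite /mu invfM !mulrA.
  by rewrite ler_pM2l// ge_min lexx.
have [/vnorm1 un1 [/vnorm1 vn1 /vnorm1 wn1]] := units n.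
have sn : small_noise q mu M tau L `|u n (i n)| `|v n (j n)| `|w n (k n)|.
  apply: (small_noise_ok tau0 _ _ r1 r4 kk0 kkN mu0 rk ML);
    [by move: tau1; clear; lra|by move: M4; clear; lra|].
  by move=> x [->|[->|->]]; apply: entry.
have HW := stdtensor_of_model (sig0 n) (mZ n) (lawZ n) (indZ n).
have pn1 : (p1 n <= p n)%N by rewrite leq_max leqnn.
have pn2 : (p2 n <= p n)%N by rewrite !leq_max leqnn orbT.
have pn3 : (p3 n <= p n)%N by rewrite !leq_max leqnn !orbT.
have M0 : 0 <= M by move: M4; clear; lra.
have G := whp_good (i n) (j n) (k n) HW pn1 pn2 pn3 p16 M0 un1 vn1 wn1.
set err := (X in whp P X _) in G.
have main := coverage_prob (u := u n) (v := v n) (w := w n) (i := i n) (j := j n) (k := k n)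
  HW (mcov n) (proj1 (andP yz)) G.
have {}main := main _.
have lo := gauss_two_sided yz Hz.
have errle : err <= eta / 2.
  have h1 : expR (- q) <= eta / 56.
    apply: (le_trans (expR_neg_le (ltW q0))).
    rewrite -[eta / 56]invrK lef_pV2 ?posrE ?invr_gt0 ?divr_gt0//; last by move: q0; clear; lra.
    by rewrite invf_div; move: pX expD; clear; lra.
  have h2 : expR (- (4 * q)) <= expR (- q) by rewrite ler_expR; move: q0; clear; lra.
  have h3 : expR (4 - M) <= eta / 128.
    rewrite (_ : 4 - M = - (128 / eta)); last by rewrite ME; ring.
    apply: (le_trans (expR_neg_le (ltW e128))).
    rewrite -[eta / 128]invrK lef_pV2 ?posrE ?invr_gt0 ?divr_gt0//; last by move: e128; clear; lra.
    by rewrite invf_div; clear; lra.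
  have h4 : expR (- (M ^+ 2 / 2)) <= expR (4 - M).
    by rewrite ler_expR; move: (sqr_ge0 (M - 1)); clear; lra.
  by rewrite /err -/q; move: h1 h2 h3 h4; clear; lra.
have : ((1 - alpha - 2 * (z - y))%:E <= P (coverage n) + err%:E)%E.
  apply: (le_trans lo); apply: main => t gt Gt.
  have [l1 [l2 l3]] := init n t.
  have Mpos : 0 < M by move: M4; clear; lra.
  pose G2 := \sum_l gcoef (u n) (v n) (w n) (i n) (j n) (k n) l ^+ 2.
  have BE : Num.sqrt G2 ^+ 2 = G2.
    by rewrite sqr_sqrtr// sumr_ge0// => l _; exact: sqr_ge0.
  have := coverage_det (lam0 n) (sig0 n) un1 vn1 wn1 (ltW q0) ln0 l1 l2 l3 t3 Mpos tau0 tau1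
    tauz sn gt (sqrtr_ge0 _) BE Gt.
  rewrite /coverage /= -/(A n t) -/q.
  by case: (alg4 _ _ _ _ _) => -[[lh uh] vh] wh.
rewrite -leeBlDr// => /(le_trans _); apply; rewrite -EFinB lee_fin.
by move: gap errle; clear; lra.
Unshelve. all: by end_near.
Qed.
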